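(* Let $\psi:\tau^0(A)\to\mathbb{C}$ be a linear map and suppose the irreducible highest weight module $V(\psi)$ for $\tau(A)$ has finite dimensional weight spaces with respect to $\bar{\mathfrak h}$. Assume that there is a co-finite ideal $I$ of $A$ such that $\psi(L_0\otimes I)=0$, $\psi(\tilde{\mathfrak h}\otimes\sqrt I)=0$, and $\psi$ is dominant integral with respect to $\sqrt I$. Then $V(\psi)$ is integrable.
   Context: All vector spaces and tensor products are over $\mathbb{C}$. Let $\mathfrak g$ be a simple finite dimensional Lie algebra with non-degenerate symmetric invariant bilinear form $(\cdot,\cdot)$. Let $\tilde{\mathfrak g}=\mathfrak g\otimes\mathbb{C}[t,t^{-1}]\oplus\mathbb{C}K$ with $K$ central and $[X\otimes t^n,Y\otimes t^m]=[X,Y]\otimes t^{m+n}+n\,\delta_{m+n,0}(X,Y)K$. Let $Vir=\bigoplus_{n\in\mathbb{Z}}\mathbb{C}L_n\oplus\mathbb{C}C_0$ with $C_0$ central and $[L_n,L_m]=(m-n)L_{n+m}+\delta_{n+m,0}\frac{n^3-n}{12}C_0$. Let $\bar\tau=Vir\ltimes\tilde{\mathfrak g}$ with $[L_n,X\otimes t^m]=mX\otimes t^{m+n}$ and $K$, $C_0$ central, and let $\tau=\bar\tau/\mathbb{C}(K-C_0)$. Let $A$ be a commutative associative finitely generated $\mathbb{C}$-algebra with unit. For a Lie algebra (or vector space) $\mathfrak g'$ put $\mathfrak g'(A)=\mathfrak g'\otimes A$ with bracket $[X\otimes a,Y\otimes b]=[X,Y]\otimes ab$, and write $X(a)=X\otimes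 a$. We regard $\tau\subset\tau(A)$ via $X\mapsto X\otimes 1$. An ideal $I$ of $A$ is co-finite if $\dim A/I<\infty$; $\sqrt I=\{a\in A: a^n\in I\text{ for some }n>0\}$. Let $\mathfrak g=\mathfrak n^-\oplus\mathfrak h\oplus\mathfrak n^+$ be a triangular decomposition with Cartan subalgebra $\mathfrak h$; $\tilde{\mathfrak h}=\mathfrak h\oplus\mathbb{C}K$, $\bar{\mathfrak h}=\tilde{\mathfrak h}\oplus\mathbb{C}L_0$, $N^{\pm}=\mathfrak n^{\pm}\oplus\bigoplus_{n>0}\mathfrak g\otimes t^{\pm n}$, $L^{\pm}=\bigoplus_{n>0}\mathbb{C}L_{\pm n}$. Put $\tau^{\pm}(A)=N^{\pm}(A)\oplus L^{\pm}(A)$ and $\tau^0(A)=\bar{\mathfrak h}(A)$, so $\tau(A)=\tau^-(A)\oplus\tau^0(A)\oplus\tau^+(A)$. For linear $\psi:\tau^0(A)\to\mathbb{C}$, $M(\psi)=U(\tau(A))\otimes_{U(\tau^0(A)\oplus\tau^+(A))}\mathbb{C}v$, where $\tau^+(A)$ acts on $\mathbb{C}v$ by zero and $\tau^0(A)$ acts via $\psi$; $V(\psi)$ is its unique irreducible quotient. Dominant integrality: for a co-finite ideal $I$, $\sqrt I=M_1\cap\dots\cap M_k$ with $M_i$ distinct maximal ideals and $A/\sqrt I\cong\bigoplus_{i=1}^k A/M_i\cong\mathbb{C}^k$. Choose $e_i\in A$ mapping to the $i$-th standard basis vector of $\mathbb{C}^k$. If $\psi(\tilde{\mathfrak h}\otimes\sqrt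 I)=0$, the restriction $\psi_i$ of $\psi$ to the $i$-th copy of $\tilde{\mathfrak h}$ in $\tilde{\mathfrak h}\otimes A/\sqrt I\cong\bigoplus_{i=1}^k\tilde{\mathfrak h}$, namely $\psi_i(h)=\psi(h\otimes e_i)$, is well defined. $\psi$ is dominant integral with respect to $\sqrt I$ if $\psi(\tilde{\mathfrak h}\otimes\sqrt I)=0$ and each $\psi_i$ is a dominant integral weight of $\tilde{\mathfrak g}$, i.e. $\psi_i(\alpha_j^\vee)\in\mathbb{Z}_{\ge 0}$ for $0\le j\le l$ and $1\le i\le k$, where $\alpha_1^\vee,\dots,\alpha_l^\vee\in\mathfrak h$ are the simple coroots of $\mathfrak g$ and $\alpha_0^\vee=\frac{2}{(\beta,\beta)}K-\beta^\vee$, with $\beta$ the highest root of $\mathfrak g$. Let $\overset{\circ}{\Delta}$ be the root system of $(\mathfrak g,\mathfrak h)$ and $\Delta^{real}=\{\alpha+n\delta:\alpha\in\overset{\circ}{\Delta},n\in\mathbb{Z}\}$; a root vector for $\alpha+n\delta$ is an element of $\mathfrak g_\alpha\otimes t^n$. A $\tau(A)$-module $V$ is integrable if: (i) $V=\bigoplus_{\lambda\in\bar{\mathfrak h}^*}V_\lambda$, where $V_\lambda=\{v\in V: hv=\lambda(h)v\ \forall h\in\bar{\mathfrak h}\}$, with $\dim V_\lambda<\infty$ for all $\lambda$; (ii) for any $v\in V$, $\alpha\in\Delta^{real}$, root vector $X_\alpha$ of root $\alpha$, and $a\in A$ there is $N=N(\alpha,v,a)$ such that $(X_\alpha(a))^N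 v=0$. *)

(* Defs.v *)
From HB Require Import structures.
From mathcomp Require Import all_boot all_order all_algebra.
From mathcomp Require Import boolp classical_sets functions cardinality fsbigop.
From mathcomp Require Import reals complex.
From mathcomp Require Import ring.

Set Implicit Arguments.
Unset Strict Implicit.
Unset Printing Implicit Defensive.

Import Order.TTheory GRing.Theory Num.Theory.
Local Open Scope ring_scope.
Local Open Scope classical_set_scope.
Local Open Scope quotient_scope.

Definition subspace (K : pzRingType) (V : lmodType K) (S : set V) : Prop :=
  S 0 /\ forall (c : K) u v, S u -> S v -> S (c *: u + v).

Definition lspan (K : pzRingType) (V : lmodType K) (X : set V) : set V :=
  [set v | forall S : set V, subspace S -> X `<=` S -> S v].

Definition fin_dim (K : pzRingType) (V : lmodType K) (S : set V) : Prop :=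
  exists2 s : seq V, (forall v, v \in s -> S v) &
    forall v, S v -> lspan [set` s] v.

HB.mixin Record Lmodule_isLie (K : pzRingType) g of GRing.Lmodule K g := {
  lie : g -> g -> g;
  lie_linearl : forall y, linear (lie^~ y);
  lie_linearr : forall x, linear (lie x);
  lie_xx : forall x, lie x x = 0;
  lie_jacobi : forall x y z,
    lie x (lie y z) + lie y (lie z x) + lie z (lie x y) = 0
}.

#[short(type="lieType")]
HB.structure Definition Lie (K : pzRingType) :=
  {g of GRing.Lmodule K g & Lmodule_isLie K g}.

#[short(type="finLieType")]
HB.structure Definition FinLie (K : nzRingType) :=
  {g of Vector K g & Lmodule_isLie K g}.

HB.mixin Record Lmodule_isLieModule (K : pzRingType) (L : lieType K) V
    of GRing.Lmodule K V := {
  act : L -> V -> V;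
  act_linearl : forall v, linear (act^~ v);
  act_linearr : forall x, linear (act x);
  act_lie : forall x y v,
    act (lie x y) v = act x (act y v) - act y (act x v)
}.

#[short(type="lieModType")]
HB.structure Definition LieModule (K : pzRingType) (L : lieType K) :=
  {V of GRing.Lmodule K V & Lmodule_isLieModule K L V}.

Section LieModules.
Variables (K : pzRingType) (L : lieType K).

Definition submodule (V : lieModType L) (S : set V) : Prop :=
  subspace S /\ forall (x : L) v, S v -> S (act x v).

Definition irreducible (V : lieModType L) : Prop :=
  (exists v : V, v <> 0) /\
  forall S : set V, submodule S -> S = [set 0] \/ S = setT.

Definition module_hom (V W : lieModType L) (f : V -> W) : Prop :=
  linear f /\ forall (x : L) v, f (act x v) = act x (f v).

Definition irreducible_quotient (M V : lieModType L) : Prop :=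
  irreducible V /\
  exists f : M -> V, module_hom f /\ forall w, exists v, f v = w.

End LieModules.

Section LieTheory.
Variables (K : pzRingType) (L : lieType K).
Implicit Types x y z : L.

HB.instance Definition _ (x : L) :=
  GRing.isLinear.Build K L L _ (lie x) (lie_linearr x).

Lemma lieDl x y z : lie (x + y) z = lie x z + lie y z.
Proof. by have := lie_linearl z 1 x y; rewrite !scale1r. Qed.
Lemma lie0l z : lie 0 z = 0.
Proof. by apply: (addrI (lie 0 z)); rewrite -lieDl !addr0. Qed.
Lemma lieZl c x z : lie (c *: x) z = c *: lie x z.
Proof. by have := lie_linearl z c x 0; rewrite lie0l !addr0. Qed.
Lemma lieNl x z : lie (- x) z = - lie x z.
Proof. by rewrite -scaleN1r lieZl scaleN1r. Qed.
Lemma lieC x y : lie x y = - lie y x.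
Proof.
have := lie_xx (x + y); rewrite lieDl !linearD /= !lie_xx add0r addr0.
by move/eqP; rewrite addr_eq0 => /eqP.
Qed.
Lemma lieDr x y z : lie x (y + z) = lie x y + lie x z.
Proof. exact: linearD. Qed.
Lemma lieZr c x y : lie x (c *: y) = c *: lie x y.
Proof. exact: linearZ. Qed.
Lemma lieNr x y : lie x (- y) = - lie x y.
Proof. exact: linearN. Qed.
Lemma lie0r x : lie x 0 = 0.
Proof. exact: linear0. Qed.
End LieTheory.

(* [tensb V W Bal] is the space generated by symbols [v (x) w], bilinear in
   [(v, w)], subject to [v (x) w = v' (x) w'] whenever [Bal v w v' w']. *)

Section Tensor.
Variables (K : pzRingType) (V W : lmodType K).
Variable Bal : V -> W -> V -> W -> Prop.

Inductive tterm : Type :=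
| TPure of V & W
| TZero
| TAdd of tterm & tterm
| TScale of K & tterm.

Inductive teq : tterm -> tterm -> Prop :=
| teq_refl t : teq t t
| teq_sym t u : teq t u -> teq u t
| teq_trans t u v : teq t u -> teq u v -> teq t v
| teq_add t t' u u' : teq t t' -> teq u u' -> teq (TAdd t u) (TAdd t' u')
| teq_scale c t t' : teq t t' -> teq (TScale c t) (TScale c t')
| teq_addA t u v : teq (TAdd t (TAdd u v)) (TAdd (TAdd t u) v)
| teq_addC t u : teq (TAdd t u) (TAdd u t)
| teq_add0 t : teq (TAdd TZero t) t
| teq_addN t : teq (TAdd (TScale (-1) t) t) TZero
| teq_scaleA a b t : teq (TScale a (TScale b t)) (TScale (a * b) t)
| teq_scale1 t : teq (TScale 1 t) t
| teq_scaleDr a t u :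
    teq (TScale a (TAdd t u)) (TAdd (TScale a t) (TScale a u))
| teq_scaleDl a b t :
    teq (TScale (a + b) t) (TAdd (TScale a t) (TScale b t))
| teq_linl a v v' w :
    teq (TPure (a *: v + v') w) (TAdd (TScale a (TPure v w)) (TPure v' w))
| teq_linr a v w w' :
    teq (TPure v (a *: w + w')) (TAdd (TScale a (TPure v w)) (TPure v w'))
| teq_bal v w v' w' : Bal v w v' w' -> teq (TPure v w) (TPure v' w').

HB.instance Definition _ := gen_eqMixin tterm.
HB.instance Definition _ := gen_choiceMixin tterm.

Definition teqb (t u : tterm) : bool := `[< teq t u >].
Lemma teqb_refl : reflexive teqb.
Proof. by move=> t; apply/asboolP; exact: teq_refl. Qed.
Lemma teqb_sym : symmetric teqb.
Proof. by move=> t u; apply/asboolP/asboolP; exact: teq_sym. Qed.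
Lemma teqb_trans : transitive teqb.
Proof.
by move=> u t v /asboolP h1 /asboolP h2; apply/asboolP; exact: teq_trans h1 h2.
Qed.
Canonical teqb_equiv := EquivRel teqb teqb_refl teqb_sym teqb_trans.

Definition tensb : Type := {eq_quot teqb}.
HB.instance Definition _ := Choice.on tensb.
HB.instance Definition _ := EqQuotient.on tensb.

Lemma tensP (t u : tterm) : \pi_tensb t = \pi_tensb u <-> teq t u.
Proof. by split=> [/eqmodP/asboolP//|h]; apply/eqmodP/asboolP. Qed.

Lemma tens_repr (t : tterm) : teq (repr (\pi_tensb t)) t.
Proof. by apply/tensP; rewrite reprK. Qed.

Definition tens_add (x y : tensb) : tensb := \pi_tensb (TAdd (repr x) (repr y)).
Definition tens_scale (c : K) (x : tensb) : tensb := \pi_tensb (TScale c (repr x)).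

Lemma tens_add_pi t u : tens_add (\pi t) (\pi u) = \pi_tensb (TAdd t u).
Proof. by apply/tensP/teq_add; exact: tens_repr. Qed.
Lemma tens_scale_pi c t : tens_scale c (\pi t) = \pi_tensb (TScale c t).
Proof. by apply/tensP/teq_scale; exact: tens_repr. Qed.

Lemma tens_addA : associative tens_add.
Proof.
move=> x y z; rewrite -[x]reprK -[y]reprK -[z]reprK !tens_add_pi.
exact/tensP/teq_addA.
Qed.
Lemma tens_addC : commutative tens_add.
Proof. by move=> x y; apply/tensP/teq_addC. Qed.
Lemma tens_add0 : left_id (\pi_tensb TZero) tens_add.
Proof.
by move=> x; rewrite -[x]reprK tens_add_pi; exact/tensP/teq_add0.
Qed.
Lemma tens_addN : left_inverse (\pi_tensb TZero) (tens_scale (-1)) tens_add.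
Proof.
move=> x; rewrite -[x]reprK tens_scale_pi tens_add_pi; exact/tensP/teq_addN.
Qed.
HB.instance Definition _ := GRing.isZmodule.Build tensb
  tens_addA tens_addC tens_add0 tens_addN.

Lemma tens_scaleA a b x : tens_scale a (tens_scale b x) = tens_scale (a * b) x.
Proof. by rewrite -[x]reprK !tens_scale_pi; exact/tensP/teq_scaleA. Qed.
Lemma tens_scale1 : left_id 1 tens_scale.
Proof. by move=> x; rewrite -[x]reprK tens_scale_pi; exact/tensP/teq_scale1. Qed.
Lemma tens_scaleDr : right_distributive tens_scale +%R.
Proof.
move=> a x y; rewrite -[x]reprK -[y]reprK [_ + _]tens_add_pi !tens_scale_pi.
by rewrite [RHS]tens_add_pi; exact/tensP/teq_scaleDr.
Qed.
Lemma tens_scaleDl x : {morph tens_scale^~ x : a b / a + b}.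
Proof.
move=> a b; rewrite -[x]reprK !tens_scale_pi [RHS]tens_add_pi.
exact/tensP/teq_scaleDl.
Qed.
HB.instance Definition _ := GRing.Zmodule_isLmodule.Build K tensb
  tens_scaleA tens_scale1 tens_scaleDr tens_scaleDl.

Definition pure (v : V) (w : W) : tensb := \pi_tensb (TPure v w).

Lemma pi_TAdd t u :
  \pi_tensb (TAdd t u) = (\pi_tensb t : tensb) + (\pi_tensb u : tensb).
Proof. by rewrite -tens_add_pi. Qed.
Lemma pi_TScale c t : \pi_tensb (TScale c t) = c *: (\pi_tensb t : tensb).
Proof. by rewrite -tens_scale_pi. Qed.

Lemma pure_linearl w : linear (pure^~ w).
Proof.
by move=> a v v'; rewrite /pure -pi_TScale -pi_TAdd; exact/tensP/teq_linl.
Qed.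
Lemma pure_linearr v : linear (pure v).
Proof.
by move=> a w w'; rewrite /pure -pi_TScale -pi_TAdd; exact/tensP/teq_linr.
Qed.
Lemma pure_bal v w v' w' : Bal v w v' w' -> pure v w = pure v' w'.
Proof. by move=> h; exact/tensP/teq_bal. Qed.

Lemma tens_ind (P : tensb -> Prop) : P 0 ->
  (forall a x y, P x -> P y -> P (a *: x + y)) ->
  (forall v w, P (pure v w)) -> forall x, P x.
Proof.
move=> P0 PL PP x; rewrite -[x]reprK; elim: (repr x) => //=.
- by move=> t Pt u Pu; rewrite pi_TAdd -[X in X + _]scale1r; exact: PL.
- by move=> c t Pt; rewrite pi_TScale -[X in P X]addr0; exact: PL.
Qed.

Section Lift.
Variables (U : lmodType K) (F : V -> W -> U).

Fixpoint teval (t : tterm) : U :=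
  match t with
  | TPure v w => F v w
  | TZero => 0
  | TAdd t u => teval t + teval u
  | TScale c t => c *: teval t
  end.

Definition tlift (x : tensb) : U := teval (repr x).

Hypotheses (Fl : forall w, linear (F^~ w)) (Fr : forall v, linear (F v))
  (Fb : forall v w v' w', Bal v w v' w' -> F v w = F v' w').

Lemma teval_eq t u : teq t u -> teval t = teval u.
Proof.
elim=> //=.
- by move=> ? ? ? _ -> _ ->.
- by move=> ? ? ? ? _ -> _ ->.
- by move=> ? ? ? _ ->.
- by move=> *; rewrite addrA.
- by move=> *; rewrite addrC.
- by move=> *; rewrite add0r.
- by move=> *; rewrite scaleN1r addNr.
- by move=> *; rewrite scalerA.
- by move=> *; rewrite scale1r.
- by move=> *; rewrite scalerDr.
- by move=> *; rewrite scalerDl.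
- by move=> *; exact: Fl.
- by move=> *; exact: Fr.
Qed.

Lemma tlift_pi t : tlift (\pi_tensb t) = teval t.
Proof. by apply: teval_eq; exact: tens_repr. Qed.
Lemma tlift_pure v w : tlift (pure v w) = F v w.
Proof. by rewrite tlift_pi. Qed.
Lemma tlift_linear : linear tlift.
Proof.
move=> a x y; rewrite -[x]reprK -[y]reprK -pi_TScale -pi_TAdd.
by rewrite !tlift_pi.
Qed.
End Lift.

End Tensor.

Definition tensor (K : pzRingType) (V W : lmodType K) : Type :=
  @tensb K V W (fun _ _ _ _ => False).
HB.instance Definition _ (K : pzRingType) (V W : lmodType K) :=
  GRing.Lmodule.on (tensor V W).

Definition tmul (K : pzRingType) (V W : lmodType K) (v : V) (w : W) :
  tensor V W := pure _ v w.

Definition tensor_mapl (K : pzRingType) (V V' W : lmodType K) (f : V -> V') :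
  tensor V W -> tensor V' W := tlift (fun v w => tmul (f v) w).

Section CurrentAlgebra.
Variables (K : numFieldType) (L : lieType K) (A : comAlgType K).

Definition current : Type := tensor L A.
HB.instance Definition _ := GRing.Lmodule.on current.

Definition cur (x : L) (a : A) : current := tmul x a.

Let lie1 (x : L) (a : A) : current -> current :=
  tlift (fun (y : L) (b : A) => cur (lie x y) (a * b)).
Definition cur_lie (s t : current) : current :=
  tlift (fun (x : L) (a : A) => lie1 x a t) s.

Lemma cur_linearl a : linear (cur^~ a).
Proof. exact: pure_linearl. Qed.
Lemma cur_linearr x : linear (cur x).
Proof. exact: pure_linearr. Qed.

Lemma current_ind (P : current -> Prop) : P 0 ->
  (forall c s t, P s -> P t -> P (c *: s + t)) ->
  (forall x a, P (cur x a)) -> forall t, P t.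
Proof. exact: tens_ind. Qed.

Let lie1_pure x a y b : lie1 x a (cur y b) = cur (lie x y) (a * b).
Proof.
apply: tlift_pure => // [{}b c u v|{}y c u v]; first by rewrite linearP cur_linearl.
by rewrite mulrDr -scalerAr cur_linearr.
Qed.
Let lie1_linear x a : linear (lie1 x a).
Proof.
apply: tlift_linear => // [b c u v|y c u v]; first by rewrite linearP cur_linearl.
by rewrite mulrDr -scalerAr cur_linearr.
Qed.

Let lie1_l a t : linear (fun x => lie1 x a t).
Proof.
move=> c x x'; elim/current_ind: t => [|d s t IHs IHt|y b].
- have e x0 : lie1 x0 a 0 = 0.
    by apply: (addrI (lie1 x0 a 0)); rewrite -[X in X + _]scale1r -lie1_linear
       scale1r !addr0.
  by rewrite !e scaler0 addr0.
- by rewrite !lie1_linear IHs IHt !scalerDr !scalerA [c * d]mulrC addrACA.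
- by rewrite !lie1_pure lieDl lieZl cur_linearl.
Qed.
Let lie1_r x t : linear (fun a => lie1 x a t).
Proof.
move=> c a a'; elim/current_ind: t => [|d s t IHs IHt|y b].
- have e x0 : lie1 x x0 0 = 0.
    by apply: (addrI (lie1 x x0 0)); rewrite -[X in X + _]scale1r -lie1_linear
       scale1r !addr0.
  by rewrite !e scaler0 addr0.
- by rewrite !lie1_linear IHs IHt !scalerDr !scalerA [c * d]mulrC addrACA.
- by rewrite !lie1_pure mulrDl -scalerAl cur_linearr.
Qed.

Let cur_lie1 x a t : cur_lie (cur x a) t = lie1 x a t.
Proof.
exact: (tlift_pure (F := fun x0 a0 => lie1 x0 a0 t)).
Qed.
Lemma cur_lieE x a y b : cur_lie (cur x a) (cur y b) = cur (lie x y) (a * b).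
Proof. by rewrite cur_lie1 lie1_pure. Qed.
Let curl t : linear (cur_lie^~ t).
Proof. by apply: tlift_linear. Qed.
Let curr s : linear (cur_lie s).
Proof.
move=> c t t'; elim/current_ind: s => [|d s s' IHs IHs'|x a].
- have e t0 : cur_lie 0 t0 = 0.
    by apply: (addrI (cur_lie 0 t0)); rewrite -[X in X + _]scale1r -curl
       scale1r !addr0.
  by rewrite !e scaler0 addr0.
- by rewrite !curl IHs IHs' !scalerDr !scalerA [c * d]mulrC addrACA.
- by rewrite !cur_lie1 lie1_linear.
Qed.

Let cur_lie0 s : cur_lie s 0 = 0.
Proof.
apply: (addrI (cur_lie s 0)).
by rewrite -[X in X + _]scale1r -curr scale1r !addr0.
Qed.
Let cur_0lie s : cur_lie 0 s = 0.
Proof.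
apply: (addrI (cur_lie 0 s)).
by rewrite -[X in X + _]scale1r -curl scale1r !addr0.
Qed.

Let curD x y a : cur (x + y) a = cur x a + cur y a.
Proof. by have := cur_linearl a 1 x y; rewrite !scale1r. Qed.
Let cur0 a : cur 0 a = 0.
Proof. by apply: (addrI (cur 0 a)); rewrite -curD !addr0. Qed.
Let curN x a : cur (- x) a = - cur x a.
Proof. by apply/eqP; rewrite -addr_eq0 -curD addNr cur0. Qed.

Let cur_lieC s t : cur_lie s t = - cur_lie t s.
Proof.
elim/current_ind: s => [|c s s' IHs IHs'|x a].
- by rewrite cur_lie0 cur_0lie oppr0.
- by rewrite curl curr IHs IHs' opprD scalerN.
elim/current_ind: t => [|c s s' IHs IHs'|y b].
- by rewrite cur_lie0 cur_0lie oppr0.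
- by rewrite curl curr IHs IHs' opprD scalerN.
by rewrite !cur_lieE lieC [a * b]mulrC curN.
Qed.
Lemma cur_lie_xx s : cur_lie s s = 0.
Proof.
have /eqP := cur_lieC s s; rewrite -addr_eq0 -mulr2n -scaler_nat scaler_eq0.
by rewrite pnatr_eq0 => /eqP.
Qed.

Let add3Z c (a b d a' b' d' : current) :
  c *: a + a' + (c *: b + b') + (c *: d + d') =
  c *: (a + b + d) + (a' + b' + d').
Proof. by rewrite !scalerDr (addrACA (c *: a)) (addrACA (c *: a + c *: b)). Qed.

Lemma cur_lie_jacobi s t u :
  cur_lie s (cur_lie t u) + cur_lie t (cur_lie u s) + cur_lie u (cur_lie s t)
  = 0.
Proof.
elim/current_ind: s => [|c s s' IHs IHs'|x a].
- by rewrite !(cur_lie0, cur_0lie) !addr0.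
- by rewrite !(curl, curr) add3Z IHs IHs' scaler0 addr0.
elim/current_ind: t => [|c s s' IHs IHs'|y b].
- by rewrite !(cur_lie0, cur_0lie) !addr0.
- by rewrite !(curl, curr) add3Z IHs IHs' scaler0 addr0.
elim/current_ind: u => [|c s s' IHs IHs'|z d].
- by rewrite !(cur_lie0, cur_0lie) !addr0.
- by rewrite !(curl, curr) add3Z IHs IHs' scaler0 addr0.
rewrite !cur_lieE.
have -> : b * (d * a) = a * (b * d) by rewrite mulrA mulrC.
have -> : d * (a * b) = a * (b * d) by rewrite mulrC mulrA.
by rewrite -!curD lie_jacobi cur0.
Qed.

HB.instance Definition _ := Lmodule_isLie.Build K current
  curl curr cur_lie_xx cur_lie_jacobi.

Lemma lie_cur (x y : L) (a b : A) :
  lie (cur x a) (cur y b) = cur (lie x y) (a * b).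
Proof. exact: cur_lieE. Qed.

End CurrentAlgebra.

(* [U(L)] is the unital associative algebra generated by symbols [UGen x],
   linear in [x : L], subject to [xy - yx = [x, y]]. *)

Section Enveloping.
Variables (K : fieldType) (L : lieType K).

Inductive uterm : Type :=
| UGen of L
| UZero
| UOne
| UAdd of uterm & uterm
| UScale of K & uterm
| UMul of uterm & uterm.

Inductive ueq : uterm -> uterm -> Prop :=
| ueq_refl t : ueq t t
| ueq_sym t u : ueq t u -> ueq u t
| ueq_trans t u v : ueq t u -> ueq u v -> ueq t v
| ueq_add t t' u u' : ueq t t' -> ueq u u' -> ueq (UAdd t u) (UAdd t' u')
| ueq_scale c t t' : ueq t t' -> ueq (UScale c t) (UScale c t')
| ueq_mul t t' u u' : ueq t t' -> ueq u u' -> ueq (UMul t u) (UMul t' u')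
| ueq_addA t u v : ueq (UAdd t (UAdd u v)) (UAdd (UAdd t u) v)
| ueq_addC t u : ueq (UAdd t u) (UAdd u t)
| ueq_add0 t : ueq (UAdd UZero t) t
| ueq_addN t : ueq (UAdd (UScale (-1) t) t) UZero
| ueq_scaleA a b t : ueq (UScale a (UScale b t)) (UScale (a * b) t)
| ueq_scale1 t : ueq (UScale 1 t) t
| ueq_scaleDr a t u :
    ueq (UScale a (UAdd t u)) (UAdd (UScale a t) (UScale a u))
| ueq_scaleDl a b t :
    ueq (UScale (a + b) t) (UAdd (UScale a t) (UScale b t))
| ueq_mulA t u v : ueq (UMul t (UMul u v)) (UMul (UMul t u) v)
| ueq_mul1 t : ueq (UMul UOne t) t
| ueq_mulr1 t : ueq (UMul t UOne) t
| ueq_mulDl t u v : ueq (UMul (UAdd t u) v) (UAdd (UMul t v) (UMul u v))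
| ueq_mulDr t u v : ueq (UMul t (UAdd u v)) (UAdd (UMul t u) (UMul t v))
| ueq_scaleAl a t u : ueq (UScale a (UMul t u)) (UMul (UScale a t) u)
| ueq_scaleAr a t u : ueq (UScale a (UMul t u)) (UMul t (UScale a u))
| ueq_gen a x y : ueq (UGen (a *: x + y)) (UAdd (UScale a (UGen x)) (UGen y))
| ueq_lie x y : ueq (UMul (UGen x) (UGen y))
    (UAdd (UMul (UGen y) (UGen x)) (UGen (lie x y))).

HB.instance Definition _ := gen_eqMixin uterm.
HB.instance Definition _ := gen_choiceMixin uterm.

Definition ueqb (t u : uterm) : bool := `[< ueq t u >].
Lemma ueqb_refl : reflexive ueqb.
Proof. by move=> t; apply/asboolP; exact: ueq_refl. Qed.
Lemma ueqb_sym : symmetric ueqb.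
Proof. by move=> t u; apply/asboolP/asboolP; exact: ueq_sym. Qed.
Lemma ueqb_trans : transitive ueqb.
Proof.
by move=> u t v /asboolP h1 /asboolP h2; apply/asboolP; exact: ueq_trans h1 h2.
Qed.
Canonical ueqb_equiv := EquivRel ueqb ueqb_refl ueqb_sym ueqb_trans.

Definition env : Type := {eq_quot ueqb}.
HB.instance Definition _ := Choice.on env.
HB.instance Definition _ := EqQuotient.on env.

Lemma envP (t u : uterm) : \pi_env t = \pi_env u <-> ueq t u.
Proof. by split=> [/eqmodP/asboolP//|h]; apply/eqmodP/asboolP. Qed.

Lemma env_repr (t : uterm) : ueq (repr (\pi_env t)) t.
Proof. by apply/envP; rewrite reprK. Qed.

Definition env_add (x y : env) : env := \pi_env (UAdd (repr x) (repr y)).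
Definition env_scale (c : K) (x : env) : env := \pi_env (UScale c (repr x)).
Definition env_mul (x y : env) : env := \pi_env (UMul (repr x) (repr y)).

Lemma env_add_pi t u : env_add (\pi t) (\pi u) = \pi_env (UAdd t u).
Proof. by apply/envP/ueq_add; exact: env_repr. Qed.
Lemma env_scale_pi c t : env_scale c (\pi t) = \pi_env (UScale c t).
Proof. by apply/envP/ueq_scale; exact: env_repr. Qed.
Lemma env_mul_pi t u : env_mul (\pi t) (\pi u) = \pi_env (UMul t u).
Proof. by apply/envP/ueq_mul; exact: env_repr. Qed.
Let env_pi := (env_add_pi, env_scale_pi, env_mul_pi).

Lemma env_addA : associative env_add.
Proof.
move=> x y z; rewrite -[x]reprK -[y]reprK -[z]reprK !env_pi.
exact/envP/ueq_addA.
Qed.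
Lemma env_addC : commutative env_add.
Proof. by move=> x y; apply/envP/ueq_addC. Qed.
Lemma env_add0 : left_id (\pi_env UZero) env_add.
Proof. by move=> x; rewrite -[x]reprK !env_pi; exact/envP/ueq_add0. Qed.
Lemma env_addN : left_inverse (\pi_env UZero) (env_scale (-1)) env_add.
Proof. by move=> x; rewrite -[x]reprK !env_pi; exact/envP/ueq_addN. Qed.
HB.instance Definition _ := GRing.isZmodule.Build env
  env_addA env_addC env_add0 env_addN.

Lemma env_scaleA a b x : env_scale a (env_scale b x) = env_scale (a * b) x.
Proof. by rewrite -[x]reprK !env_pi; exact/envP/ueq_scaleA. Qed.
Lemma env_scale1 : left_id 1 env_scale.
Proof. by move=> x; rewrite -[x]reprK !env_pi; exact/envP/ueq_scale1. Qed.
Lemma env_scaleDr : right_distributive env_scale +%R.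
Proof.
move=> a x y; rewrite -[x]reprK -[y]reprK [_ + _]env_add_pi !env_scale_pi.
by rewrite [RHS]env_add_pi; exact/envP/ueq_scaleDr.
Qed.
Lemma env_scaleDl x : {morph env_scale^~ x : a b / a + b}.
Proof.
move=> a b; rewrite -[x]reprK !env_scale_pi [RHS]env_add_pi.
exact/envP/ueq_scaleDl.
Qed.
HB.instance Definition _ := GRing.Zmodule_isLmodule.Build K env
  env_scaleA env_scale1 env_scaleDr env_scaleDl.

Lemma env_mulA : associative env_mul.
Proof.
move=> x y z; rewrite -[x]reprK -[y]reprK -[z]reprK !env_pi.
exact/envP/ueq_mulA.
Qed.
Lemma env_mul1 : left_id (\pi_env UOne) env_mul.
Proof. by move=> x; rewrite -[x]reprK !env_pi; exact/envP/ueq_mul1. Qed.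
Lemma env_mulr1 : right_id (\pi_env UOne) env_mul.
Proof. by move=> x; rewrite -[x]reprK !env_pi; exact/envP/ueq_mulr1. Qed.
Lemma env_mulDl : left_distributive env_mul +%R.
Proof.
move=> x y z; rewrite -[x]reprK -[y]reprK -[z]reprK [_ + _]env_add_pi !env_mul_pi.
by rewrite [RHS]env_add_pi; exact/envP/ueq_mulDl.
Qed.
Lemma env_mulDr : right_distributive env_mul +%R.
Proof.
move=> x y z; rewrite -[x]reprK -[y]reprK -[z]reprK [_ + _]env_add_pi !env_mul_pi.
by rewrite [RHS]env_add_pi; exact/envP/ueq_mulDr.
Qed.

(* The augmentation [U(L) -> K] kills [L]; it shows that [1 <> 0] in [U(L)]. *)
Fixpoint uaug (t : uterm) : K :=
  match t with
  | UGen _ | UZero => 0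
  | UOne => 1
  | UAdd t u => uaug t + uaug u
  | UScale c t => c * uaug t
  | UMul t u => uaug t * uaug u
  end.
Lemma uaug_eq t u : ueq t u -> uaug t = uaug u.
Proof.
elim=> //=.
- by move=> ? ? ? _ -> _ ->.
- by move=> ? ? ? ? _ -> _ ->.
- by move=> ? ? ? _ ->.
- by move=> ? ? ? ? _ -> _ ->.
- by move=> *; rewrite addrA.
- by move=> *; rewrite addrC.
- by move=> *; rewrite add0r.
- by move=> *; rewrite mulN1r addNr.
- by move=> *; rewrite mulrA.
- by move=> *; rewrite mul1r.
- by move=> *; rewrite mulrDr.
- by move=> *; rewrite mulrDl.
- by move=> *; rewrite mulrA.
- by move=> *; rewrite mul1r.
- by move=> *; rewrite mulr1.
- by move=> *; rewrite mulrDl.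
- by move=> *; rewrite mulrDr.
- by move=> *; rewrite mulrA.
- by move=> *; rewrite mulrCA.
- by move=> *; rewrite mulr0 addr0.
- by move=> *; rewrite mulr0 addr0.
Qed.
Lemma env_one_neq0 : \pi_env UOne != 0 :> env.
Proof.
apply/eqP => h; have /envP/uaug_eq/eqP : \pi_env UOne = \pi_env UZero by [].
by rewrite /= oner_eq0.
Qed.

HB.instance Definition _ := GRing.Zmodule_isNzRing.Build env
  env_mulA env_mul1 env_mulr1 env_mulDl env_mulDr env_one_neq0.

Lemma env_scaleAl a (x y : env) : a *: (x * y) = (a *: x) * y.
Proof.
rewrite -[x]reprK -[y]reprK [_ * _]env_mul_pi ![_ *: _]env_scale_pi.
by rewrite [RHS]env_mul_pi; exact/envP/ueq_scaleAl.
Qed.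
Lemma env_scaleAr a (x y : env) : a *: (x * y) = x * (a *: y).
Proof.
rewrite -[x]reprK -[y]reprK [_ * _]env_mul_pi ![_ *: _]env_scale_pi.
by rewrite [RHS]env_mul_pi; exact/envP/ueq_scaleAr.
Qed.
HB.instance Definition _ := GRing.Lmodule_isLalgebra.Build K env env_scaleAl.
HB.instance Definition _ := GRing.Lalgebra_isAlgebra.Build K env env_scaleAr.

Definition inj_env (x : L) : env := \pi_env (UGen x).

Lemma inj_env_linear : linear inj_env.
Proof.
move=> a x y; have -> := env_scale_pi a (UGen x) : a *: inj_env x = _.
by rewrite [RHS]env_add_pi; exact/envP/ueq_gen.
Qed.
HB.instance Definition _ :=
  GRing.isLinear.Build K L env _ inj_env inj_env_linear.

Lemma inj_env_lie x y :
  inj_env (lie x y) = inj_env x * inj_env y - inj_env y * inj_env x.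
Proof.
apply/esym/eqP; rewrite subr_eq addrC; apply/eqP.
have -> := env_mul_pi (UGen y) (UGen x) : inj_env y * inj_env x = _.
by rewrite [LHS]env_mul_pi [RHS]env_add_pi; exact/envP/ueq_lie.
Qed.

Lemma pi_UAdd t u :
  \pi_env (UAdd t u) = (\pi_env t : env) + (\pi_env u : env).
Proof. by rewrite -env_add_pi. Qed.
Lemma pi_UScale c t : \pi_env (UScale c t) = c *: (\pi_env t : env).
Proof. by rewrite -env_scale_pi. Qed.
Lemma pi_UMul t u :
  \pi_env (UMul t u) = (\pi_env t : env) * (\pi_env u : env).
Proof. by rewrite -env_mul_pi. Qed.

Lemma env_ind (P : env -> Prop) : P 1 ->
  (forall a x y, P x -> P y -> P (a *: x + y)) ->
  (forall x y, P x -> P y -> P (x * y)) ->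
  (forall x, P (inj_env x)) -> forall u, P u.
Proof.
move=> P1 PL PM PG u.
have P0 : P 0 by have := PL (-1) 1 1 P1 P1; rewrite scaleN1r addNr.
rewrite -[u]reprK; elim: (repr u) => //=.
- by move=> t Pt v Pv; rewrite pi_UAdd -[X in X + _]scale1r; exact: PL.
- by move=> c t Pt; rewrite pi_UScale -[X in P X]addr0; exact: PL.
- by move=> t Pt v Pv; rewrite pi_UMul; exact: PM.
Qed.

End Enveloping.

(* For a subalgebra [b] of [L] acting on the line [K v] through scalars, the
   relation [chi y c] says that [y] is in [b] and acts by [c].  The induced
   module [U(L) (x)_{U(b)} K v] is [U(L) (x)_K K v] modulo the relations
   [u y (x) z = u (x) y z]; as [U(b)] is generated by [b], it is enough to
   impose them for [y] in [b]. *)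

Section Induced.
Variables (K : fieldType) (L : lieType K) (chi : L -> K -> Prop).

Definition ind_bal (u : env L) (z : K^o) (u' : env L) (z' : K^o) : Prop :=
  exists (y : L) (c : K),
    [/\ chi y c, u = u' * inj_env y & z' = c *: z].

Definition induced : Type := tensb ind_bal.
HB.instance Definition _ := GRing.Lmodule.on induced.

Definition ind_pure (u : env L) (z : K^o) : induced := pure ind_bal u z.

Definition ind_act (x : L) : induced -> induced :=
  tlift (fun u z => ind_pure (inj_env x * u) z).

Let F_l x z : linear (fun u => ind_pure (inj_env x * u) z).
Proof. by move=> a u v; rewrite mulrDr -scalerAr; exact: pure_linearl. Qed.
Let F_r x u : linear (fun z => ind_pure (inj_env x * u) z).
Proof. by move=> a z z'; exact: pure_linearr. Qed.
Let F_b x u z u' z' : ind_bal u z u' z' ->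
  ind_pure (inj_env x * u) z = ind_pure (inj_env x * u') z'.
Proof.
case=> y [c [hc -> ->]]; apply: pure_bal; exists y, c; split=> //.
exact: mulrA.
Qed.

Lemma ind_act_pure x u z :
  ind_act x (ind_pure u z) = ind_pure (inj_env x * u) z.
Proof.
apply: tlift_pure; [exact: F_l | exact: F_r | exact: F_b].
Qed.
Lemma ind_act_linearr x : linear (ind_act x).
Proof.
apply: tlift_linear; [exact: F_l | exact: F_r | exact: F_b].
Qed.
Let ind_act0 x : ind_act x 0 = 0.
Proof.
apply: (addrI (ind_act x 0)).
by rewrite -[X in X + _]scale1r -ind_act_linearr scale1r !addr0.
Qed.
Lemma ind_act_linearl t : linear (ind_act^~ t).
Proof.
move=> a x y; elim/tens_ind: t => [|c s t IHs IHt|u z].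
- by rewrite !ind_act0 scaler0 addr0.
- by rewrite !ind_act_linearr IHs IHt !scalerDr !scalerA [a * c]mulrC addrACA.
rewrite !ind_act_pure linearP mulrDl -scalerAl; exact: pure_linearl.
Qed.
Lemma ind_act_lie x y t :
  ind_act (lie x y) t = ind_act x (ind_act y t) - ind_act y (ind_act x t).
Proof.
elim/tens_ind: t => [|c s t IHs IHt|u z].
- by rewrite !ind_act0 subr0.
- by rewrite !ind_act_linearr IHs IHt scalerBr opprD addrACA.
rewrite !ind_act_pure inj_env_lie mulrBl -!mulrA.
have := pure_linearl ind_bal z (-1) (inj_env y * (inj_env x * u))
  (inj_env x * (inj_env y * u)).
by rewrite !scaleN1r /ind_pure [in X in _ -> X]addrC => ->; rewrite addrC.
Qed.

HB.instance Definition _ := Lmodule_isLieModule.Build K L induced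
  ind_act_linearl ind_act_linearr ind_act_lie.

End Induced.

(* [loop V] is [V (x) C[t, t^-1]], realized as the finitely supported functions
   [int -> V]; [mono n v] is [v (x) t^n]. *)

Section Loop.
Variables (K : pzRingType) (V : lmodType K).

Definition loop_pred : {pred int -> V} :=
  [pred f | `[< finite_set [set n | f n <> 0] >]].

Lemma loop_submod : submod_closed loop_pred.
Proof.
split=> [|c f g]; rewrite !inE.
  by apply: (@sub_finite_set _ _ set0) => // n /=; apply.
move=> ff fg.
apply: (@sub_finite_set _ _ ([set n | f n <> 0] `|` [set n | g n <> 0])).
  move=> n /= h; apply: contrapT => /not_orP[/contrapT f0 /contrapT g0].
  apply: h; have -> : (c *: f + g) n = c *: f n + g n by [].
  by rewrite f0 g0 addr0 scaler0.
by rewrite finite_setU.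
Qed.

Record loop : Type := Loop { loop_fun :> int -> V; _ : loop_pred loop_fun }.
HB.instance Definition _ := [isSub for loop_fun].
HB.instance Definition _ := [Choice of loop by <:].
HB.instance Definition _ := GRing.SubChoice_isSubLmodule.Build K _ _ loop
  (GRing.submod_closed_semi loop_submod).

Lemma loopD (f g : loop) n : (f + g) n = f n + g n.
Proof. by []. Qed.
Lemma loopZ c (f : loop) n : (c *: f) n = c *: f n.
Proof. by []. Qed.
Lemma loop0 n : (0 : loop) n = 0.
Proof. by []. Qed.
Lemma loopP (f g : loop) : (forall n, f n = g n) <-> f = g.
Proof. by split=> [h|->//]; apply/val_inj/funext. Qed.
Lemma loop_finite (f : loop) : finite_set [set n | f n <> 0].
Proof. by apply/asboolP; exact: (valP f). Qed.

Lemma mono_subproof (n : int) (v : V) :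
  loop_pred (fun m => if m == n then v else 0).
Proof.
apply/asboolP; apply: (@sub_finite_set _ _ [set n]) => // m /=.
by case: eqP.
Qed.
Definition mono (n : int) (v : V) : loop := Loop (mono_subproof n v).

Lemma monoE n v m : mono n v m = if m == n then v else 0.
Proof. by []. Qed.
Lemma mono_linear n : linear (mono n).
Proof.
move=> c u v; apply/loopP => m; rewrite loopD loopZ !monoE.
by case: eqP; rewrite ?scaler0 ?addr0.
Qed.
HB.instance Definition _ n :=
  GRing.isLinear.Build K V loop _ (mono n) (mono_linear n).

Section Extension.
Variables (W : lmodType K) (phi : int -> V -> W).

(* The linear map [loop V -> W] that sends [v (x) t^n] to [phi n v]. *)
Definition loop_ext (f : loop) : W := (\sum_(n \in [set: int]) phi n (f n))%R.

Hypothesis phi_lin : forall n, linear (phi n).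

Let phi0 n : phi n 0 = 0.
Proof.
apply: (addrI (phi n 0)).
by rewrite -[X in X + _]scale1r -phi_lin scale1r !addr0.
Qed.

Let loop_extE (f : loop) (r : seq int) : uniq r ->
  (forall n, n \notin r -> f n = 0) -> loop_ext f = \sum_(n <- r) phi n (f n).
Proof.
move=> ur hr; rewrite /loop_ext (fsbigE r) //.
  by apply: eq_bigl => n; rewrite in_setT.
by move=> n _ /hr ->.
Qed.

Lemma loop_ext_linear : linear loop_ext.
Proof.
move=> c f g.
have /finite_seqP[X hX] : finite_set ([set n | f n <> 0] `|` [set n | g n <> 0]).
  by rewrite finite_setU; split; exact: loop_finite.
have f0 n : n \notin undup X -> f n = 0.
  rewrite mem_undup => nX; apply: contrapT => h; move/negP: nX; apply.
  by have : [set` X] n by rewrite -hX; left.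
have g0 n : n \notin undup X -> g n = 0.
  rewrite mem_undup => nX; apply: contrapT => h; move/negP: nX; apply.
  by have : [set` X] n by rewrite -hX; right.
rewrite !(@loop_extE _ (undup X)) ?undup_uniq //; last first.
  by move=> n nX; rewrite loopD loopZ f0 // g0 // scaler0 addr0.
rewrite scaler_sumr -big_split; apply: eq_bigr => n _.
exact: phi_lin.
Qed.

Lemma loop_ext_mono n v : loop_ext (mono n v) = phi n v.
Proof.
rewrite (@loop_extE _ [:: n]) // ?big_seq1 ?monoE ?eqxx //.
by move=> m; rewrite inE monoE => /negbTE ->.
Qed.

End Extension.

Lemma loop_ind (P : loop -> Prop) : P 0 ->
  (forall c f g, P f -> P g -> P (c *: f + g)) ->
  (forall n v, P (mono n v)) -> forall f, P f.
Proof.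
move=> P0 PL PM f.
have /finite_seqP[X hX] := loop_finite f.
have -> : f = \sum_(n <- undup X) mono n (f n).
  apply/loopP => m.
  have -> : (\sum_(n <- undup X) mono n (f n) : loop) m = \sum_(n <- undup X) mono n (f n) m.
    by elim/big_rec2: _ => //= n _ y _ <-.
  have [mX|mX] := boolP (m \in undup X).
    rewrite (bigD1_seq m) ?undup_uniq // big1.
      by rewrite monoE eqxx; exact: esym (addr0 _).
    move=> n nm.
    by rewrite monoE eq_sym (negbTE nm).
  rewrite big1_seq => [|n /andP[_ nX]].
    rewrite mem_undup in mX; apply: contrapT => h; move/negP: mX; apply.
    by have : [set` X] m by rewrite -hX.
  by rewrite monoE; case: eqP mX nX => // -> /negbTE ->.
elim: (undup X) => [|n s IHs]; first by rewrite big_nil.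
by rewrite big_cons -[X in X + _]scale1r; exact: PL.
Qed.

End Loop.

Section Extension2.
Variables (K : pzRingType) (V V' W : lmodType K).
Variable phi : int -> V -> int -> V' -> W.

(* The bilinear map that sends [v (x) t^n, v' (x) t^m] to [phi n v m v']. *)
Definition loop_ext2 (f : loop V) (h : loop V') : W :=
  loop_ext (fun n v => loop_ext (phi n v) h) f.

Hypothesis phil : forall n m v', linear (fun v => phi n v m v').
Hypothesis phir : forall n v m, linear (phi n v m).
Hypothesis KC : forall a b : K, a * b = b * a.

Let inner n h : linear (fun v => loop_ext (phi n v) h).
Proof.
move=> c u v; elim/loop_ind: h => [|d f g IHf IHg|m w].
- have e x : loop_ext (phi n x) 0 = 0.
    apply: (addrI (loop_ext (phi n x) 0)); rewrite -[X in X + _]scale1r.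
    by rewrite -(loop_ext_linear (phir n x)) scale1r !addr0.
  by rewrite !e scaler0 addr0.
- rewrite !(loop_ext_linear (phir n _)) IHf IHg !scalerDr !scalerA [c * d]KC.
  by rewrite addrACA.
- by rewrite !(loop_ext_mono (phir n _)); exact: phil.
Qed.

Lemma loop_ext2_linearl h : linear (loop_ext2^~ h).
Proof. by apply: loop_ext_linear => n; exact: inner. Qed.

Lemma loop_ext2_mono n v m v' :
  loop_ext2 (mono n v) (mono m v') = phi n v m v'.
Proof.
rewrite /loop_ext2 loop_ext_mono => [|k]; last exact: inner.
exact: loop_ext_mono (phir n v) _ _.
Qed.

Lemma loop_ext2_linearr f : linear (loop_ext2 f).
Proof.
move=> c h h'; elim/loop_ind: f => [|d f g IHf IHg|m w].
- have e x : loop_ext2 0 x = 0.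
    apply: (addrI (loop_ext2 0 x)); rewrite -[X in X + _]scale1r.
    by rewrite -loop_ext2_linearl scale1r !addr0.
  by rewrite !e scaler0 addr0.
- rewrite !loop_ext2_linearl IHf IHg !scalerDr !scalerA [c * d]KC.
  by rewrite addrACA.
- rewrite /loop_ext2 !(loop_ext_mono (fun n => inner n _)).
  exact: loop_ext_linear (phir m w) _ _ _.
Qed.

End Extension2.

Record inv_form (K : fieldType) (g : finLieType K) := InvForm {
  form :> g -> g -> K;
  form_linear : forall y, scalar (form^~ y);
  form_sym : forall x y, form x y = form y x;
  form_inv : forall x y z, form (lie x y) z = form x (lie y z);
  form_nondeg : forall x, (forall y, form x y = 0) -> x = 0
}.

Section Tau.
Variables (K : numFieldType) (g : finLieType K) (B : inv_form g).

(* An element [((f, k), (l, c))] stands for [f + k K + l + c C_0], where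
   [f : g (x) C[t, t^-1]] and [mono n 1 : loop K^o] stands for [L_n]. *)
Definition taubar_of (_ : inv_form g) : Type :=
  ((loop g * K^o) * (loop K^o * K^o))%type.
Local Notation taubar := (taubar_of B).
HB.instance Definition _ := GRing.Lmodule.on taubar.

Definition bX (n : int) (x : g) : taubar := ((mono n x, 0), (0, 0)).
Definition bK : taubar := ((0, 1), (0, 0)).
Definition bL (n : int) : taubar := ((0, 0), (mono n (1 : K^o), 0)).
Definition bC : taubar := ((0, 0), (0, 1)).

Definition aff_bracket : loop g -> loop g -> loop g :=
  loop_ext2 (fun n x m y => mono (n + m) (lie x y)).
Definition aff_cocycle : loop g -> loop g -> K^o :=
  loop_ext2 (fun n x m y => (n + m == 0)%:R * (n%:~R * B x y) : K^o).
Definition vir_action : loop K^o -> loop g -> loop g :=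
  loop_ext2 (fun n (a : K^o) m y => mono (m + n) ((m%:~R * a : K) *: y)).
Definition vir_bracket : loop K^o -> loop K^o -> loop K^o :=
  loop_ext2 (fun n (a : K^o) m (b : K^o) =>
    mono (n + m) ((m - n)%:~R * (a * b) : K^o)).
Definition vir_cocycle : loop K^o -> loop K^o -> K^o :=
  loop_ext2 (fun n (a : K^o) m (b : K^o) =>
    (n + m == 0)%:R * ((n ^+ 3 - n)%:~R / 12 * (a * b)) : K^o).

Definition taubar_lie (s t : taubar) : taubar :=
  let: ((f, _), (l, _)) := s in
  let: ((f', _), (l', _)) := t in
  ((aff_bracket f f' + vir_action l f' - vir_action l' f, aff_cocycle f f'),
   (vir_bracket l l', vir_cocycle l l')).

Let formD x y z : B (x + y) z = B x z + B y z.
Proof. by have := form_linear B z 1 x y; rewrite !scale1r mul1r. Qed.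
Let formDr x y z : B x (y + z) = B x y + B x z.
Proof. by rewrite form_sym formD ![B _ x]form_sym. Qed.
Let form0 z : B 0 z = 0.
Proof. by apply: (addrI (B 0 z)); rewrite -formD !addr0. Qed.
Let formZ c x z : B (c *: x) z = c * B x z.
Proof. by have := form_linear B z c x 0; rewrite form0 !addr0. Qed.
Let formZr c x z : B x (c *: z) = c * B x z.
Proof. by rewrite form_sym formZ form_sym. Qed.

Let ab1 n m y : linear (fun x : g => mono (n + m) (lie x y)).
Proof. by move=> c u v; rewrite lieDl lieZl linearP. Qed.
Let ab2 n x m : linear (fun y : g => mono (n + m) (lie x y)).
Proof. by move=> c u v; rewrite !linearP. Qed.
Let ac1 n m y :
  linear (fun x : g => (n + m == 0)%:R * (n%:~R * B x y) : K^o).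
Proof. by move=> c u v; rewrite formD formZ /GRing.scale /=; ring. Qed.
Let ac2 n x m :
  linear (fun y : g => (n + m == 0)%:R * (n%:~R * B x y) : K^o).
Proof. by move=> c u v; rewrite formDr formZr /GRing.scale /=; ring. Qed.
Let va1 n m y :
  linear (fun a : K^o => mono (m + n) ((m%:~R * a : K) *: y) : loop g).
Proof.
move=> c u v; rewrite -linearP; congr mono; rewrite scalerA -scalerDl.
by congr (_ *: _); rewrite /GRing.scale /=; ring.
Qed.
Let va2 n (a : K^o) m :
  linear (fun y : g => mono (m + n) ((m%:~R * a : K) *: y)).
Proof.
move=> c u v; rewrite -linearP; congr mono; rewrite scalerDr !scalerA.
by congr (_ *: _ + _); rewrite mulrC.
Qed.
Let vb1 n m (b : K^o) :
  linear (fun a : K^o => mono (n + m) ((m - n)%:~R * (a * b) : K^o)).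
Proof.
move=> c u v; rewrite -linearP; congr mono; rewrite /GRing.scale /=; ring.
Qed.
Let vb2 n (a : K^o) m :
  linear (fun b : K^o => mono (n + m) ((m - n)%:~R * (a * b) : K^o)).
Proof.
move=> c u v; rewrite -linearP; congr mono; rewrite /GRing.scale /=; ring.
Qed.
Let vc1 n m (b : K^o) : linear (fun a : K^o =>
  (n + m == 0)%:R * ((n ^+ 3 - n)%:~R / 12 * (a * b)) : K^o).
Proof. move=> c u v; rewrite /GRing.scale /=; ring. Qed.
Let vc2 n (a : K^o) m : linear (fun b : K^o =>
  (n + m == 0)%:R * ((n ^+ 3 - n)%:~R / 12 * (a * b)) : K^o).
Proof. move=> c u v; rewrite /GRing.scale /=; ring. Qed.

Let lin1 := (loop_ext2_linearl ab1 ab2 (@mulrC K),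
  loop_ext2_linearl ac1 ac2 (@mulrC K), loop_ext2_linearl va1 va2 (@mulrC K),
  loop_ext2_linearl vb1 vb2 (@mulrC K), loop_ext2_linearl vc1 vc2 (@mulrC K)).
Let lin2 := (loop_ext2_linearr ab1 ab2 (@mulrC K),
  loop_ext2_linearr ac1 ac2 (@mulrC K), loop_ext2_linearr va1 va2 (@mulrC K),
  loop_ext2_linearr vb1 vb2 (@mulrC K), loop_ext2_linearr vc1 vc2 (@mulrC K)).
Let monoE2 := (loop_ext2_mono ab1 ab2 (@mulrC K),
  loop_ext2_mono ac1 ac2 (@mulrC K), loop_ext2_mono va1 va2 (@mulrC K),
  loop_ext2_mono vb1 vb2 (@mulrC K), loop_ext2_mono vc1 vc2 (@mulrC K)).

Let l0 (V W : lmodType K) (f : V -> W) : linear f -> f 0 = 0.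
Proof.
move=> h; apply: (addrI (f 0)).
by rewrite -[X in X + _]scale1r -h scale1r !addr0.
Qed.

Let lin01 := (fun h => l0 (loop_ext2_linearl ab1 ab2 (@mulrC K) h),
  fun h => l0 (loop_ext2_linearl ac1 ac2 (@mulrC K) h),
  fun h => l0 (loop_ext2_linearl va1 va2 (@mulrC K) h),
  fun h => l0 (loop_ext2_linearl vb1 vb2 (@mulrC K) h),
  fun h => l0 (loop_ext2_linearl vc1 vc2 (@mulrC K) h)).
Let lin02 := (fun h => l0 (loop_ext2_linearr ab1 ab2 (@mulrC K) h),
  fun h => l0 (loop_ext2_linearr ac1 ac2 (@mulrC K) h),
  fun h => l0 (loop_ext2_linearr va1 va2 (@mulrC K) h),
  fun h => l0 (loop_ext2_linearr vb1 vb2 (@mulrC K) h),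
  fun h => l0 (loop_ext2_linearr vc1 vc2 (@mulrC K) h)).

Let add3Z (V : lmodType K) c (a b d a' b' d' : V) :
  c *: a + a' + (c *: b + b') + (c *: d + d') =
  c *: (a + b + d) + (a' + b' + d').
Proof. by rewrite !scalerDr (addrACA (c *: a)) (addrACA (c *: a + c *: b)). Qed.

Lemma taubar_linearl t : linear (taubar_lie^~ t).
Proof.
case: t => [[f' k'] [l' c']] a [[f1 k1] [l1 c1]] [[f2 k2] [l2 c2]] /=.
rewrite /aff_bracket /aff_cocycle /vir_action /vir_bracket /vir_cocycle.
rewrite !lin1 !lin2; congr (_, _, (_, _)) => /=.
by rewrite opprD -scalerN add3Z.
Qed.
Lemma taubar_linearr s : linear (taubar_lie s).
Proof.
case: s => [[f' k'] [l' c']] a [[f1 k1] [l1 c1]] [[f2 k2] [l2 c2]] /=.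
rewrite /aff_bracket /aff_cocycle /vir_action /vir_bracket /vir_cocycle.
rewrite !lin1 !lin2; congr (_, _, (_, _)) => /=.
by rewrite opprD -scalerN add3Z.
Qed.

Let eq4 (s t : taubar) : s.1.1 = t.1.1 -> s.1.2 = t.1.2 ->
  s.2.1 = t.2.1 -> s.2.2 = t.2.2 -> s = t.
Proof. by case: s t => [[? ?] [? ?]] [[? ?] [? ?]] /= -> -> -> ->. Qed.

Let tbE := (monoE2, lin01, lin02).

Lemma taubar_XX n x m y : taubar_lie (bX n x) (bX m y) =
  bX (n + m) (lie x y) + ((n + m == 0)%:R * (n%:~R * B x y)) *: bK.
Proof.
apply: eq4; rewrite /= /aff_bracket /aff_cocycle /vir_action /vir_bracket
  /vir_cocycle !tbE ?scaler0 ?addr0 ?subr0 ?add0r //.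
by rewrite /GRing.scale /= mulr1.
Qed.
Lemma taubar_LX n m x :
  taubar_lie (bL n) (bX m x) = m%:~R *: bX (m + n) x.
Proof.
apply: eq4; rewrite /= /aff_bracket /aff_cocycle /vir_action /vir_bracket
  /vir_cocycle !tbE ?scaler0 ?addr0 ?subr0 ?add0r //.
by rewrite mulr1 linearZ.
Qed.
Lemma taubar_XL n m x :
  taubar_lie (bX m x) (bL n) = - (m%:~R *: bX (m + n) x).
Proof.
apply: eq4; rewrite /= /aff_bracket /aff_cocycle /vir_action /vir_bracket
  /vir_cocycle !tbE ?scaler0 ?addr0 ?subr0 ?add0r ?oppr0 //.
by rewrite mulr1 linearZ.
Qed.
Lemma taubar_LL n m : taubar_lie (bL n) (bL m) =
  (m - n)%:~R *: bL (n + m) +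
  ((n + m == 0)%:R * ((n ^+ 3 - n)%:~R / 12)) *: bC.
Proof.
apply: eq4; rewrite /= /aff_bracket /aff_cocycle /vir_action /vir_bracket
  /vir_cocycle !tbE ?scaler0 ?addr0 ?subr0 ?add0r //.
- by rewrite -linearZ /= mulr1.
- by rewrite /GRing.scale /= !mulr1.
Qed.
Lemma taubar_Kl s : taubar_lie bK s = 0.
Proof.
case: s => [[f k] [l c]]; apply: eq4; rewrite /= /aff_bracket /aff_cocycle
  /vir_action /vir_bracket /vir_cocycle !tbE ?addr0 ?subr0 //.
Qed.
Lemma taubar_Kr s : taubar_lie s bK = 0.
Proof.
case: s => [[f k] [l c]]; apply: eq4; rewrite /= /aff_bracket /aff_cocycle
  /vir_action /vir_bracket /vir_cocycle !tbE ?addr0 ?subr0 //.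
Qed.
Lemma taubar_Cl s : taubar_lie bC s = 0.
Proof.
case: s => [[f k] [l c]]; apply: eq4; rewrite /= /aff_bracket /aff_cocycle
  /vir_action /vir_bracket /vir_cocycle !tbE ?addr0 ?subr0 //.
Qed.
Lemma taubar_Cr s : taubar_lie s bC = 0.
Proof.
case: s => [[f k] [l c]]; apply: eq4; rewrite /= /aff_bracket /aff_cocycle
  /vir_action /vir_bracket /vir_cocycle !tbE ?addr0 ?subr0 //.
Qed.

Lemma taubar_ind (P : taubar -> Prop) :
  (forall c s t, P s -> P t -> P (c *: s + t)) ->
  (forall n x, P (bX n x)) -> P bK -> (forall n, P (bL n)) -> P bC ->
  forall s, P s.
Proof.
move=> PL PX PK PLn PC [[f k] [l c]].
have P0 : P 0 by have := PL (-1) bK bK PK PK; rewrite scaleN1r addNr.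
have -> : ((f, k), (l, c)) =
    1 *: ((f, 0), (0, 0)) + (k *: bK + (1 *: ((0, 0), (l, 0)) + (c *: bC + 0)))
      :> taubar.
  by apply: eq4; rewrite /= ?scaler0 ?scale1r ?addr0 ?add0r // /GRing.scale /=
     mulr1.
apply: (PL); last (apply: (PL) => //; apply: (PL); last exact: PL).
- elim/loop_ind: f => // a h h' IHh IHh'.
  have -> : ((a *: h + h', 0), (0, 0)) =
      a *: ((h, 0), (0, 0)) + ((h', 0), (0, 0)) :> taubar.
    by apply: eq4; rewrite /= ?scaler0 ?addr0.
  exact: PL.
- elim/loop_ind: l => // [a h h' IHh IHh'|n x].
    have -> : ((0, 0), (a *: h + h', 0)) =
        a *: ((0, 0), (h, 0)) + ((0, 0), (h', 0)) :> taubar.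
      by apply: eq4; rewrite /= ?scaler0 ?addr0.
    exact: PL.
  have -> : ((0, 0), (mono n x, 0)) = x *: bL n + 0 :> taubar.
    by apply: eq4; rewrite /= ?scaler0 ?addr0 // -linearZ /GRing.scale /= mulr1.
  exact: PL.
Qed.

Let tlieC s t : taubar_lie s t = - taubar_lie t s.
Proof.
elim/taubar_ind: s => [a s s' IHs IHs'|n x||n|].
- by rewrite taubar_linearl taubar_linearr IHs IHs' opprD scalerN.
- elim/taubar_ind: t => [a s s' IHs IHs'|m y||m|].
  + by rewrite taubar_linearl taubar_linearr IHs IHs' opprD scalerN.
  + rewrite !taubar_XX opprD [m + n]addrC; congr (_ + _).
      by apply: eq4; rewrite /= ?oppr0 // -linearN -lieC.
    rewrite -scaleNr; congr (_ *: _); rewrite form_sym.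
    have [|_] := eqVneq (n + m) 0; last by rewrite !mul0r oppr0.
    by move/eqP; rewrite addr_eq0 => /eqP ->; rewrite rmorphN; ring.
  + by rewrite taubar_Kl taubar_Kr oppr0.
  + by rewrite taubar_LX taubar_XL.
  + by rewrite taubar_Cl taubar_Cr oppr0.
- by rewrite taubar_Kl taubar_Kr oppr0.
- elim/taubar_ind: t => [a s s' IHs IHs'|m y||m|].
  + by rewrite taubar_linearl taubar_linearr IHs IHs' opprD scalerN.
  + by rewrite taubar_LX taubar_XL opprK.
  + by rewrite taubar_Kl taubar_Kr oppr0.
  + rewrite !taubar_LL opprD [m + n]addrC.
    congr (_ + _); rewrite -scaleNr; congr (_ *: _).
      by rewrite -rmorphN opprB.
    have [|_] := eqVneq (n + m) 0; last by rewrite !mul0r oppr0.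
    move/eqP; rewrite addr_eq0 => /eqP ->; rewrite !mul1r -mulNr -rmorphN.
    by congr (_%:~R / _); ring.
  + by rewrite taubar_Cl taubar_Cr oppr0.
- by rewrite taubar_Cl taubar_Cr oppr0.
Qed.

Lemma taubar_lie_xx s : taubar_lie s s = 0.
Proof.
have /eqP := tlieC s s; rewrite -addr_eq0 -mulr2n -scaler_nat scaler_eq0.
by rewrite pnatr_eq0 /= => /eqP.
Qed.

Let jac s t u : taubar := taubar_lie s (taubar_lie t u) +
  taubar_lie t (taubar_lie u s) + taubar_lie u (taubar_lie s t).
Let jacC s t u : jac s t u = jac t u s.
Proof. by rewrite /jac -addrA addrC. Qed.
Let jacl c s s' t u : jac (c *: s + s') t u = c *: jac s t u + jac s' t u.
Proof. by rewrite /jac !(taubar_linearl, taubar_linearr) add3Z. Qed.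
Let jac_lin c t u s s' : jac s t u = 0 -> jac s' t u = 0 ->
  jac (c *: s + s') t u = 0.
Proof. by rewrite jacl => -> ->; rewrite scaler0 addr0. Qed.
Let tl0 s : taubar_lie s 0 = 0.
Proof. exact: l0 (taubar_linearr s). Qed.
Let tl0l s : taubar_lie 0 s = 0.
Proof. exact: l0 (taubar_linearl s). Qed.
Let jacK t u : jac bK t u = 0.
Proof. by rewrite /jac !(taubar_Kl, taubar_Kr, tl0) !addr0. Qed.
Let jacCC t u : jac bC t u = 0.
Proof. by rewrite /jac !(taubar_Cl, taubar_Cr, tl0) !addr0. Qed.

Let tlD s t u : taubar_lie s (t + u) = taubar_lie s t + taubar_lie s u.
Proof. by have := taubar_linearr s 1 t u; rewrite !scale1r. Qed.
Let tlZ s c t : taubar_lie s (c *: t) = c *: taubar_lie s t.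
Proof. by have := taubar_linearr s c t 0; rewrite tl0 !addr0. Qed.
Let tlN s t : taubar_lie s (- t) = - taubar_lie s t.
Proof. by rewrite -scaleN1r tlZ scaleN1r. Qed.

Let bX_linear n : linear (bX n).
Proof.
by move=> c x y; apply: eq4; rewrite /= ?scaler0 ?addr0 // linearP.
Qed.
Let bXD n x y : bX n (x + y) = bX n x + bX n y.
Proof. by have := bX_linear n 1 x y; rewrite !scale1r. Qed.
Let bX0 n : bX n 0 = 0.
Proof. exact: l0 (bX_linear n). Qed.

Let add6 (V : zmodType) (a b c d e f : V) :
  a + d + (b + e) + (c + f) = a + b + c + (d + e + f).
Proof. by rewrite (addrACA a) (addrACA (a + b)). Qed.

Let jacXXX n x m y p z : jac (bX n x) (bX m y) (bX p z) = 0.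
Proof.
rewrite /jac !taubar_XX !tlD !tlZ !taubar_Kr !scaler0 !addr0 !taubar_XX.
have -> : m + (p + n) = n + (m + p) by ring.
have -> : p + (n + m) = n + (m + p) by ring.
rewrite add6 -!bXD lie_jacobi bX0 add0r -!scalerDl.
have -> : form B y (lie z x) = form B x (lie y z).
  by rewrite -form_inv form_sym.
have -> : form B z (lie x y) = form B x (lie y z).
  by rewrite form_sym form_inv.
have [e|_] := eqVneq (n + (m + p)) 0; last by rewrite !mul0r !addr0 scale0r.
by rewrite !mul1r -!mulrDl -!rmorphD -addrA e mul0r scale0r.
Qed.

Let bXN n x : bX n (- x) = - bX n x.
Proof. by apply/eqP; rewrite -addr_eq0 -bXD addNr bX0. Qed.

Let jacLXX n m y p z : jac (bL n) (bX m y) (bX p z) = 0.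
Proof.
rewrite /jac; set X := bX (m + p + n) (lie y z).
set d : K := (m + p + n == 0)%:R.
have -> : taubar_lie (bL n) (taubar_lie (bX m y) (bX p z)) =
    (m + p)%:~R *: X + 0 *: bK.
  by rewrite taubar_XX tlD tlZ taubar_Kr scaler0 scale0r taubar_LX.
have -> : taubar_lie (bX m y) (taubar_lie (bX p z) (bL n)) =
    (- p)%:~R *: X + (- p%:~R * (d * (m%:~R * B y z))) *: bK.
  rewrite taubar_XL tlN tlZ taubar_XX addrA scalerDr scalerA opprD.
  by rewrite rmorphN mulNr; congr (_ + _); rewrite scaleNr.
have -> : taubar_lie (bX p z) (taubar_lie (bL n) (bX m y)) =
    (- m)%:~R *: X + (m%:~R * (d * (p%:~R * B y z))) *: bK.
  rewrite taubar_LX tlZ taubar_XX addrA [p + m]addrC scalerDr scalerA.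
  by rewrite lieC bXN scalerN rmorphN scaleNr form_sym.
rewrite add6 -!scalerDl -!rmorphD.
have -> : m + p + - p + - m = 0 by ring.
rewrite scale0r add0r [X in X *: _](_ : _ = 0) ?scale0r //; ring.
Qed.

Let jacLLX n m p z : jac (bL n) (bL m) (bX p z) = 0.
Proof.
rewrite /jac; set X := bX (p + m + n) z.
have -> : taubar_lie (bL n) (taubar_lie (bL m) (bX p z)) =
    (p%:~R * (p + m)%:~R) *: X.
  by rewrite taubar_LX tlZ taubar_LX scalerA.
have -> : taubar_lie (bL m) (taubar_lie (bX p z) (bL n)) =
    (- (p%:~R * (p + n)%:~R)) *: X.
  by rewrite taubar_XL tlN tlZ taubar_LX scalerA -scaleNr addrAC.
have -> : taubar_lie (bX p z) (taubar_lie (bL n) (bL m)) =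
    (- ((m - n)%:~R * p%:~R)) *: X.
  rewrite taubar_LL tlD !tlZ taubar_Cr scaler0 addr0 taubar_XL scalerN scalerA.
  by rewrite -scaleNr [n + m]addrC addrA.
rewrite -!scalerDl [X in X *: _](_ : _ = 0) ?scale0r //.
by rewrite !rmorphD rmorphN /=; ring.
Qed.

Let jacLLL n m p : jac (bL n) (bL m) (bL p) = 0.
Proof.
rewrite /jac; set X := bL (n + m + p).
set d : K := (n + m + p == 0)%:R.
pose w (k : int) : K := (k ^+ 3 - k)%:~R / 12.
have E k i j : n + m + p = k + (i + j) ->
    taubar_lie (bL k) (taubar_lie (bL i) (bL j)) =
    ((j - i)%:~R * (i + j - k)%:~R) *: X + ((j - i)%:~R * (d * w k)) *: bC.
  move=> e; rewrite taubar_LL tlD !tlZ taubar_Cr scaler0 addr0 taubar_LL.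
  by rewrite scalerDr !scalerA -e.
rewrite (E n m p) ?(E m p n) ?(E p n m); try ring.
rewrite add6 -!scalerDl.
rewrite [X in X *: _](_ : _ = 0); last by rewrite !rmorphD !rmorphN /=; ring.
rewrite scale0r add0r /d.
have [e|_] := eqVneq (n + m + p) 0; last by rewrite !mul0r !mulr0 !addr0 scale0r.
have -> : p = - (n + m) by apply/eqP; rewrite -addr_eq0 addrC e.
rewrite [X in X *: _](_ : _ = 0) ?scale0r // /w.
by rewrite !(rmorphD, rmorphN, rmorphXn) /=; field.
Qed.

Lemma taubar_jacobi s t u : taubar_lie s (taubar_lie t u) +
  taubar_lie t (taubar_lie u s) + taubar_lie u (taubar_lie s t) = 0.
Proof.
rewrite -/(jac s t u).
elim/taubar_ind: s => [a s s'|n x||n|]; [exact: jac_lin| |exact: jacK| |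
  exact: jacCC].
- elim/taubar_ind: t => [a s s' h h'|m y||m|].
  + by rewrite jacC; apply: jac_lin; rewrite -jacC.
  + elim/taubar_ind: u => [a s s' h h'|p z||p|].
    * by rewrite -jacC; apply: jac_lin; rewrite jacC.
    * exact: jacXXX.
    * by rewrite -jacC jacK.
    * by rewrite -jacC jacLXX.
    * by rewrite -jacC jacCC.
  + by rewrite jacC jacK.
  + elim/taubar_ind: u => [a s s' h h'|p z||p|].
    * by rewrite -jacC; apply: jac_lin; rewrite jacC.
    * by rewrite jacC jacLXX.
    * by rewrite -jacC jacK.
    * by rewrite jacC jacLLX.
    * by rewrite -jacC jacCC.
  + by rewrite jacC jacCC.
- elim/taubar_ind: t => [a s s' h h'|m y||m|].
  + by rewrite jacC; apply: jac_lin; rewrite -jacC.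
  + elim/taubar_ind: u => [a s s' h h'|p z||p|].
    * by rewrite -jacC; apply: jac_lin; rewrite jacC.
    * exact: jacLXX.
    * by rewrite -jacC jacK.
    * by rewrite -jacC jacLLX.
    * by rewrite -jacC jacCC.
  + by rewrite jacC jacK.
  + elim/taubar_ind: u => [a s s' h h'|p z||p|].
    * by rewrite -jacC; apply: jac_lin; rewrite jacC.
    * exact: jacLLX.
    * by rewrite -jacC jacK.
    * exact: jacLLL.
    * by rewrite -jacC jacCC.
  + by rewrite jacC jacCC.
Qed.

HB.instance Definition _ := Lmodule_isLie.Build K taubar
  taubar_linearl taubar_linearr taubar_lie_xx taubar_jacobi.

Definition tau_eqb (s t : taubar) : bool :=
  `[< exists c : K, s - t = c *: (bK - bC) >].
Lemma tau_eqb_refl : reflexive tau_eqb.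
Proof. by move=> s; apply/asboolP; exists 0; rewrite subrr scale0r. Qed.
Lemma tau_eqb_sym : symmetric tau_eqb.
Proof.
by move=> s t; apply/asboolP/asboolP => -[c e]; exists (- c);
  rewrite scaleNr -e opprB.
Qed.
Lemma tau_eqb_trans : transitive tau_eqb.
Proof.
move=> t s u /asboolP[c e] /asboolP[d e']; apply/asboolP; exists (c + d).
by rewrite scalerDl -e -e' addrA subrK.
Qed.
Canonical tau_eqb_equiv :=
  EquivRel tau_eqb tau_eqb_refl tau_eqb_sym tau_eqb_trans.

Definition tau : Type := {eq_quot tau_eqb}.
HB.instance Definition _ := Choice.on tau.
HB.instance Definition _ := EqQuotient.on tau.

Definition tau_pi (s : taubar) : tau := \pi_tau s.

Lemma tau_piP s t : tau_pi s = tau_pi t <->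
  exists c : K, s - t = c *: (bK - bC).
Proof. by split=> [/eqmodP/asboolP//|h]; apply/eqmodP/asboolP. Qed.

Let repr_pi s : exists c : K, repr (tau_pi s) = s + c *: (bK - bC).
Proof.
have /tau_piP[c e] : tau_pi (repr (tau_pi s)) = tau_pi s by exact: reprK.
by exists c; rewrite -e addrC subrK.
Qed.
Let piK (x : tau) : exists s, x = tau_pi s.
Proof. by exists (repr x); exact: esym (reprK x). Qed.

Definition tau_add (x y : tau) : tau := tau_pi (repr x + repr y).
Definition tau_scale (c : K) (x : tau) : tau := tau_pi (c *: repr x).
Definition tau_lie (x y : tau) : tau := tau_pi (lie (repr x) (repr y)).

Lemma tau_add_pi s t : tau_add (tau_pi s) (tau_pi t) = tau_pi (s + t).
Proof.
apply/tau_piP; have [c ->] := repr_pi s; have [d ->] := repr_pi t.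
by exists (c + d); rewrite (addrACA s) scalerDl [LHS]addrC addKr.
Qed.
Lemma tau_scale_pi c s : tau_scale c (tau_pi s) = tau_pi (c *: s).
Proof.
apply/tau_piP; have [d ->] := repr_pi s.
by exists (c * d); rewrite scalerDr scalerA [LHS]addrC addKr.
Qed.
Let central c s : lie s (c *: (bK - bC)) = 0.
Proof.
rewrite lieZr lieDr lieNr [lie s bK]taubar_Kr [lie s bC]taubar_Cr subrr.
exact: scaler0.
Qed.
Lemma tau_lie_pi s t : tau_lie (tau_pi s) (tau_pi t) = tau_pi (lie s t).
Proof.
apply/tau_piP; have [c ->] := repr_pi s; have [d ->] := repr_pi t.
exists 0; rewrite scale0r lieDl !lieDr !central !addr0.
by rewrite [lie (_ *: _) _]lieC central oppr0 addr0 subrr.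
Qed.

Let tau_addA : associative tau_add.
Proof.
move=> x y z; have [s ->] := piK x; have [t ->] := piK y; have [u ->] := piK z.
by rewrite !tau_add_pi addrA.
Qed.
Let tau_addC : commutative tau_add.
Proof. by move=> x y; rewrite /tau_add addrC. Qed.
Let tau_add0 : left_id (tau_pi 0) tau_add.
Proof. by move=> x; have [s ->] := piK x; rewrite tau_add_pi add0r. Qed.
Let tau_addN : left_inverse (tau_pi 0) (tau_scale (-1)) tau_add.
Proof.
move=> x; have [s ->] := piK x.
by rewrite tau_scale_pi tau_add_pi scaleN1r addNr.
Qed.
HB.instance Definition _ := GRing.isZmodule.Build tau
  tau_addA tau_addC tau_add0 tau_addN.

Let tau_scaleA a b x : tau_scale a (tau_scale b x) = tau_scale (a * b) x.
Proof. by have [s ->] := piK x; rewrite !tau_scale_pi scalerA. Qed.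
Let tau_scale1 : left_id 1 tau_scale.
Proof. by move=> x; have [s ->] := piK x; rewrite !tau_scale_pi scale1r. Qed.
Let tau_scaleDr : right_distributive tau_scale +%R.
Proof.
move=> a x y; have [s ->] := piK x; have [t ->] := piK y.
by rewrite [_ + _]tau_add_pi !tau_scale_pi [RHS]tau_add_pi scalerDr.
Qed.
Let tau_scaleDl x : {morph tau_scale^~ x : a b / a + b}.
Proof.
move=> a b; have [s ->] := piK x.
by rewrite !tau_scale_pi [RHS]tau_add_pi scalerDl.
Qed.
HB.instance Definition _ := GRing.Zmodule_isLmodule.Build K tau
  tau_scaleA tau_scale1 tau_scaleDr tau_scaleDl.

Lemma tau_pi_linear : linear tau_pi.
Proof.
by move=> c s t; rewrite -tau_add_pi -tau_scale_pi.
Qed.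
HB.instance Definition _ :=
  GRing.isLinear.Build K taubar tau _ tau_pi tau_pi_linear.

Let tau_linearl y : linear (tau_lie^~ y).
Proof.
move=> a x x'; have [s ->] := piK x; have [t ->] := piK x'; have [u ->] := piK y.
have pP a0 s0 t0 : a0 *: tau_pi s0 + tau_pi t0 = tau_pi (a0 *: s0 + t0).
  by rewrite linearP.
by rewrite pP !tau_lie_pi pP lieDl lieZl.
Qed.
Let tau_linearr x : linear (tau_lie x).
Proof.
move=> a y y'; have [s ->] := piK x; have [t ->] := piK y; have [u ->] := piK y'.
have pP a0 s0 t0 : a0 *: tau_pi s0 + tau_pi t0 = tau_pi (a0 *: s0 + t0).
  by rewrite linearP.
by rewrite pP !tau_lie_pi pP lieDr lieZr.
Qed.
Let tau_lie_xx x : tau_lie x x = 0.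
Proof. by have [s ->] := piK x; rewrite tau_lie_pi lie_xx. Qed.
Let tau_jacobi x y z : tau_lie x (tau_lie y z) + tau_lie y (tau_lie z x) +
  tau_lie z (tau_lie x y) = 0.
Proof.
have [s ->] := piK x; have [t ->] := piK y; have [u ->] := piK z.
by rewrite !tau_lie_pi [X in X + _]tau_add_pi [LHS]tau_add_pi lie_jacobi.
Qed.
HB.instance Definition _ := Lmodule_isLie.Build K tau
  tau_linearl tau_linearr tau_lie_xx tau_jacobi.

Definition tX (n : int) (x : g) : tau := tau_pi (bX n x).
Definition tK : tau := tau_pi bK.
Definition tL (n : int) : tau := tau_pi (bL n).

Lemma tK_C : tau_pi bC = tK.
Proof. by apply/tau_piP; exists (-1); rewrite scaleN1r opprB. Qed.
Lemma lie_tKl s : lie tK s = 0.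
Proof. by have [t ->] := piK s; rewrite [LHS]tau_lie_pi [lie _ _]taubar_Kl linear0. Qed.
Lemma lie_tXX n x m y : lie (tX n x) (tX m y) =
  tX (n + m) (lie x y) + ((n + m == 0)%:R * (n%:~R * B x y)) *: tK.
Proof. by rewrite [LHS]tau_lie_pi [lie _ _]taubar_XX linearD linearZ. Qed.
Lemma lie_tLX n m x : lie (tL n) (tX m x) = m%:~R *: tX (m + n) x.
Proof. by rewrite [LHS]tau_lie_pi [lie _ _]taubar_LX linearZ. Qed.
Lemma lie_tLL n m : lie (tL n) (tL m) = (m - n)%:~R *: tL (n + m) +
  ((n + m == 0)%:R * ((n ^+ 3 - n)%:~R / 12)) *: tK.
Proof.
by rewrite [LHS]tau_lie_pi [lie _ _]taubar_LL linearD !linearZ /= tK_C.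
Qed.
Lemma tau_ind (P : tau -> Prop) :
  (forall c s t, P s -> P t -> P (c *: s + t)) ->
  (forall n x, P (tX n x)) -> P tK -> (forall n, P (tL n)) -> forall s, P s.
Proof.
move=> PL PX PK PLn x; have [s ->] := piK x.
elim/taubar_ind: s => // [c s t Ps Pt|]; last by rewrite tK_C.
by rewrite linearP; exact: PL.
Qed.

End Tau.

Section Structure.
Variables (K : fieldType) (g : finLieType K).

Definition lie_ideal (I : {vspace g}) : Prop :=
  forall x y : g, y \in I -> lie x y \in I.

Definition simple_lie : Prop :=
  (exists x y : g, lie x y <> 0) /\
  forall I : {vspace g}, lie_ideal I -> I = 0%VS \/ I = fullv.

Definition cartan_subalgebra (h : {vspace g}) : Prop :=
  [/\ forall x y, x \in h -> y \in h -> lie x y \in h,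
      exists n : nat, forall (s : n.-tuple g) (y : g),
        all [in h] s -> y \in h -> foldr (@lie K g) y s = 0
    & forall x, (forall y, y \in h -> lie x y \in h) -> x \in h].

Definition dual (h : {vspace g}) := 'Hom(subvs_of h, K^o).

Definition root_space (h : {vspace g}) (alpha : dual h) : set g :=
  [set x | forall y : subvs_of h, lie (vsval y) x = (alpha y : K) *: x].

Definition is_root (h : {vspace g}) (alpha : dual h) : Prop :=
  alpha <> 0 /\ exists2 x, root_space alpha x & x <> 0.

(* [simple_root] is a base of the root system; [nplus] and [nminus] are the sums
   of the root spaces of the positive and of the negative roots. *)
Record triangular := Triangular {
  cartan : {vspace g};
  rank : nat;
  simple_root : 'I_rank -> dual cartan;
  nplus : {vspace g};
  nminus : {vspace g};
  cartanP : cartan_subalgebra cartan;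
  simple_rootP : forall j, is_root (simple_root j);
  simple_root_basis : basis_of fullv (codom simple_root);
  root_sign : forall alpha, is_root alpha -> exists c : 'I_rank -> nat,
    alpha = \sum_j simple_root j *+ c j \/
    alpha = - (\sum_j simple_root j *+ c j);
  nplusP : forall x, x \in nplus <->
    lspan (\bigcup_(alpha in [set alpha | is_root alpha /\
      exists c : 'I_rank -> nat, alpha = \sum_j simple_root j *+ c j])
      root_space alpha) x;
  nminusP : forall x, x \in nminus <->
    lspan (\bigcup_(alpha in [set alpha | is_root alpha /\
      exists c : 'I_rank -> nat, alpha = - (\sum_j simple_root j *+ c j)])
      root_space alpha) x;
  triangular_sum : (nminus + cartan + nplus)%VS = fullv;
  triangular_direct : directv (nminus + cartan + nplus)
}.

Definition highest_root (T : triangular) (beta : dual (cartan T)) : Prop :=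
  is_root beta /\
  forall alpha : dual (cartan T), is_root alpha -> exists c : 'I_(rank T) -> nat,
    beta - alpha = \sum_j simple_root j *+ c j.

(* [dual_vec B alpha] is the element of [h] that represents [alpha] with respect
   to the form: [(dual_vec B alpha, y) = alpha y].  The induced form on [h^*] is
   [(alpha, alpha) = (dual_vec B alpha, dual_vec B alpha)]. *)
Variable B : inv_form g.

Definition dual_vec (h : {vspace g}) (alpha : dual h) : subvs_of h :=
  xget 0 [set t : subvs_of h |
    forall y : subvs_of h, B (vsval t) (vsval y) = alpha y].

Definition dual_norm (h : {vspace g}) (alpha : dual h) : K :=
  B (vsval (dual_vec alpha)) (vsval (dual_vec alpha)).

Definition coroot (h : {vspace g}) (alpha : dual h) : subvs_of h :=
  (2 / dual_norm alpha) *: dual_vec alpha.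

End Structure.

Section Algebras.
Variables (K : fieldType) (A : comAlgType K).

Definition finitely_generated : Prop :=
  exists s : seq A, forall S : {pred A}, GRing.subalg_closed S ->
    {subset s <= S} -> forall a, a \in S.

Definition is_ideal (I : set A) : Prop :=
  [/\ I 0, forall a b, I a -> I b -> I (a + b) & forall a b, I b -> I (a * b)].

Definition maximal_ideal (M : set A) : Prop :=
  [/\ is_ideal M, M <> setT &
    forall J, is_ideal J -> M `<=` J -> J = M \/ J = setT].

Definition cofinite_ideal (I : set A) : Prop :=
  is_ideal I /\ exists s : seq A, forall a, exists2 b,
    lspan [set` s] b & I (a - b).

Definition radical (I : set A) : set A :=
  [set a | exists2 n : nat, (0 < n)%N & I (a ^+ n)].

End Algebras.

Section HighestWeight.
Variables (K : numFieldType) (g : finLieType K) (B : inv_form g).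
Variables (T : triangular g) (A : comAlgType K).

Local Notation h := (cartan T).
Local Notation tauA := (current (tau B) A).

(* [(y, k, l)] stands for [y + k K + l L_0]. *)
Definition hbar : Type := (subvs_of h * K^o * K^o)%type.
HB.instance Definition _ := GRing.Lmodule.on hbar.

Definition hbar_tau (u : hbar) : tau B :=
  tX B 0 (vsval u.1.1) + (u.1.2 : K) *: tK B + (u.2 : K) *: tL B 0.

Definition htilde : set hbar := [set u | u.2 = 0].
Definition hbarL0 : hbar := (0, 0, 1).

(* [tau^0(A)] and its inclusion in [tau(A)]. *)
Definition tau0A : Type := tensor hbar A.
HB.instance Definition _ := GRing.Lmodule.on tau0A.
Definition tau0A_incl : tau0A -> tauA := tensor_mapl hbar_tau.

(* [tau_plus_gen] spans [N^+ + L^+]. *)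
Inductive tau_plus_gen : tau B -> Prop :=
| tau_plus_n x : x \in nplus T -> tau_plus_gen (tX B 0 x)
| tau_plus_X n x : 0 < n -> tau_plus_gen (tX B n x)
| tau_plus_L n : 0 < n -> tau_plus_gen (tL B n).

Definition tau_plusA : set tauA :=
  lspan [set y | exists x a, tau_plus_gen x /\ y = cur x a].

(* The character of [tau^0(A) + tau^+(A)] that extends [psi] by zero. *)
Definition borel_char (psi : tau0A -> K) (y : tauA) (c : K) : Prop :=
  exists (u : tau0A) (n : tauA),
    [/\ tau_plusA n, y = tau0A_incl u + n & c = psi u].

Definition verma (psi : tau0A -> K) : lieModType tauA :=
  induced (borel_char psi).

(* Irreducible quotients of [M(psi)] are unique up to isomorphism, so this says
   that [V] is [V(psi)]. *)
Definition is_irr_hw (psi : tau0A -> K) (V : lieModType tauA) : Prop :=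
  irreducible_quotient (verma psi) V.

Definition weight_space (V : lieModType tauA) (lambda : hbar -> K) : set V :=
  [set v | forall u : hbar, act (cur (hbar_tau u) (1 : A)) v = lambda u *: v].

Definition fin_dim_weight_spaces (V : lieModType tauA) : Prop :=
  forall lambda : hbar -> K, scalar lambda -> fin_dim (weight_space (V := V) lambda).

Definition weight_decomposition (V : lieModType tauA) : Prop :=
  (forall v : V, lspan (\bigcup_(lambda in [set lambda | scalar lambda])
     weight_space (V := V) lambda) v) /\
  forall (n : nat) (lambda : 'I_n -> hbar -> K) (v : 'I_n -> V),
    (forall i, scalar (lambda i)) -> injective lambda ->
    (forall i, weight_space (lambda i) (v i)) ->
    \sum_i v i = 0 -> forall i, v i = 0.

Definition integrable (V : lieModType tauA) : Prop :=
  [/\ weight_decomposition V, fin_dim_weight_spaces V &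
    forall (v : V) (alpha : dual h) (n : int) (a : A), is_root alpha ->
      exists N : nat, forall x, root_space alpha x ->
        iter N (act (cur (tX B n x) a)) v = 0].

(* The simple coroot [alpha_0^v = 2 / (beta, beta) K - beta^v]. *)
Definition coroot0 (beta : dual h) : hbar :=
  (- coroot B beta, 2 / dual_norm B beta, 0).

Definition simple_coroot (j : 'I_(rank T)) : hbar :=
  (coroot B (simple_root j), 0, 0).

Definition dominant_integral (beta : dual h) (psi : tau0A -> K) (I : set A) :
    Prop :=
  (forall u a, htilde u -> radical I a -> psi (tmul u a) = 0) /\
  exists (k : nat) (M : 'I_k -> set A) (e : 'I_k -> A),
    [/\ (forall i, maximal_ideal (M i)) /\ injective M,
        radical I = \bigcap_i M i,
        forall i j, M j (e i - (i == j)%:R) &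
        forall i, (exists m : nat, psi (tmul (coroot0 beta) (e i)) = m%:R) /\
          forall j, exists m : nat, psi (tmul (simple_coroot j) (e i)) = m%:R].

End HighestWeight.

(* Main.v *)
(** The module V is generated by its highest weight vector v, so its weights are
    lambda - sum_i c_i alpha_i with c_i >= 0, and a weight vector of lower weight
    killed by tau^+(A) is zero.  Let (e_i, f_i, h_i) be the sl2-triple of an
    affine simple root alpha_i.  Since f_i(a) v is singular for a in sqrt I, it
    vanishes; then e_i(b) acts on the vectors f_i(eps_j)^q v, where eps_j is the
    j-th idempotent modulo sqrt I, as in the sl2-module of highest weight
    m_j = psi(h_i (x) eps_j), so f_i(eps_j)^(m_j + 1) v is singular, hence zero.
    So f_i = f_i(1) is nilpotent on v and locally nilpotent on V, and the set of
    weights is stable under those reflections s_i that raise the weight.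

    Raising a weight mu to a dominant one shows (mu, mu) <= (lambda, lambda).  A
    real root alpha has positive norm, so mu + N alpha is no weight for large N
    and all root vectors of root alpha act nilpotently, with an exponent
    depending on mu and alpha only.

    The norm is obtained from the trace form sum_gamma gamma(t) gamma(t') over
    the finite roots: it is positive on coroots and invariant under reflections,
    whatever the scalar by which the given form differs from the Killing form. *)

Require Import Defs.
From HB Require Import structures.
From mathcomp Require Import all_boot all_order all_algebra.
From mathcomp Require Import boolp classical_sets functions cardinality fsbigop.
From mathcomp Require Import reals complex.
From mathcomp Require Import ring zify.

Set Implicit Arguments.
Unset Strict Implicit.
Unset Printing Implicit Defensive.

Import Order.TTheory GRing.Theory Num.Theory.
Local Open Scope ring_scope.
Local Open Scope classical_set_scope.

(** The classical proof carries local nilpotency from the simple roots to all real roots by the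
    affine Weyl group. The norm bound avoids the group: it needs only that a weight pairing
    negatively with a simple coroot can be raised, and raising terminates because it lowers the sum
    of the nonnegative c_i. The affine form is merely semidefinite, delta being isotropic, so the
    bound gives nothing along delta; along a real root the norm grows quadratically, which suffices.
    Positivity is decided over the rationals, from the integers c_i; these are determined by the
    weight because L_0 separates delta from the finite roots. Two facts tame the size of tau(A). A
    vector of weight lambda - N alpha_i with N > 0 is singular as soon as all e_i(b) kill it,
    because any other positive root vector leads outside the weights. And A / M_j is
    one-dimensional, so modulo sqrt I each b eps_j is a multiple of eps_j, and all e_i(b) act on the
    string of f_i(eps_j) by multiples of one sl2-formula. *)

HB.instance Definition _ (K : pzRingType) (L : lieType K) (V : lieModType L)
  (x : L) := GRing.isLinear.Build K V V _ (act x) (act_linearr x).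

(** * Spans and locally nilpotent operators *)

Section Subspaces.
Variables (K : pzRingType) (V : lmodType K).
Implicit Types (S X : set V).

Lemma subspaceD S u v : subspace S -> S u -> S v -> S (u + v).
Proof. by move=> [_ SL] Su Sv; rewrite -[u]scale1r; exact: SL. Qed.

Lemma subspaceZ S c u : subspace S -> S u -> S (c *: u).
Proof. by move=> [S0 SL] Su; rewrite -[_ *: _]addr0; exact: SL. Qed.

Lemma subspace_sum S (I : Type) (r : seq I) (P : pred I) (F : I -> V) :
  subspace S -> (forall i, P i -> S (F i)) -> S (\sum_(i <- r | P i) F i).
Proof.
move=> sS SF; elim/big_ind: _ => //; first by case: sS.
by move=> x y; exact: subspaceD.
Qed.

Lemma lspan_subspace X : subspace (lspan X).
Proof.
split=> [S [] //|c u v hu hv S sS XS].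
by case: (sS) => _; apply; [apply: hu|apply: hv].
Qed.

Lemma lspan_sub X : X `<=` lspan X.
Proof. by move=> v Xv S _; exact. Qed.

Lemma linear_map0 (W : lmodType K) (f : V -> W) : linear f -> f 0 = 0.
Proof.
move=> lf; apply: (addrI (f 0)).
by rewrite -[X in X + _]scale1r -lf scale1r !addr0.
Qed.

Lemma linear_mapZ (W : lmodType K) (f : V -> W) c u :
  linear f -> f (c *: u) = c *: f u.
Proof. by move=> lf; rewrite -[c *: u]addr0 lf linear_map0 ?addr0. Qed.

Lemma subspace_preimage (W : lmodType K) (S' : set W) (f : V -> W) :
  linear f -> subspace S' -> subspace [set v | S' (f v)].
Proof.
move=> lf [S0 SL]; split=> [|c u v /= hu hv]; last by rewrite lf; exact: SL.
by rewrite /= linear_map0.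
Qed.

Lemma lspan_comb X v : lspan X v -> exists (n : nat) (c : 'I_n -> K) x,
  (forall i, X (x i)) /\ v = \sum_(i < n) c i *: x i.
Proof.
pose S := [set w | exists n (c : 'I_n -> K) x,
  (forall i, X (x i)) /\ w = \sum_(i < n) c i *: x i].
move=> h; apply: (h S); last first.
  by move=> x Xx; exists 1%N, (fun _ => 1), (fun _ => x);
     rewrite big_ord1 scale1r.
split=> [|a u w [n [c [x [hx ->]]]] [m [d [y [hy ->]]]]].
  by exists 0%N, (fun _ => 0), (fun _ => 0); split; [case|rewrite big_ord0].
exists (n + m)%N, (fun i : 'I_(n + m) =>
    match fintype.split i with inl j => a * c j | inr j => d j end),
  (fun i : 'I_(n + m) => match fintype.split i with inl j => x j | inr j => y j end); split=> [i|].
  by case: fintype.splitP.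
rewrite big_split_ord scaler_sumr; congr (_ + _); apply: eq_bigr => i _.
  by rewrite scalerA (unsplitK (inl i)).
by rewrite (unsplitK (inr i)).
Qed.

Lemma iter_linear (f : {linear V -> V}) n : linear (iter n f).
Proof. by move=> c u v; elim: n => //= n ->; rewrite linearP. Qed.

Lemma iter_linear0 (f : {linear V -> V}) n : iter n f 0 = 0.
Proof. by elim: n => //= n ->; rewrite linear0. Qed.

Lemma iter_le0 (f : {linear V -> V}) n m v :
  (n <= m)%N -> iter n f v = 0 -> iter m f v = 0.
Proof. by move=> /subnK <- h; rewrite iterD h iter_linear0. Qed.

Lemma nilpotent_subspace (f : {linear V -> V}) :
  subspace [set v | exists n, iter n f v = 0].
Proof.
split=> [|c u v [n hn] [m hm]]; first by exists 0%N.
exists (n + m)%N; rewrite iter_linear (iter_le0 (leq_addr m n) hn).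
by rewrite (iter_le0 (leq_addl n m) hm) scaler0 addr0.
Qed.

Lemma last_nonzero_iter (f : {linear V -> V}) v : v <> 0 ->
  (exists n, iter n f v = 0) ->
  exists r, iter r f v <> 0 /\ f (iter r f v) = 0.
Proof.
move=> v0 [n hn].
have ex : exists n, `[< iter n f v = 0 >] by exists n; apply/asboolP.
case: (ex_minnP ex) => -[/asboolP //|r] /asboolP h hmin.
exists r; split=> // h'; have := hmin r; rewrite ltnn.
by move=> /(_ (asboolT h')).
Qed.

(** The binomial argument without coefficients: by induction on n + m, since f v and g v each have
    one of the two exponents lowered and, by commutation, keep the other. *)
Lemma nilpotent_sum_commuting (f g : {linear V -> V}) v n m :
  (forall w, f (g w) = g (f w)) -> iter n f v = 0 -> iter m g v = 0 ->
  iter (n + m) (f \+ g) v = 0.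
Proof.
move=> fg; move: {-2}(n + m)%N (erefl (n + m)%N) => k.
have comm (f1 g1 : {linear V -> V}) p w : (forall w, f1 (g1 w) = g1 (f1 w)) ->
    iter p g1 w = 0 -> iter p g1 (f1 w) = 0.
  move=> fg1; have -> : iter p g1 (f1 w) = f1 (iter p g1 w).
    by elim: p => //= p ->; rewrite fg1.
  by move=> ->; rewrite linear0.
elim: k n m v => [|k IH] n m v e fn gm.
  by move: e fn; case: n => // _ /= ->.
case: n m e fn gm => [_ _ /= -> _|n]; first exact: (iter_linear0 (f \+ g) k.+1).
case=> [_ _ /= ->|m e fn gm]; first exact: (iter_linear0 (f \+ g) k.+1).
rewrite iterSr /= -[f v]scale1r (iter_linear (f \+ g)).
rewrite (IH n m.+1 (f v)) ?(IH n.+1 m (g v)) ?scaler0 ?addr0 //; try lia.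
- by apply: comm => // w; rewrite fg.
- by rewrite -iterSr.
- by rewrite -iterSr.
- exact: comm.
Qed.

End Subspaces.

(** * Simultaneous eigenvectors *)

Section Eigenvectors.
Variables (K : fieldType) (V : lmodType K) (U : Type) (T : U -> {linear V -> V}).

(** For u separating the last eigenvalue function from [mu], the operator [T u - lam ord_max u]
    removes the last summand and multiplies v by a nonzero scalar. The functions [lam i] may
    repeat. *)
Lemma sum_distinct_eigenvectors n (lam : 'I_n -> U -> K) (w : 'I_n -> V)
    (mu : U -> K) v : (forall i u, T u (w i) = lam i u *: w i) ->
  (forall i, lam i <> mu) -> (forall u, T u v = mu u *: v) ->
  v = \sum_i w i -> v = 0.
Proof.
elim: n lam w v => [|n IH] lam w v hw lm hv e; first by rewrite e big_ord0.
have [u hu] : exists u, lam ord_max u != mu u.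
  apply: contrapT => h; apply: (lm ord_max); apply/funext => u.
  by apply/eqP; apply: contrapT => /negP h'; apply: h; exists u.
suff /eqP : (mu u - lam ord_max u) *: v = 0.
  by rewrite scaler_eq0 subr_eq0 eq_sym (negbTE hu) => /eqP.
pose i0 (i : 'I_n) := widen_ord (leqnSn n) i.
apply: (IH (fun i => lam (i0 i))
  (fun i => (lam (i0 i) u - lam ord_max u) *: w (i0 i))).
- by move=> i u'; rewrite linearZ hw /= !scalerA mulrC.
- by move=> i; exact: lm.
- by move=> u'; rewrite linearZ hv /= !scalerA mulrC.
rewrite scalerBl -hv {1}e {1}e linear_sum scaler_sumr -sumrB big_ord_recr /=.
rewrite hw subrr addr0; apply: eq_bigr => i _.
by rewrite hw scalerBl.
Qed.

Lemma span_eigenvectors (X : set (U -> K)) (mu : U -> K) (v : V) :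
  lspan (\bigcup_(lam in X) [set w | forall u, T u w = lam u *: w]) v ->
  (forall u, T u v = mu u *: v) -> v <> 0 -> X mu.
Proof.
move=> /lspan_comb[n [c [x [hx ->]]]] hv v0; apply: contrapT => Xmu; apply: v0.
have /choice[lam hlam] : forall i, exists lam, X lam /\ forall u, T u (x i) = lam u *: x i.
  by move=> i; have [lam Xl h] := hx i; exists lam.
apply: (sum_distinct_eigenvectors (lam := lam) (w := fun i => c i *: x i)) hv _.
- by move=> i u; rewrite linearZ (hlam i).2 /= !scalerA mulrC.
- by move=> i e; apply: Xmu; rewrite -e; exact: (hlam i).1.
- by [].
Qed.

Lemma distinct_eigenvectors n (lam : 'I_n -> U -> K) (w : 'I_n -> V) :
  injective lam -> (forall i u, T u (w i) = lam i u *: w i) ->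
  \sum_i w i = 0 -> forall i, w i = 0.
Proof.
move=> lam_inj hw /eqP; case: n lam w lam_inj hw => [|n] lam w lam_inj hw hs i.
  by case: i.
move: hs; rewrite (bigD1_ord i) //= addrC addr_eq0 => /eqP hs.
apply/eqP; rewrite -oppr_eq0; apply/eqP.
apply: (sum_distinct_eigenvectors (lam := fun j => lam (lift i j))
  (w := fun j => w (lift i j)) (mu := lam i)) => //.
- by move=> j /lam_inj /eqP; rewrite eq_sym (negbTE (neq_lift _ _)).
- by move=> u; rewrite linearN hw scalerN.
Qed.

End Eigenvectors.

(** * Strings of vectors under sl2-operators *)

Section Sl2.
Variables (K : numFieldType) (V : lmodType K) (E F H : {linear V -> V}).
Hypothesis EF : forall w, E (F w) = F (E w) + H w.

(** The parameter b covers three situations: b = 1 for an sl2-triple, b = 0 when H acts on the whole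
    string by one scalar, and an arbitrary b when E and H are rescaled by b, as for e_i(b') with b'
    in A. *)
Lemma string_commutator (a b : K) v :
  (forall q, H (iter q F v) = (a - 2 * b * q%:R) *: iter q F v) ->
  forall q, E (iter q.+1 F v) =
    iter q.+1 F (E v) + (q.+1%:R * (a - b * q%:R)) *: iter q F v.
Proof.
move=> Hv; elim=> [|q IH].
  by have /= -> := EF v; have /= -> := Hv 0%N; rewrite !mulr0 !subr0 mul1r.
rewrite iterS EF IH linearD linearZ -addrA Hv -scalerDl /=.
congr (_ + _ *: _); rewrite -!natr1; ring.
Qed.

Lemma string_nonzero (M : nat) v : E v = 0 -> v <> 0 ->
  (forall q, H (iter q F v) = (M%:R - 2 * q%:R) *: iter q F v) ->
  forall s, (s <= M)%N -> iter s F v <> 0.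
Proof.
move=> Ev v0 Hv; elim=> // s IH ltsM h; apply: (IH (ltnW ltsM)).
have := string_commutator (a := M%:R) (b := 1) (v := v).
rewrite mulr1 => /(_ Hv s); rewrite h Ev iter_linear0 add0r linear0 mul1r.
move/esym/eqP; rewrite scaler_eq0 mulf_eq0 pnatr_eq0 /= subr_eq0 eqr_nat.
by rewrite gtn_eqF // => /eqP.
Qed.

(** E v itself may be nonzero: with F = ad x and v of root 2 alpha, E v is a multiple of x, which ad
    x kills. *)
Lemma string_grows (a b : K) v : v <> 0 -> (forall q, iter q.+1 F (E v) = 0) ->
  (forall q : nat, a - b * q%:R != 0) ->
  (forall q, H (iter q F v) = (a - 2 * b * q%:R) *: iter q F v) ->
  forall q, iter q F v <> 0.
Proof.
move=> v0 Ev ab Hv; elim=> // q IH h; apply: IH.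
have := string_commutator Hv q; rewrite h Ev add0r linear0.
by move/esym/eqP; rewrite scaler_eq0 mulf_eq0 pnatr_eq0 (negbTE (ab q)) => /eqP.
Qed.

Lemma string_length (a : K) v k : E v = 0 -> iter k F v <> 0 ->
  F (iter k F v) = 0 ->
  (forall q, H (iter q F v) = (a - 2 * q%:R) *: iter q F v) -> a = k%:R.
Proof.
move=> Ev k0 Fk Hv; have := string_commutator (a := a) (b := 1) (v := v).
rewrite mulr1 => /(_ Hv k); rewrite iterS Fk Ev iter_linear0 add0r linear0 mul1r.
move/esym/eqP; rewrite scaler_eq0 mulf_eq0 pnatr_eq0 /= subr_eq0.
by move=> /orP[/eqP//|/eqP].
Qed.

End Sl2.

(** * Root space decomposition *)

Section InvariantForm.
Variables (K : fieldType) (g : finLieType K) (B : inv_form g).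
Implicit Types x y z : g.

Lemma inv_formDl x y z : B (x + y) z = B x z + B y z.
Proof. by have := form_linear B z 1 x y; rewrite !scale1r mul1r. Qed.
Lemma inv_form0l z : B 0 z = 0.
Proof. by apply: (addrI (B 0 z)); rewrite -inv_formDl !addr0. Qed.
Lemma inv_formZl c x z : B (c *: x) z = c * B x z.
Proof. by have := form_linear B z c x 0; rewrite inv_form0l !addr0. Qed.
Lemma inv_formDr x y z : B x (y + z) = B x y + B x z.
Proof. by rewrite form_sym inv_formDl ![B _ x]form_sym. Qed.
Lemma inv_form0r x : B x 0 = 0.
Proof. by rewrite form_sym inv_form0l. Qed.
Lemma inv_formZr c x y : B x (c *: y) = c * B x y.
Proof. by rewrite form_sym inv_formZl form_sym. Qed.
Lemma inv_formNr x y : B x (- y) = - B x y.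
Proof. by rewrite -scaleN1r inv_formZr mulN1r. Qed.
Lemma inv_formNl x y : B (- x) y = - B x y.
Proof. by rewrite -scaleN1r inv_formZl mulN1r. Qed.

End InvariantForm.

Lemma lie_leibniz (K : pzRingType) (L : lieType K) (x y z : L) :
  lie x (lie y z) = lie (lie x y) z + lie y (lie x z).
Proof.
have /eqP := lie_jacobi x y z.
rewrite [lie z x]lieC lieNr [lie z _]lieC -addrA addr_eq0 => /eqP ->.
by rewrite opprD !opprK addrC.
Qed.

Lemma sub_lfunE (K : nzRingType) (U V : vectType K) (f f' : 'Hom(U, V)) x :
  (f - f') x = f x - f' x.
Proof. by rewrite add_lfunE opp_lfunE. Qed.

Lemma natmul_lfunE (K : nzRingType) (U V : vectType K) (f : 'Hom(U, V)) n x :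
  (f *+ n) x = f x *+ n.
Proof. by elim: n => [|n IH]; rewrite ?zero_lfunE // !mulrS add_lfunE IH. Qed.

Section RootSpaces.
Variables (K : numFieldType) (g : finLieType K) (T : triangular g).
Local Notation h := (cartan T).
Local Notation alpha_ := (simple_root (t := T)).
Implicit Types (x y z : g) (alpha gamma : dual h) (t : subvs_of h).

Lemma simple_root_span (S : set (dual h)) : subspace S ->
  (forall j, S (alpha_ j)) -> forall alpha, S alpha.
Proof.
move=> sS Sj alpha; have /andP[/eqP sp _] := simple_root_basis T.
have : alpha \in <<in_tuple (codom alpha_)>>%VS by rewrite /= sp memvf.
move/coord_span ->; apply: subspace_sum => // i _; apply: subspaceZ => //.
have : (in_tuple (codom alpha_))`_i \in codom alpha_ by apply: mem_nth.
by move=> /codomP[j ->].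
Qed.

Lemma simple_root_free (c : 'I_(rank T) -> K) :
  \sum_j c j *: alpha_ j = 0 -> forall j, c j = 0.
Proof.
have /andP[_ fr] := simple_root_basis T.
move=> e j; have /freeP/(_ (fun i => c (enum_val i))) := (fr : free (codom_tuple alpha_)).
move=> /(_ _ (enum_rank j)); rewrite enum_rankK; apply.
rewrite -[RHS]e [RHS](big_enum_val (A := 'I_(rank T))) /=.
by apply: eq_bigr => i _; rewrite nth_codom.
Qed.

Lemma functional_neq0 t : t <> 0 -> exists alpha, alpha t <> 0.
Proof.
move=> t0; apply: contrapT => /forallNP hn; apply: t0; apply: val_inj => /=.
rewrite [vsval t](coord_vbasis (subvsP t)) big1 // => i _.
pose f : subvs_of h -> K^o := fun u => coord (vbasis h) i (vsval u).
have lf : linear f by move=> c u v; rewrite /f linearP.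
pose fL := GRing.isLinear.Build K _ _ _ f lf.
pose f' : {linear subvs_of h -> K^o} := HB.pack f fL.
have := hn (linfun f'); rewrite lfunE /= /f => /contrapT ->.
by rewrite scale0r.
Qed.

Lemma simple_root_sep t : (forall j, alpha_ j t = 0) -> t = 0.
Proof.
move=> h0; apply: contrapT => /functional_neq0[alpha]; apply.
apply: (simple_root_span (S := [set a : dual h | a t = 0])) => //.
split=> [|c u v /= hu hv]; first by rewrite /= zero_lfunE.
by rewrite /= add_lfunE scale_lfunE hu hv scaler0 addr0.
Qed.

Lemma root_space_subspace alpha : subspace (root_space alpha).
Proof.
split=> [t|c x y hx hy t]; first by rewrite lie0r scaler0.
by rewrite lieDr lieZr hx hy scalerDr !scalerA mulrC.
Qed.

Lemma root_space_lie alpha gamma x y : root_space alpha x ->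
  root_space gamma y -> root_space (alpha + gamma) (lie x y).
Proof.
move=> hx hy t; rewrite lie_leibniz hx hy lieZl lieZr -scalerDl.
by rewrite add_lfunE.
Qed.

Lemma root_space_iter alpha gamma x y n : root_space alpha x ->
  root_space gamma y -> root_space (gamma + alpha *+ n) (iter n (lie x) y).
Proof.
move=> hx hy; elim: n => [|n IH]; first by rewrite addr0.
by rewrite mulrS addrCA; exact: root_space_lie.
Qed.

Lemma cartan_lie_sub x y : x \in h -> y \in h -> lie x y \in h.
Proof. by have [+ _ _] := cartanP T; apply. Qed.

(** A Cartan subalgebra is given as nilpotent and self-normalizing. On a root vector of alpha a
    commutator acts by alpha x alpha y - alpha y alpha x = 0, so every simple root vanishes at
    [x, y], and the simple roots span the dual. *)
Lemma cartan_abelian x y : x \in h -> y \in h -> lie x y = 0.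
Proof.
move=> hx hy; pose t : subvs_of h := Subvs (cartan_lie_sub hx hy).
suff t0 : t = 0 by have := congr1 vsval t0; rewrite linear0.
apply: simple_root_sep => j; have [_ [z hz z0]] := simple_rootP j.
have hx' : lie x z = _ := hz (Subvs hx).
have hy' : lie y z = _ := hz (Subvs hy).
have : lie (lie x y) z = alpha_ j t *: z := hz t.
have /eqP := lie_leibniz x y z; rewrite -subr_eq => /eqP <-.
rewrite hx' hy' !lieZr hx' hy' !scalerA mulrC subrr => /esym/eqP.
by rewrite scaler_eq0 => /orP[/eqP//|/eqP].
Qed.

Lemma root_space0 x : x \in h -> root_space (0 : dual h) x.
Proof.
by move=> hx t; rewrite zero_lfunE scale0r (cartan_abelian (subvsP t) hx).
Qed.

Lemma root_decomposition (S : set g) : subspace S ->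
  (forall x, x \in h -> S x) ->
  (forall alpha x, is_root alpha -> root_space alpha x -> S x) -> forall x, S x.
Proof.
move=> sS Sh Sr x.
have : x \in (nminus T + h + nplus T)%VS by rewrite Defs.triangular_sum memvf.
case/memv_addP => u /memv_addP[n' /nminusP hn' [t ht ->]] [n /nplusP hn ->].
apply: (subspaceD sS); first apply: (subspaceD sS); last 1 first.
- by apply: hn => // y [alpha [ra _]]; exact: Sr.
- by apply: hn' => // y [alpha [ra _]]; exact: Sr.
- exact: Sh.
Qed.

Lemma root_vectors_free n (lam : 'I_n -> dual h) (x : 'I_n -> g) :
  injective lam -> (forall i, root_space (lam i) (x i)) ->
  \sum_i x i = 0 -> forall i, x i = 0.
Proof.
move=> inj hx; apply: (distinct_eigenvectors (T := fun t : subvs_of h => lie (vsval t))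
  (lam := fun i t => lam i t)).
  move=> i j e; apply: inj; apply/lfunP => t.
  exact: (congr1 (fun f => f t) e).
by move=> i t; exact: hx.
Qed.

Lemma roots_bounded (s : seq (dual h)) : uniq s ->
  (forall alpha, alpha \in s -> is_root alpha) -> (size s <= \dim {:g})%N.
Proof.
move=> us hs.
have /choice[x hx] : forall i : 'I_(size s), exists x, root_space s`_i x /\ x <> 0.
  by move=> i; have [_ [x h1 h2]] := hs _ (mem_nth 0 (ltn_ord i)); exists x.
suff fr : free [tuple x i | i < size s].
  have := dimvS (subvf <<[tuple x i | i < size s]>>%VS).
  by rewrite (eqP fr) size_tuple.
apply/freeP => k e i.
have inj : injective (fun i : 'I_(size s) => s`_i).
  move=> a b /eqP; rewrite nth_uniq // => /eqP; exact: val_inj.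
have k0 : forall j, k j *: x j = 0.
  move=> j; apply: (root_vectors_free (x := fun j => k j *: x j) inj) => {j} [j|].
    exact: (subspaceZ _ (root_space_subspace _) (hx j).1).
  by rewrite -[RHS]e; apply: eq_bigr => j _; rewrite -tnth_nth tnth_mktuple.
have /eqP := k0 i; rewrite scaler_eq0 => /orP[/eqP//|/eqP x0].
by have := (hx i).2.
Qed.

(** Being a root is only a predicate; sums over the roots need an enumeration. A duplicate-free list
    of roots of maximal length is one, and it exists because root vectors of distinct roots are
    linearly independent. *)
Definition roots : seq (dual h) :=
  xget [::] [set s | uniq s /\ forall alpha, alpha \in s <-> is_root alpha].

Lemma roots_spec : uniq roots /\ forall alpha, alpha \in roots <-> is_root alpha.
Proof.
rewrite /roots; set R := (X in xget _ X).
suff hR : exists s, R s by exact: (xgetPex [::] hR).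
pose P n := `[< exists s : seq (dual h), [/\ uniq s,
  forall alpha, alpha \in s -> is_root alpha & size s = n] >].
have exP : exists n, P n by exists 0%N; apply/asboolP; exists [::].
have bd n : P n -> (n <= \dim {:g})%N.
  by move=> /asboolP[s [us hs <-]]; exact: roots_bounded.
case: (ex_maxnP exP bd) => n /asboolP[s [us hs sz]] max.
exists s; split=> // alpha; split=> [|ra]; first exact: hs.
apply: contrapT => /negP ns; suff : P n.+1 by move=> /max; rewrite ltnn.
apply/asboolP; exists (alpha :: s); split=> /=; rewrite ?ns ?sz //.
by move=> gamma; rewrite inE => /predU1P[-> | /hs].
Qed.

Lemma roots_uniq : uniq roots. Proof. by case: roots_spec. Qed.
Lemma mem_roots alpha : alpha \in roots <-> is_root alpha.
Proof. by case: roots_spec. Qed.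

Lemma root_vector_nilpotent alpha x : alpha <> 0 -> root_space alpha x ->
  forall z, exists n, iter n (lie x) z = 0.
Proof.
move=> a0 hx.
suff key gamma z : root_space gamma z -> exists n, iter n (lie x) z = 0.
  apply: (root_decomposition (nilpotent_subspace (lie x))) => [z hz|gamma z _].
    exact: key (root_space0 hz).
  exact: key.
move=> hz; apply: contrapT => /forallNP hn.
(* Pigeonhole: these are [(size roots).+2] distinct functionals, each of which is 0 or a root. *)
pose s := [seq gamma + alpha *+ n | n <- iota 0 (size roots).+2].
have us : uniq s.
  rewrite map_inj_uniq ?iota_uniq // => a b /addrI/eqP.
  rewrite -!scaler_nat -subr_eq0 -scalerBl scaler_eq0 subr_eq0 eqr_nat.
  by move=> /orP[/eqP//|/eqP].
have := uniq_leq_size (s2 := 0 :: roots) us; rewrite size_map size_iota /= ltnn.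
move=> /(_ _)/negP; apply; [|by []] => _ /mapP[n _ ->].
rewrite inE; case: eqP => //= n0; apply/mem_roots; split=> //.
by exists (iter n (lie x) z); [exact: root_space_iter|exact: hn].
Qed.

End RootSpaces.

(** * Coroots, root strings and the trace form *)

Section RootSystem.
Variables (K : numFieldType) (g : finLieType K) (B : inv_form g).
Variable T : triangular g.
Local Notation h := (cartan T).
Implicit Types (x y z : g) (alpha gamma : dual h) (t u : subvs_of h).

Lemma dual_neq0 alpha : alpha <> 0 -> exists t, alpha t <> 0.
Proof.
move=> a0; apply: contrapT => /forallNP hn; apply: a0; apply/lfunP => t.
by rewrite zero_lfunE; apply: contrapT; exact: hn.
Qed.

Lemma form_root_orthogonal alpha gamma x y : root_space alpha x ->
  root_space gamma y -> alpha + gamma <> 0 -> B x y = 0.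
Proof.
move=> hx hy /dual_neq0[t /eqP]; rewrite add_lfunE => nz.
have : (alpha t : K) * B x y = - ((gamma t : K) * B x y).
  rewrite -inv_formZl -hx lieC inv_formNl form_inv hy inv_formZr //.
by move/eqP; rewrite -addr_eq0 -mulrDl mulf_eq0 (negbTE nz) => /eqP.
Qed.

Lemma form_subspace x : subspace [set y | B x y = 0].
Proof.
split=> [|c u v /= hu hv]; first exact: inv_form0r.
by rewrite /= inv_formDr inv_formZr hu hv mulr0 addr0.
Qed.

Lemma form_root_pairing alpha x : alpha <> 0 -> root_space alpha x -> x <> 0 ->
  exists y, root_space (- alpha) y /\ B x y = 1.
Proof.
move=> a0 hx x0.
have [y [hy nz]] : exists y, root_space (- alpha) y /\ B x y != 0.
  apply: contrapT => /forallNP hn; apply: x0; apply: (form_nondeg (i := B)).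
  apply: (root_decomposition (T := T) (form_subspace x)) => [y hy|gamma y rg hy] /=.
    by apply: (form_root_orthogonal hx (root_space0 hy)); rewrite addr0.
  have [e|ne] := eqVneq (alpha + gamma) 0; last first.
    by apply: (form_root_orthogonal hx hy); exact/eqP.
  apply/eqP; apply: contrapT => /negP nz; apply: (hn y); split=> //.
  by move/eqP: e; rewrite addrC addr_eq0 => /eqP <-.
exists ((B x y)^-1 *: y); split; last by rewrite inv_formZr mulVf.
by apply: (subspaceZ _ (root_space_subspace _)).
Qed.

Lemma root_opp alpha : is_root alpha -> is_root (- alpha).
Proof.
move=> [a0 [x hx x0]]; have [y [hy Bxy]] := form_root_pairing a0 hx x0.
split; first by apply/eqP; rewrite oppr_eq0; exact/eqP.
exists y => // y0; move: Bxy; rewrite y0 inv_form0r => /eqP.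
by rewrite eq_sym oner_eq0.
Qed.

Lemma form_cartan_nondeg t : (forall u, B (vsval t) (vsval u) = 0) -> t = 0.
Proof.
move=> ht; apply: val_inj; apply: (form_nondeg (i := B)).
apply: (root_decomposition (T := T) (form_subspace _)) => [y hy|gamma y [g0 _] hy] /=.
  exact: (ht (Subvs hy)).
apply: (form_root_orthogonal (root_space0 (subvsP t)) hy).
by rewrite add0r.
Qed.

Lemma centralizer_cartan x : root_space (0 : dual h) x -> x \in h.
Proof.
move=> hx; have [_ _] := cartanP T; apply=> y hy.
have := hx (Subvs hy); rewrite zero_lfunE scale0r /= => yx.
by rewrite lieC yx oppr0 mem0v.
Qed.

Lemma lie_opposite_mem alpha x y : root_space alpha x ->
  root_space (- alpha) y -> lie x y \in h.
Proof.
move=> hx hy; apply: centralizer_cartan.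
by have := root_space_lie hx hy; rewrite subrr.
Qed.

Lemma form_lie_opposite alpha x y t : root_space (- alpha) y ->
  B (lie x y) (vsval t) = (alpha t : K) * B x y.
Proof.
by move=> hy; rewrite form_inv lieC inv_formNr hy inv_formZr opp_lfunE mulNr opprK.
Qed.

(** [dual_vec] falls back to 0 when nothing represents alpha. For a root, [x, y] does, where x and y
    are root vectors of alpha and - alpha with B x y = 1. *)
Lemma dual_vecE alpha : is_root alpha ->
  forall t, B (vsval (dual_vec B alpha)) (vsval t) = alpha t.
Proof.
move=> [a0 [x hx x0]]; rewrite /dual_vec; set R := (X in xget _ X).
suff hR : exists s, R s by exact: (xgetPex 0 hR).
have [y [hy Bxy]] := form_root_pairing a0 hx x0.
exists (Subvs (lie_opposite_mem hx hy)) => t /=.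
by rewrite (form_lie_opposite _ _ hy) Bxy mulr1.
Qed.

Lemma dual_vec_uniq alpha t : is_root alpha ->
  (forall u, B (vsval t) (vsval u) = alpha u) -> t = dual_vec B alpha.
Proof.
move=> ra ht; apply/eqP; rewrite -subr_eq0; apply/eqP.
apply: form_cartan_nondeg => u.
by rewrite linearB /= inv_formDl inv_formNl ht dual_vecE // subrr.
Qed.

Lemma lie_opposite alpha x y : is_root alpha -> root_space alpha x ->
  root_space (- alpha) y -> lie x y = B x y *: vsval (dual_vec B alpha).
Proof.
move=> ra hx hy; pose t : subvs_of h := Subvs (lie_opposite_mem hx hy).
suff e : t = B x y *: dual_vec B alpha by rewrite -linearZ -e.
apply/eqP; rewrite -subr_eq0; apply/eqP; apply: form_cartan_nondeg => u.
rewrite linearB linearZ /= inv_formDl inv_formZl inv_formNl dual_vecE //.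
by rewrite (form_lie_opposite _ _ hy) mulrN mulrC subrr.
Qed.

Lemma dual_normE alpha : is_root alpha ->
  dual_norm B alpha = alpha (dual_vec B alpha).
Proof. by move=> ra; rewrite /dual_norm dual_vecE. Qed.

Lemma lie_iter_root_space alpha gamma t y z n : root_space alpha y ->
  root_space gamma z -> lie (vsval t) (iter n (lie y) z) =
  ((gamma t : K) + n%:R * (alpha t : K)) *: iter n (lie y) z.
Proof.
move=> hy hz; have := root_space_iter n hy hz t.
by rewrite add_lfunE natmul_lfunE mulr_natl.
Qed.

(* If (alpha, alpha) = 0 then [x, y] = t_alpha acts by one scalar on each
   alpha-string, and this scalar must vanish for the string to be finite; thus
   all roots vanish at t_alpha. *)
Lemma dual_norm_neq0 alpha : is_root alpha -> dual_norm B alpha != 0.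
Proof.
move=> ra; have [a0 [x hx x0]] := ra; apply/negP => /eqP.
rewrite dual_normE // => N0.
have [y [hy Bxy]] := form_root_pairing a0 hx x0.
have xy : lie x y = vsval (dual_vec B alpha).
  by rewrite (lie_opposite ra) // Bxy scale1r.
have t0 : dual_vec B alpha = 0.
  apply: simple_root_sep => j; set gamma := simple_root j; set t := dual_vec _ _.
  have [_ [z hz z0]] := simple_rootP j.
  apply: contrapT => /eqP c0.
  have [r [ru r0]] := last_nonzero_iter z0 (root_vector_nilpotent a0 hx z).
  set u := iter r (lie x) z in ru r0.
  have hu : root_space (gamma + alpha *+ r) u by exact: root_space_iter.
  have na0 : - alpha <> 0 by apply/eqP; rewrite oppr_eq0; exact/eqP.
  have [n hn] := root_vector_nilpotent na0 hy u; move: hn.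
  have EF w : lie x (lie y w) = lie y (lie x w) + lie (vsval t) w.
    by rewrite lie_leibniz xy addrC.
  apply: (string_grows (E := lie x) (F := lie y) EF (a := gamma t) (b := 0)) => //.
  - by move=> q; rewrite /= r0 -iterS iter_linear0.
  - by move=> q; rewrite mul0r subr0.
  - move=> q /=; rewrite (lie_iter_root_space _ _ hy hu) add_lfunE natmul_lfunE opp_lfunE.
    have -> : alpha t = 0 by exact: N0.
    by rewrite mul0rn oppr0 !mulr0 !mul0r !addr0 subr0.
have [t] := dual_neq0 a0; apply.
by rewrite -dual_vecE // t0 linear0 inv_form0l.
Qed.

Lemma root_coroot alpha : is_root alpha -> (alpha (coroot B alpha) : K) = 2.
Proof.
move=> ra; rewrite /coroot linearZ /= -dual_normE //.
by rewrite [LHS](mulfVK (dual_norm_neq0 ra)).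
Qed.

Lemma dual_vecN alpha : is_root alpha -> dual_vec B (- alpha) = - dual_vec B alpha.
Proof.
move=> ra; apply/esym/dual_vec_uniq; first exact: root_opp.
by move=> u; rewrite linearN /= inv_formNl dual_vecE // opp_lfunE.
Qed.

Lemma dual_normN alpha : is_root alpha -> dual_norm B (- alpha) = dual_norm B alpha.
Proof. by move=> ra; rewrite /dual_norm dual_vecN // linearN /= inv_formNl inv_formNr opprK. Qed.

Lemma corootN alpha : is_root alpha -> coroot B (- alpha) = - coroot B alpha.
Proof. by move=> ra; rewrite /coroot dual_vecN // dual_normN // scalerN. Qed.

Lemma root_sl2 alpha x : is_root alpha -> root_space alpha x -> x <> 0 ->
  exists y, [/\ root_space (- alpha) y, B x y = 2 / dual_norm B alpha &
    lie x y = vsval (coroot B alpha)].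
Proof.
move=> ra hx x0; have [y [hy Bxy]] := form_root_pairing ra.1 hx x0.
exists ((2 / dual_norm B alpha) *: y); split.
- exact: (subspaceZ _ (root_space_subspace _)).
- by rewrite inv_formZr Bxy mulr1.
- by rewrite lieZr (lie_opposite ra) // Bxy scale1r linearZ.
Qed.

(** z is first raised to a vector killed by ad x, after r steps; the finite string below that vector
    forces its weight to be the natural number k, and none of the first k steps down reaches
    zero. *)
Lemma root_string alpha gamma z : is_root alpha -> root_space gamma z -> z <> 0 ->
  exists x y r k, [/\ root_space alpha x, root_space (- alpha) y,
    (gamma (coroot B alpha) : K) + 2 * r%:R = k%:R &
    forall s, (s <= k)%N -> iter s (lie y) (iter r (lie x) z) <> 0].
Proof.
move=> ra hz z0; have [a0 [x hx x0]] := ra.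
have [y [hy _ xy]] := root_sl2 ra hx x0.
have [r [ru r0]] := last_nonzero_iter z0 (root_vector_nilpotent a0 hx z).
set u := iter r (lie x) z in ru r0.
have hu : root_space (gamma + alpha *+ r) u by exact: root_space_iter.
have [k [ku k0]] := last_nonzero_iter ru (root_vector_nilpotent (root_opp ra).1 hy u).
have EF w : lie x (lie y w) = lie y (lie x w) + lie (vsval (coroot B alpha)) w.
  by rewrite lie_leibniz xy addrC.
have Hu q : lie (vsval (coroot B alpha)) (iter q (lie y) u) =
    ((gamma (coroot B alpha) : K) + 2 * r%:R - 2 * q%:R) *: iter q (lie y) u.
  rewrite (lie_iter_root_space _ _ hy hu) add_lfunE natmul_lfunE opp_lfunE.
  by rewrite root_coroot //; congr (_ *: _); ring.
have ek := string_length (E := lie x) (F := lie y) EF r0 ku k0 Hu.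
exists x, y, r, k; split=> // s sk.
apply: (string_nonzero (E := lie x) (F := lie y) EF r0 ru _ sk) => q.
by rewrite /= Hu ek.
Qed.

Lemma cartan_integer alpha gamma : is_root alpha -> is_root gamma ->
  exists m : int, (gamma (coroot B alpha) : K) = m%:~R.
Proof.
move=> ra [_ [z hz z0]]; have [x [y [r [k [_ _ e _]]]]] := root_string ra hz z0.
exists (k%:Z - (2 * r)%:Z).
by rewrite rmorphB /= -!pmulrn natrM -e addrK.
Qed.

Definition reflection alpha gamma : dual h :=
  gamma - (gamma (coroot B alpha) : K) *: alpha.

Lemma reflectionK alpha : is_root alpha -> involutive (reflection alpha).
Proof.
move=> ra gamma; rewrite /reflection.
set c : K := gamma (coroot B alpha).
have -> : (gamma - c *: alpha) (coroot B alpha) = - c :> K.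
  by rewrite sub_lfunE scale_lfunE root_coroot // -/c /GRing.scale /=; ring.
by rewrite scaleNr opprK subrK.
Qed.

Lemma reflection_root alpha gamma : is_root alpha -> is_root gamma ->
  is_root (reflection alpha gamma).
Proof.
move=> ra [g0 [z hz z0]]; split.
  move=> e; apply: g0; rewrite -[gamma](reflectionK ra) e.
  by rewrite /reflection zero_lfunE scale0r subr0.
(* The existential says that gamma takes a nonnegative integer value on the coroot. Otherwise alpha
   is replaced by - alpha, which has the same reflection. The reflected root then lies k - r steps
   below gamma + r alpha, as that value is k - 2 r. *)
wlog ge0 : alpha ra / exists k r : nat,
    (gamma (coroot B alpha) : K) + 2 * r%:R = k%:R /\ (2 * r <= k)%N.
  move=> hw; have [x [y [r [k [_ _ e _]]]]] := root_string ra hz z0.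
  have [le|/ltnW ge] := leqP (2 * r) k; first by apply: hw => //; exists k, r.
  have := hw (- alpha) (root_opp ra).
  have -> : reflection (- alpha) gamma = reflection alpha gamma.
    by rewrite /reflection corootN // scalerN opprK [gamma (- _)]linearN scaleNr.
  apply; exists (2 * r - k)%N, 0%N; split=> //.
  rewrite corootN // [gamma (- _)]linearN mulr0 addr0 natrB // -e natrM.
  by rewrite opprD addrCA subrr addr0.
have [x [y [r [k [hx hy e nz]]]]] := root_string ra hz z0.
have le : (2 * r <= k)%N.
  have [k' [r' [e' le']]] := ge0; rewrite -(ler_nat K) -e natrM lerDr.
  by rewrite -[gamma _ : K](addrK (2 * r'%:R)) e' -natrM subr_ge0 ler_nat.
exists (iter (k - r) (lie y) (iter r (lie x) z)); last by apply: nz; lia.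
have -> : reflection alpha gamma = gamma + alpha *+ r + (- alpha) *+ (k - r).
  rewrite /reflection; have -> : (gamma (coroot B alpha) : K) = k%:R - 2 * r%:R by rewrite -e addrK.
  rewrite -!addrA; congr (_ + _).
  rewrite mulNrn -!scaler_nat -scalerBl -scaleNr; congr (_ *: _).
  rewrite natrB; [ring|lia].
exact: root_space_iter (root_space_iter _ _ _).
Qed.

(** Here ad y plays E and ad x plays F. A nonzero z would start a string with a = - (n + 1), for
    which a - q never vanishes, against the nilpotency of ad x. *)
Lemma lowest_weight_vanishes alpha gamma x y z (n : nat) :
  root_space alpha x -> lie x y = vsval (coroot B alpha) -> is_root alpha ->
  root_space gamma z -> (gamma (coroot B alpha) : K) = n.+1%:R ->
  (forall q, iter q.+1 (lie x) (lie y z) = 0) -> z = 0.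
Proof.
move=> hx + ra; move: (root_coroot ra); move: (coroot B alpha) => c ac xy hz gn yz.
apply: contrapT => z0; have [k] := root_vector_nilpotent ra.1 hx z.
have Nc : vsval (- c) = - vsval c by exact: linearN.
have EF w : lie y (lie x w) = lie x (lie y w) + lie (vsval (- c)) w.
  by rewrite Nc -xy -lieC lie_leibniz addrC.
apply: (string_grows (E := lie y) (F := lie x) EF (a := - n.+1%:R) (b := 1)) => //.
- by move=> q; rewrite mul1r -opprD -natrD oppr_eq0 pnatr_eq0.
- move=> q; change (lie (vsval (- c)) (iter q (lie x) z) =
    (- n.+1%:R - 2 * 1 * q%:R) *: iter q (lie x) z).
  rewrite Nc lieNl (lie_iter_root_space _ _ hx hz) gn ac -scaleNr.
  by congr (_ *: _); ring.
Qed.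

(** Subtracting the multiple of x that makes the pairing with y vanish leaves a vector killed by ad
    y and of weight 2, hence zero. *)
Lemma root_space_dim1 alpha x z : is_root alpha -> root_space alpha x ->
  x <> 0 -> root_space alpha z -> exists c : K, z = c *: x.
Proof.
move=> ra hx x0 hz; have [y [hy Bxy xy]] := root_sl2 ra hx x0.
have nz : B x y != 0 by rewrite Bxy mulf_neq0 ?invr_eq0 ?dual_norm_neq0 ?pnatr_eq0.
exists (B z y / B x y); apply/eqP; rewrite -subr_eq0; apply/eqP.
have hw : root_space alpha (z - (B z y / B x y) *: x).
  rewrite addrC -scaleNr.
  by have [_] := root_space_subspace alpha; apply.
apply: (lowest_weight_vanishes (n := 1) hx xy ra hw) => [|q].
  exact: root_coroot.
rewrite (_ : lie y _ = 0) ?iter_linear0 //.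
rewrite lieC (lie_opposite ra hw hy) inv_formDl inv_formNl inv_formZl divfK //.
by rewrite subrr scale0r oppr0.
Qed.

(** For z of root 2 alpha, [y, z] is a multiple of x because the root space of alpha is a line; so
    ad x kills it, while z has the positive weight 4. *)
Lemma double_root alpha : is_root alpha -> ~ is_root (alpha *+ 2).
Proof.
move=> ra [_ [z hz]]; apply; have [_ [x hx x0]] := ra.
have [y [hy _ xy]] := root_sl2 ra hx x0.
apply: (lowest_weight_vanishes (n := 3) hx xy ra hz) => [|q].
  by rewrite natmul_lfunE root_coroot // -mulrnA.
have hw : root_space alpha (lie y z).
  by have := root_space_lie hy hz; rewrite mulr2n addKr.
have [c ->] := root_space_dim1 ra hx x0 hw.
by rewrite iterSr lieZr lie_xx scaler0 iter_linear0.
Qed.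

(** The value m of alpha on the coroot of k alpha is an integer with m k = 2, which leaves k = 1 and
    the excluded k = 2. *)
Lemma multiple_root alpha k : is_root alpha -> is_root (alpha *+ k) -> k = 1%N.
Proof.
move=> ra rk; have [m hm] := cartan_integer rk ra.
have /eqP : (m * k%:Z)%:~R = 2%:~R :> K.
  have := root_coroot rk; rewrite natmul_lfunE => e.
  by rewrite intrM -pmulrn mulr_natr -hm; exact: e.
rewrite eqr_int => /eqP mk.
have : (k %| 2)%N by apply/dvdnP; exists `|m|%N; by have := congr1 absz mk; rewrite abszM => /esym.
case: k rk {hm mk} => [|[|[|k]]] // rk _; by case: (double_root ra rk).
Qed.

(** The Killing form restricted to the Cartan subalgebra, because the root spaces are lines. *)
Definition trace_form (t u : subvs_of h) : K :=
  \sum_(gamma <- roots T) (gamma t : K) * (gamma u : K).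

Lemma trace_formC t u : trace_form t u = trace_form u t.
Proof. by apply: eq_bigr => gamma _; rewrite mulrC. Qed.

Lemma trace_form_linear t : scalar (trace_form t).
Proof.
move=> c u v; rewrite /trace_form mulr_sumr -big_split; apply: eq_bigr => gamma _.
by rewrite linearP /= mulrDr mulrCA.
Qed.

(* Polarizes the invariance of the trace form under the reflection of alpha. *)
Lemma trace_form_coroot alpha t : is_root alpha ->
  2 * trace_form (coroot B alpha) t =
  trace_form (coroot B alpha) (coroot B alpha) * (alpha t : K).
Proof.
move=> ra; set c := coroot B alpha.
have inv u v : trace_form (u - (alpha u : K) *: c) (v - (alpha v : K) *: c) = trace_form u v.
  have refl gamma w : gamma (w - (alpha w : K) *: c) = reflection alpha gamma w.
    by rewrite sub_lfunE linearB linearZ scale_lfunE; congr (_ - _); exact: mulrC.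
  rewrite /trace_form; under eq_bigr do rewrite !refl.
  rewrite -(big_map (reflection alpha) predT (fun gamma : dual h => (gamma u : K) * (gamma v : K))).
  apply: perm_big; apply: uniq_perm; last 1 first.
  - move=> gamma; apply/mapP/idP => [[z /mem_roots rz ->]|/mem_roots rg].
      exact/mem_roots/reflection_root.
    exists (reflection alpha gamma); last by rewrite reflectionK.
    exact/mem_roots/reflection_root.
  - by rewrite map_inj_uniq ?roots_uniq //; exact: inv_inj (reflectionK ra).
  - exact: roots_uniq.
have lin a u v : trace_form u (a *: v) = a * trace_form u v.
  have := trace_form_linear u a v 0; rewrite addr0 => ->.
  by rewrite [X in _ + X](_ : _ = 0) ?addr0 // /trace_form big1 // => i _;
     rewrite linear0 mulr0.
have := inv c t; rewrite /c root_coroot // -/c.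
have -> : c - 2 *: c = (-1) *: c by rewrite -{1}[c]scale1r -scalerBl; congr (_ *: _); ring.
rewrite trace_formC lin addrC -scaleNr trace_formC -/(trace_form _ _).
have -> := trace_form_linear c (- (alpha t : K)) c t.
move=> e; rewrite mulr_natl mulr2n -{1}e; ring.
Qed.

(** A sum of squares of Cartan integers, to which alpha contributes 4. Stated with a natural number,
    so that the value can be moved between K and the rationals. *)
Lemma trace_form_coroot_pos alpha : is_root alpha -> exists n : nat,
  trace_form (coroot B alpha) (coroot B alpha) = n.+1%:R.
Proof.
move=> ra; set c := coroot B alpha.
have /choice[m hm] : forall gamma, exists m : int, is_root gamma -> (gamma c : K) = m%:~R.
  move=> gamma; have [rg|nr] := pselect (is_root gamma); last by exists 0.
  by have [m] := cartan_integer ra rg; exists m.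
pose N : int := \sum_(gamma <- roots T) m gamma * m gamma.
have e : trace_form c c = N%:~R.
  rewrite /N rmorph_sum /trace_form !big_seq; apply: eq_bigr => gamma.
  by move=> /mem_roots rg; rewrite rmorphM /= hm.
have N0 : 0 < N.
  rewrite /N (bigD1_seq alpha) ?roots_uniq //=; last exact/mem_roots.
  have m2 : m alpha = 2.
    by apply/eqP; rewrite -(eqr_int K) -hm // root_coroot.
  rewrite m2 ltr_wpDr // sumr_ge0 // => gamma _; exact: sqr_ge0 (m gamma).
case: N N0 e => // -[//|n] _ ->; by exists n; rewrite -pmulrn.
Qed.

End RootSystem.

(** * Weights and the norm *)

Section WeightLattice.
Variables (I : finType) (m : I -> nat) (a : I -> I -> int) (d : I -> rat).
Hypotheses (d_gt0 : forall i, 0 < d i) (a_diag : forall i, a i i = 2).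
Hypothesis (a_sym : forall i j, d i * (a i j)%:~R = d j * (a j i)%:~R).

(** The value of lambda - sum_j c_j alpha_j at the i-th coroot, where m lists the values of lambda
    and a is the Cartan matrix. *)
Definition weight_pairing (c : I -> int) (i : I) : int :=
  (m i)%:Z - \sum_j a i j * c j.

Definition lattice_form (x y : I -> int) : rat :=
  \sum_i \sum_j d i * (a i j)%:~R * (x i)%:~R * (y j)%:~R.

(* With the weight lambda - sum_i c_i alpha_i for c, this is
   (lambda, lambda) - (mu, mu) up to normalization. *)
Definition norm_drop (c : I -> int) : rat :=
  \sum_i d i * (c i)%:~R * ((m i)%:Z + weight_pairing c i)%:~R.

Let lin (x : I -> int) : rat := 2 * \sum_i d i * (m i)%:R * (x i)%:~R.

Lemma norm_dropE c : norm_drop c = lin c - lattice_form c c.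
Proof.
rewrite /norm_drop /lin mulr_sumr -sumrB; apply: eq_bigr => i _.
rewrite /weight_pairing !rmorphD rmorphN rmorph_sum /= -pmulrn.
rewrite addrA !mulrDr mulrN mulr_sumr; congr (_ - _); first by ring.
by apply: eq_bigr => j _; rewrite rmorphM /=; ring.
Qed.

Lemma lattice_form_sym x y : lattice_form x y = lattice_form y x.
Proof.
rewrite /lattice_form exchange_big; apply: eq_bigr => i _; apply: eq_bigr => j _.
by rewrite -a_sym; ring.
Qed.

Lemma norm_drop_add (c x : I -> int) (k : int) :
  norm_drop (fun i => c i + k * x i) = norm_drop c
  + k%:~R * (lin x - 2 * lattice_form x c) - k%:~R ^+ 2 * lattice_form x x.
Proof.
rewrite !norm_dropE.
have -> : lin (fun i => c i + k * x i) = lin c + k%:~R * lin x.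
  rewrite /lin [k%:~R * _]mulrCA -mulrDr; congr (_ * _); rewrite mulr_sumr -big_split.
  by apply: eq_bigr => i _; rewrite rmorphD rmorphM /=; ring.
have -> : lattice_form (fun i => c i + k * x i) (fun i => c i + k * x i) =
    lattice_form c c + k%:~R * lattice_form x c + k%:~R * lattice_form c x
    + k%:~R ^+ 2 * lattice_form x x.
  rewrite /lattice_form !mulr_sumr -!big_split; apply: eq_bigr => i _ /=.
  rewrite !mulr_sumr -!big_split; apply: eq_bigr => j _ /=.
  by rewrite !rmorphD !rmorphM /=; ring.
by rewrite (lattice_form_sym c x); ring.
Qed.

(** The new coordinates are those of the image of lambda - sum_j c_j alpha_j under s_i, which is an
    isometry. *)
Lemma norm_drop_reflection c i :
  norm_drop (fun j => c j + weight_pairing c i * (j == i)%:Z) = norm_drop c.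
Proof.
rewrite norm_drop_add; set e := fun j : I => (j == i)%:Z.
have e_sum (F : I -> rat) : \sum_j F j * (e j)%:~R = F i.
  rewrite (bigD1 i) //= /e eqxx mulr1 big1 ?addr0 // => j /negbTE ->.
  by rewrite mulr0.
have form_e y : lattice_form e y = d i * \sum_j (a i j * y j)%:~R.
  rewrite /lattice_form -[RHS](e_sum (fun i => d i * \sum_j (a i j * y j)%:~R)).
  apply: eq_bigr => k _; rewrite mulr_sumr mulr_suml; apply: eq_bigr => j _.
  by rewrite rmorphM /=; ring.
have -> : lin e = 2 * (d i * (m i)%:R).
  by rewrite /lin (e_sum (fun i => d i * (m i)%:R)).
have -> : lattice_form e e = 2 * d i.
  rewrite form_e; under eq_bigr do rewrite rmorphM /=.
  by rewrite (e_sum (fun j => (a i j)%:~R)) a_diag mulrC.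
rewrite form_e; set p := weight_pairing c i.
have -> : \sum_j (a i j * c j)%:~R = (m i)%:R - p%:~R :> rat.
  rewrite /p /weight_pairing rmorphB rmorph_sum /= -pmulrn.
  by rewrite opprB addrC subrK.
ring.
Qed.

Variable P : (I -> int) -> Prop.
Hypothesis P_ge0 : forall c, P c -> forall i, 0 <= c i.
Hypothesis P_reflection : forall c i, P c -> weight_pairing c i < 0 ->
  P (fun j => c j + weight_pairing c i * (j == i)%:Z).

(** At a dominant weight mu every summand of (lambda - mu, lambda + mu) is nonnegative. Elsewhere
    some reflection lowers the sum of the c_j and preserves the norm. *)
Lemma norm_drop_ge0 c : P c -> 0 <= norm_drop c.
Proof.
have [n] := ubnP (absz (\sum_i c i)); elim: n c => // n IH c lt Pc.
have [[i neg]|/forallNP dom] := pselect (exists i, weight_pairing c i < 0).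
  rewrite -(norm_drop_reflection c i); apply: (IH _ _ (P_reflection Pc neg)).
  have := sumr_ge0 (index_enum I) (P := xpredT) (fun j _ => P_ge0 (P_reflection Pc neg) j).
  have -> : \sum_j (c j + weight_pairing c i * (j == i)%:Z) =
      \sum_j c j + weight_pairing c i.
    rewrite big_split -mulr_sumr; have -> : \sum_j (j == i)%:Z = 1.
      by rewrite (bigD1 i) //= eqxx big1 ?addr0 // => j /negbTE ->.
    by rewrite mulr1.
  by move: neg lt; move: (weight_pairing c i) (\sum_j c j) => p s; lia.
apply: sumr_ge0 => i _; apply: mulr_ge0; first apply: mulr_ge0.
- exact: ltW.
- by rewrite ler0z; exact: P_ge0.
- by rewrite ler0z addr_ge0 // leNgt; exact/negP.
Qed.

Lemma lattice_ray_leaves c x : P c -> 0 < lattice_form x x ->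
  exists N : nat, ~ P (fun i => c i + N%:Z * x i).
Proof.
move=> Pc q0; set q := lattice_form x x in q0.
set X := lin x - 2 * lattice_form x c.
(* With D the drop at c, N > (|X| + D) / q gives D + N X <= N (|X| + D) < N^2 q. The successor
   ensures N >= 1, which is used for D <= N D. *)
pose N := (Num.Def.archi_bound ((`|X| + norm_drop c) / q)).+1.
exists N => /norm_drop_ge0; rewrite norm_drop_add -/X -/q leNgt => /negP; apply.
clearbody X; have D0 := norm_drop_ge0 Pc.
have N1 : 1 <= N%:Z%:~R :> rat by rewrite -pmulrn ler1n.
have : (`|X| + norm_drop c) / q < N%:Z%:~R.
  rewrite -pmulrn; apply: lt_le_trans (archi_boundP _) _.
    by rewrite divr_ge0 ?addr_ge0 // ltW.
  by rewrite ler_nat.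
rewrite ltr_pdivrMr // => h.
have N0 : 0 < N%:Z%:~R :> rat by apply: lt_le_trans N1.
rewrite subr_lt0 expr2 -mulrA.
have le1 : norm_drop c + N%:~R * X <= N%:~R * (`|X| + norm_drop c).
  rewrite mulrDr addrC; apply: lerD; first by rewrite ler_wpM2l ?ler_norm ?ltW.
  by rewrite -[X in X <= _]mul1r ler_wpM2r.
by apply: (le_lt_trans le1); rewrite ltr_pM2l // mulrC [_ * q]mulrC.
Qed.

End WeightLattice.

(** * Co-finite ideals *)

Section Ideals.
Variables (K : closedFieldType) (A : comAlgType K).
Implicit Types (I M : set A) (a b c : A).

Lemma ideal_subspace I : is_ideal I -> subspace I.
Proof.
move=> [I0 ID IM]; split=> // k u v Iu Iv; apply: (ID) => //.
by rewrite -[u]mul1r scalerAl; exact: IM.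
Qed.

Lemma idealB I a b : is_ideal I -> I a -> I b -> I (a - b).
Proof.
move=> hI Ia Ib; rewrite -scaleN1r addrC.
by have [_] := ideal_subspace hI; apply.
Qed.

Lemma maximal_proper M : maximal_ideal M -> ~ M 1.
Proof.
move=> [[_ _ IM] nT _] M1; apply: nT; apply/seteqP; split=> // a _.
by rewrite -[a]mulr1; exact: IM.
Qed.

Lemma maximal_prime M a b : maximal_ideal M -> M (a * b) -> M a \/ M b.
Proof.
move=> mM Mab; have [Ma|nMa] := pselect (M a); [by left|right].
have [hM _ max] := mM; have [M0 MD MM] := hM.
pose J : set A := [set x | exists2 c, M c & exists d, x = c + d * a].
have hJ : is_ideal J.
  split.
  - by exists 0 => //; exists 0; rewrite mul0r addr0.
  - move=> _ _ [c Mc [d ->]] [c' Mc' [d' ->]].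
    by exists (c + c'); [exact: MD|exists (d + d'); rewrite mulrDl addrACA].
  - move=> x _ [c Mc [d ->]]; exists (x * c); first exact: MM.
    by exists (x * d); rewrite mulrDr mulrA.
have MJ : M `<=` J by move=> x Mx; exists x => //; exists 0; rewrite mul0r addr0.
have [JM|JT] := max _ hJ MJ.
  by case: nMa; rewrite -JM; exists 0 => //; exists 1; rewrite mul1r add0r.
have [c Mc [d e]] : J 1 by rewrite JT.
rewrite -[b]mul1r e mulrDl -mulrA.
by apply: MD; [rewrite mulrC; exact: MM|exact: MM].
Qed.

Lemma maximal_prime_prod M (s : seq A) : maximal_ideal M ->
  M (\prod_(x <- s) x) -> exists2 x, x \in s & M x.
Proof.
move=> mM; elim: s => [|x s IH]; first by rewrite big_nil => /(maximal_proper mM).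
rewrite big_cons => /(maximal_prime mM)[Mx|/IH[y ys My]].
  by exists x => //; rewrite mem_head.
by exists y => //; rewrite inE ys orbT.
Qed.

Lemma lspan_seq (s : seq A) a : lspan [set` s] a ->
  exists c : 'I_(size s) -> K, a = \sum_i c i *: s`_i.
Proof.
move=> h; pose S := [set x | exists c : 'I_(size s) -> K, x = \sum_i c i *: s`_i].
apply: (h S) => [|x /= xs].
  split=> [|k _ _ [c ->] [d ->]].
    by exists (fun=> 0); rewrite big1 // => i _; rewrite scale0r.
  exists (fun i => k * c i + d i); rewrite scaler_sumr -big_split.
  by apply: eq_bigr => i _; rewrite scalerDl scalerA.
have lt : (index x s < size s)%N by rewrite index_mem.
exists (fun i => (i == Ordinal lt)%:R); rewrite (bigD1 (Ordinal lt)) //= eqxx scale1r.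
rewrite nth_index // big1 ?addr0 // => i /negbTE ->.
by rewrite scale0r.
Qed.

(* A / I is finite dimensional, so b is a root modulo I of a nonzero polynomial,
   which splits. *)
Lemma maximal_residue I M b : cofinite_ideal I -> maximal_ideal M ->
  I `<=` M -> exists c : K, M (b - c *: 1).
Proof.
move=> [hI [s hs]] mM IM; pose n := size s.
have /choice[C hC] : forall k : 'I_n.+1, exists c : 'I_n -> K,
    I (b ^+ k - \sum_i c i *: s`_i).
  move=> k; have [x /lspan_seq[c ->] Ix] := hs (b ^+ k).
  by exists c.
pose Cm : 'M[K]_(n.+1, n) := \matrix_(k, i) C k i.
have [u u0 uC] : exists2 u : 'rV[K]_n.+1, u != 0 & u *m Cm = 0.
  exists (nz_row (kermx Cm)).
    rewrite nz_row_eq0 -mxrank_eq0 mxrank_ker subn_eq0 -ltnNge ltnS.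
    exact: rank_leq_col.
  exact/sub_kermxP/nz_row_sub.
pose p := \poly_(k < n.+1) u 0 (inord k).
have pE : p = \sum_(k < n.+1) u 0 k *: 'X^k.
  by rewrite /p poly_def; apply: eq_bigr => k _; rewrite inord_val.
have p0 : p != 0.
  apply: contra u0 => /eqP p0; apply/eqP/rowP => k; rewrite mxE.
  have := congr1 (fun q : {poly K} => q`_k) p0.
  by rewrite coef_poly ltn_ord inord_val coef0.
have Ip : I (horner_alg b p).
  have -> : horner_alg b p = \sum_k u 0 k *: (b ^+ k - \sum_i C k i *: s`_i).
    rewrite pE linear_sum /=; under [RHS]eq_bigr do rewrite scalerBr scaler_sumr.
    rewrite sumrB exchange_big [X in _ - X]big1 ?subr0 => [|i _].
      by apply: eq_bigr => k _; rewrite linearZ rmorphXn /= horner_algX mulr_algl.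
    under eq_bigr do rewrite scalerA.
    rewrite -scaler_suml; have := congr1 (fun w : 'rV_n => w 0 i) uC.
    rewrite !mxE => e; rewrite [X in X *: _](_ : _ = 0) ?scale0r // -[RHS]e.
    by apply: eq_bigr => k _; rewrite mxE.
  by apply: subspace_sum (ideal_subspace hI) _ => k _; apply: subspaceZ (ideal_subspace hI) _.
have [r e] := closed_field_poly_normal p.
move: (IM _ Ip); rewrite e linearZ /= mulr_algl => Mp.
have {Mp} : M (horner_alg b (\prod_(z <- r) ('X - z%:P))).
  rewrite -[horner_alg _ _]scale1r -(mulVf (_ : lead_coef p != 0)) ?lead_coef_eq0 //.
  by rewrite -scalerA; apply: subspaceZ (ideal_subspace _) Mp; case: mM.
rewrite rmorph_prod /=.
under eq_bigr do rewrite rmorphB /= horner_algX horner_algC.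
rewrite -(big_map (fun z => b - z%:A) predT id) => /(maximal_prime_prod mM).
by move=> [_ /mapP[z _ ->]]; exists z.
Qed.

End Ideals.

(** * Orthogonal idempotents modulo the radical *)

Section Idempotents.
Variables (K : closedFieldType) (A : comAlgType K) (I : set A).
Variables (k : nat) (M : 'I_k -> set A) (e : 'I_k -> A).
Hypotheses (I_cofinite : cofinite_ideal I) (M_max : forall i, maximal_ideal (M i)).
Hypotheses (radE : radical I = \bigcap_i M i).
Hypothesis (e_mod : forall i j, M j (e i - (i == j)%:R)).

Lemma radicalP a : (forall i, M i a) -> radical I a.
Proof. by move=> h; rewrite radE => i _; exact: h. Qed.

Lemma radicalMl a b : radical I b -> radical I (a * b).
Proof.
move=> rb; apply: radicalP => i; have [[_ _ MM] _ _] := M_max i.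
by apply: MM; move: rb; rewrite radE; apply.
Qed.

Lemma idempotent_offdiag i j : i != j -> M j (e i).
Proof. by move=> /negbTE ij; have := e_mod i j; rewrite ij subr0. Qed.

Lemma idempotents_sum : radical I (1 - \sum_i e i).
Proof.
apply: radicalP => j; have [hM _ _] := M_max j.
rewrite (bigD1 j) //= opprD addrA; apply: idealB => //.
  rewrite -opprB; have := e_mod j j; rewrite eqxx => h.
  by rewrite -scaleN1r; exact: subspaceZ (ideal_subspace hM) h.
by apply: subspace_sum (ideal_subspace hM) _ => i; exact: idempotent_offdiag.
Qed.

(** Modulo the radical, [e i] is the indicator of the point [M i], and c is the value of b there: b
    - c lies in [M i], and [e i] lies in all the other [M j]. *)
Lemma idempotent_residue b i : exists c : K, radical I (b * e i - c *: e i).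
Proof.
have IM : I `<=` M i.
  move=> a Ia; suff : radical I a by rewrite radE; apply.
  by exists 1%N; rewrite ?expr1.
have [c Mc] := maximal_residue b I_cofinite (M_max i) IM.
exists c; have -> : b * e i - c *: e i = (b - c *: 1) * e i.
  by rewrite mulrBl -scalerAl mul1r.
apply: radicalP => j; have MM l : forall x y, M l y -> M l (x * y).
  by have [[_ _ MM] _ _] := M_max l.
have [<-|ij] := eqVneq i j; first by rewrite mulrC; exact: MM.
by apply: MM; exact: idempotent_offdiag.
Qed.

Lemma idempotent_square i : radical I (e i * e i - e i).
Proof.
have -> : e i * e i - e i = (e i - 1) * e i by rewrite mulrBl mul1r.
apply: radicalP => j; have MM l : forall x y, M l y -> M l (x * y).
  by have [[_ _ MM] _ _] := M_max l.
have [<-|ij] := eqVneq i j; last by apply: MM; exact: idempotent_offdiag.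
by rewrite mulrC; apply: MM; have := e_mod i i; rewrite eqxx.
Qed.

End Idempotents.

(** * Affine roots *)

Lemma big_option (R : Type) (idx : R) (op : Monoid.com_law idx) (J : finType)
    (F : option J -> R) :
  \big[op/idx]_i F i = op (F None) (\big[op/idx]_j F (Some j)).
Proof.
rewrite (bigD1 None) //=; congr (op _ _).
rewrite (reindex_omap Some id) /=; last by case.
by apply: eq_bigl => j; rewrite eqxx.
Qed.

Section AffineRoots.
Variables (K : numFieldType) (g : finLieType K) (B : inv_form g).
Variables (T : triangular g) (beta : dual (cartan T)).
Hypothesis beta_highest : highest_root beta.
Local Notation h := (cartan T).
Local Notation I := (option 'I_(rank T)).
Local Notation alpha_ := (simple_root (t := T)).
Implicit Types (c : I -> int) (gamma : dual h) (n : int) (u : hbar T).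

(* The simple roots of the affine algebra are alpha_None = delta - beta and
   alpha_(Some j) = alpha_j; [affine_root] and [affine_degree] are the finite
   part and the coefficient of delta. *)
Definition affine_root (i : I) : dual h := if i is Some j then alpha_ j else - beta.
Definition affine_degree (i : I) : int := if i is Some _ then 0 else 1.
Definition affine_coroot (i : I) : hbar T :=
  if i is Some j then simple_coroot B j else coroot0 B beta.

(** The functional gamma + n delta: it vanishes on K, and delta takes the value 1 at L_0. *)
Definition affine_weight gamma n u : K := (gamma u.1.1 : K) + n%:~R * (u.2 : K).

Definition coord_weight c : hbar T -> K :=
  affine_weight (\sum_i (c i)%:~R *: affine_root i) (c None).

Lemma affine_root_is_root i : is_root (affine_root i).
Proof.
case: i => [j|]; first exact: simple_rootP.
by apply: (root_opp B); case: beta_highest.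
Qed.

Lemma affine_weight_inj gamma gamma' n n' :
  affine_weight gamma n = affine_weight gamma' n' -> gamma = gamma' /\ n = n'.
Proof.
move=> e; split.
  apply/lfunP => t; have := congr1 (fun f => f (t, 0, 0)) e.
  by rewrite /affine_weight /= !mulr0 !addr0.
have := congr1 (fun f => f (0, 0, 1)) e.
by rewrite /affine_weight /= !linear0 !mulr1 !add0r => /eqP; rewrite eqr_int => /eqP.
Qed.

Lemma affine_weightD gamma gamma' n n' u :
  affine_weight (gamma + gamma') (n + n') u =
  affine_weight gamma n u + affine_weight gamma' n' u.
Proof.
rewrite /affine_weight add_lfunE rmorphD /= mulrDl.
exact: (addrACA (gamma u.1.1 : K)).
Qed.

Lemma affine_weightN gamma n u :
  affine_weight (- gamma) (- n) u = - affine_weight gamma n u.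
Proof. by rewrite /affine_weight opp_lfunE rmorphN mulNr -opprD. Qed.

Lemma coord_weightD c c' u :
  coord_weight (fun i => c i + c' i) u = coord_weight c u + coord_weight c' u.
Proof.
rewrite /coord_weight -affine_weightD; congr affine_weight.
by rewrite -big_split; apply: eq_bigr => i _; rewrite rmorphD scalerDl.
Qed.

Lemma coord_weightM (k : int) c u :
  coord_weight (fun i => k * c i) u = k%:~R * coord_weight c u.
Proof.
have e : \sum_i (k * c i)%:~R *: affine_root i = k%:~R *: \sum_i (c i)%:~R *: affine_root i.
  by rewrite scaler_sumr; apply: eq_bigr => i _; rewrite scalerA rmorphM.
by rewrite /coord_weight e /affine_weight scale_lfunE rmorphM mulrDr mulrA.
Qed.

Lemma coord_weight0 u : coord_weight (fun=> 0) u = 0.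
Proof.
rewrite /coord_weight big1 => [|i _]; last by rewrite scale0r.
by rewrite /affine_weight zero_lfunE mul0r addr0.
Qed.

Lemma coord_weight_delta i u : coord_weight (fun j => (j == i)%:Z) u =
  affine_weight (affine_root i) (affine_degree i) u.
Proof.
rewrite /coord_weight; congr affine_weight; last by case: i.
rewrite (bigD1 i) //= eqxx scale1r big1 ?addr0 // => j /negbTE ->.
by rewrite scale0r.
Qed.

Lemma affine_corootE i : (affine_coroot i).1.1 = coroot B (affine_root i).
Proof. by case: i => //=; rewrite corootN //; case: beta_highest. Qed.

Lemma affine_weight_coroot gamma n i :
  affine_weight gamma n (affine_coroot i) = gamma (coroot B (affine_root i)).
Proof.
rewrite /affine_weight affine_corootE.
by rewrite (_ : (affine_coroot i).2 = 0) ?mulr0 ?addr0 //; case: i.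
Qed.

Lemma simple_root_int_free (s s' : 'I_(rank T) -> int) :
  \sum_j (s j)%:~R *: alpha_ j = \sum_j (s' j)%:~R *: alpha_ j -> s = s'.
Proof.
move/eqP; rewrite -subr_eq0 -sumrB => /eqP e; apply/funext => j.
have := @simple_root_free _ _ T (fun j => (s j)%:~R - (s' j)%:~R) _ j.
move=> /(_ _)/eqP; rewrite subr_eq0 eqr_int => H; apply/eqP/H.
by rewrite -[RHS]e; apply: eq_bigr => k _; rewrite scalerBl.
Qed.

Lemma root_coordinates gamma : is_root gamma -> exists s : 'I_(rank T) -> int,
  gamma = \sum_j (s j)%:~R *: alpha_ j /\
  ((forall j, 0 <= s j) \/ (forall j, s j <= 0)).
Proof.
move=> /root_sign[c [->|->]].
  exists (fun j => (c j)%:Z); split; last by left.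
  by apply: eq_bigr => j _; rewrite -pmulrn scaler_nat.
exists (fun j => - (c j)%:Z); split; last by right=> j; rewrite oppr_le0.
by rewrite -sumrN; apply: eq_bigr => j _; rewrite rmorphN /= -pmulrn scaleNr scaler_nat.
Qed.

Lemma positive_root_coordinates gamma (s : 'I_(rank T) -> int) :
  (exists c : 'I_(rank T) -> nat, gamma = \sum_j alpha_ j *+ c j) ->
  gamma = \sum_j (s j)%:~R *: alpha_ j -> forall j, 0 <= s j.
Proof.
move=> [c ec] es j; have -> : s = fun j => (c j)%:Z; last by [].
apply: simple_root_int_free; rewrite -es ec.
by apply: eq_bigr => k _; rewrite -pmulrn scaler_nat.
Qed.

(** Comparing beta with the root - beta shows that 2 beta is a nonnegative combination of simple
    roots. *)
Lemma highest_root_coordinates : exists b : 'I_(rank T) -> int,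
  beta = \sum_j (b j)%:~R *: alpha_ j /\ forall j, 0 <= b j.
Proof.
have [rb hb] := beta_highest; have [b [eb _]] := root_coordinates rb.
exists b; split=> // j.
have := hb _ (root_opp B rb); rewrite opprK => pos.
have e : beta + beta = \sum_j (b j + b j)%:~R *: alpha_ j.
  by rewrite {1 2}eb -big_split; apply: eq_bigr => k _; rewrite rmorphD scalerDl.
by have := positive_root_coordinates pos e j; lia.
Qed.

(* beta + gamma is a nonnegative combination of simple roots, hence so is
   gamma + n delta for n > 0. *)
Lemma affine_coordinates gamma n : gamma = 0 \/ is_root gamma ->
  exists c, [/\ coord_weight c = affine_weight gamma n,
    0 < n -> forall i, 0 <= c i &
    n = 0 -> forall s : 'I_(rank T) -> int,
      gamma = \sum_j (s j)%:~R *: alpha_ j -> (forall j, 0 <= s j) ->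
      forall i, 0 <= c i].
Proof.
move=> hg; have [b [eb b0]] := highest_root_coordinates.
have [s [es bs]] : exists s : 'I_(rank T) -> int,
    gamma = \sum_j (s j)%:~R *: alpha_ j /\ forall j, 0 <= b j + s j.
  case: hg => [->|rg].
    exists (fun=> 0); split=> [|j]; last by rewrite addr0.
    by rewrite big1 // => j _; rewrite scale0r.
  have [s [es _]] := root_coordinates rg; exists s; split=> // j.
  have := beta_highest.2 _ (root_opp B rg); rewrite opprK => pos.
  apply: (positive_root_coordinates pos (s := fun j => b j + s j)).
  by rewrite {1}eb {1}es -big_split; apply: eq_bigr => k _; rewrite rmorphD scalerDl.
(* From delta = alpha_None + beta: gamma + n delta = n alpha_None + (gamma + n beta). *)
exists (fun i => if i is Some j then s j + n * b j else n); split.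
- rewrite /coord_weight; congr affine_weight; rewrite big_option /=.
  rewrite {1}eb {1}es scalerN scaler_sumr -sumrN -big_split.
  apply: eq_bigr => j _.
  by rewrite rmorphD rmorphM /= scalerDl scalerA addrCA addNr addr0.
- by move=> n0 [j|]; last lia; have := b0 j; have := bs j; nia.
- move=> -> s' es' s0 [j|//]; rewrite mul0r addr0.
  have -> : s = s' by apply: simple_root_int_free; rewrite -es -es'.
  exact: s0.
Qed.

Lemma coord_weight_inj : injective coord_weight.
Proof.
move=> c c' /affine_weight_inj[e eN]; apply/funext => -[j|//].
move: e; rewrite !big_option /= eN => /addrI.
by move=> /(simple_root_int_free (s := fun j => c (Some j))) /(congr1 (fun f => f j)).
Qed.

(** The inverse trace norm of the i-th coroot is proportional to the squared length of alpha_i,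
    hence symmetrizes the matrix. The resulting form sees only finite parts, so whenever the finite
    part is a root gamma the norm is 2 divided by the trace norm of the coroot of gamma, whatever
    the degree. *)
Lemma affine_cartan_matrix : exists (a : I -> I -> int) (d : I -> rat),
  [/\ forall i j, (affine_root j (coroot B (affine_root i)) : K) = (a i j)%:~R,
    forall i, a i i = 2, forall i, 0 < d i,
    forall i j, d i * (a i j)%:~R = d j * (a j i)%:~R &
    forall c gamma, is_root gamma -> \sum_i (c i)%:~R *: affine_root i = gamma ->
      0 < lattice_form a d c c].
Proof.
have rr := affine_root_is_root.
have /choice[a ha] : forall i, exists ai : I -> int, forall j,
    (affine_root j (coroot B (affine_root i)) : K) = (ai j)%:~R.
  by move=> i; have [ai] := choice (fun j => cartan_integer B (rr i) (rr j)); exists ai.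
pose co i := coroot B (affine_root i).
have /choice[k hk] : forall i, exists n : nat, trace_form (co i) (co i) = n.+1%:R.
  by move=> i; exact: trace_form_coroot_pos.
have ksym i j : (k j).+1%:R * (a i j)%:~R = (k i).+1%:R * (a j i)%:~R :> K.
  rewrite -!ha -!hk -!trace_form_coroot // trace_formC //.
have ksym' i j : (k j).+1%:R * (a i j)%:~R = (k i).+1%:R * (a j i)%:~R :> rat.
  have := ksym i j; rewrite !pmulrn -!rmorphM /= => /eqP.
  by rewrite eqr_int => /eqP ->.
have k0 i : (k i).+1%:R != 0 :> rat by rewrite pnatr_eq0.
have k0' i : (k i).+1%:R != 0 :> K by rewrite pnatr_eq0.
exists a, (fun i => (k i).+1%:R^-1); split=> //.
- by move=> i; apply/eqP; rewrite -(eqr_int K) -ha root_coroot.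
- by move=> i; rewrite invr_gt0 ltr0n.
- move=> i j; apply: (mulfI (k0 i)); apply: (mulfI (k0 j)).
  by rewrite mulVKf // [RHS]mulrCA mulVKf // ksym'.
move=> c gamma rg eg.
have [kg hkg] := trace_form_coroot_pos B rg.
have kg0 : kg.+1%:R != 0 :> K by rewrite pnatr_eq0.
(* By the symmetry of the trace form. It cancels the factors d_i below, and the double sum collapses
   to gamma at its own coroot, divided by [kg.+1]. *)
have ratio i : (gamma (coroot B (affine_root i)) : K) =
    (k i).+1%:R / kg.+1%:R * (affine_root i (coroot B gamma) : K).
  apply: (mulfI kg0); rewrite -{1}hkg -trace_form_coroot // trace_formC.
  rewrite trace_form_coroot // hk.
  by rewrite [RHS]mulrA [kg.+1%:R * _]mulrC divfK.
rewrite -(ltr_rat K) rmorph0.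
suff -> : ratr (lattice_form a (fun i => (k i).+1%:R^-1) c c) = 2 / kg.+1%:R :> K.
  by rewrite divr_gt0 ?ltr0n.
rewrite -(root_coroot B rg) -{1}eg sum_lfunE /lattice_form rmorph_sum mulr_suml.
apply: eq_bigr => i _; rewrite rmorph_sum /=.
rewrite scale_lfunE.
transitivity ((k i).+1%:R^-1 * (c i)%:~R * (gamma (coroot B (affine_root i)) : K)).
  rewrite -eg sum_lfunE mulr_sumr; apply: eq_bigr => j _.
  rewrite !rmorphM fmorphV /= !ratr_int ratr_nat scale_lfunE.
  by rewrite -[_ *: _]/(_ * _ : K) ha; ring.
rewrite ratio; move: (affine_root i _ : K) => x; rewrite -[_ *: _]/(_ * _ : K).
move: (k i).+1%:R kg.+1%:R (k0' i) kg0 => p q p0 q0.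
by field; rewrite p0 q0.
Qed.

End AffineRoots.

(** * Root vectors of tau and their weights *)

Section TauRootVectors.
Variables (K : numFieldType) (g : finLieType K) (B : inv_form g).
Variables (T : triangular g) (beta : dual (cartan T)).
Hypothesis beta_highest : highest_root beta.
Local Notation h := (cartan T).
Local Notation alpha_ := (simple_root (t := T)).
Implicit Types (x y : g) (gamma : dual h) (n : int) (u : hbar T) (z : tau B).

Lemma tX_linear n : linear (tX B n).
Proof.
move=> c x y; rewrite /tX -linearP; congr (tau_pi _).
have -> : c *: bX B n x + bX B n y = ((c *: mono n x + mono n y, c *: 0 + 0),
  (c *: 0 + 0, c *: 0 + 0)) by [].
by rewrite !scaler0 !addr0 -linearP.
Qed.
HB.instance Definition _ n := GRing.isLinear.Build K g (tau B) _ (tX B n) (tX_linear n).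

Lemma lie_tKr z : lie z (tK B) = 0.
Proof. by rewrite lieC lie_tKl oppr0. Qed.

Definition homogeneous gamma n z : Prop :=
  forall u, lie (hbar_tau B u) z = affine_weight gamma n u *: z.

Lemma homogeneous_tX gamma n x : root_space gamma x ->
  homogeneous gamma n (tX B n x).
Proof.
move=> hx u; rewrite /hbar_tau !lieDl !lieZl lie_tXX lie_tKl lie_tLX.
rewrite add0r addr0 mul0r mulr0 scale0r addr0 scaler0 addr0 hx linearZ /=.
by rewrite scalerA -scalerDl; congr (_ *: _); rewrite /affine_weight [_ * n%:~R]mulrC.
Qed.

Lemma homogeneous_tK : homogeneous (0 : dual h) 0 (tK B).
Proof. by move=> u; rewrite lie_tKr /affine_weight zero_lfunE mul0r addr0 scale0r. Qed.

Lemma homogeneous_tL n : homogeneous (0 : dual h) n (tL B n).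
Proof.
move=> u; rewrite /hbar_tau !lieDl !lieZl lie_tKl lie_tLL lieC lie_tLX.
have -> : (0 ^+ 3 - 0 : int) = 0 by [].
rewrite scale0r oppr0 scaler0 !add0r subr0 mul0r mulr0 scale0r.
by rewrite addr0 scalerA /affine_weight zero_lfunE add0r mulrC.
Qed.

Lemma hbar_tau_commute u u' : lie (hbar_tau B u) (hbar_tau B u') = 0.
Proof.
have w0 : affine_weight (0 : dual h) 0 u = 0.
  by rewrite /affine_weight zero_lfunE mul0r addr0.
rewrite [hbar_tau B u']/hbar_tau !lieDr !lieZr.
rewrite (homogeneous_tX _ (root_space0 (subvsP u'.1.1))) homogeneous_tK homogeneous_tL.
by rewrite w0 !scale0r !scaler0 !addr0.
Qed.

(** Unlike those of [tau_plus_gen], these vectors are homogeneous and carry their weight gamma + n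
    delta; gamma = 0 in [PositiveX] accounts for the Cartan part at t^n. *)
Variant positive_vector : dual h -> int -> tau B -> Prop :=
| PositiveX gamma n x : gamma = 0 \/ is_root gamma -> root_space gamma x ->
    0 < n -> positive_vector gamma n (tX B n x)
| PositiveRoot gamma x : is_root gamma ->
    (exists c : 'I_(rank T) -> nat, gamma = \sum_j alpha_ j *+ c j) ->
    root_space gamma x -> positive_vector gamma 0 (tX B 0 x)
| PositiveL n : 0 < n -> positive_vector 0 n (tL B n).

Variant negative_vector : dual h -> int -> tau B -> Prop :=
| NegativeX gamma n x : gamma = 0 \/ is_root gamma -> root_space gamma x ->
    n < 0 -> negative_vector gamma n (tX B n x)
| NegativeRoot gamma x : is_root gamma ->
    (exists c : 'I_(rank T) -> nat, gamma = - \sum_j alpha_ j *+ c j) ->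
    root_space gamma x -> negative_vector gamma 0 (tX B 0 x)
| NegativeL n : n < 0 -> negative_vector 0 n (tL B n).

Lemma positive_homogeneous gamma n z : positive_vector gamma n z ->
  homogeneous gamma n z.
Proof.
by case=> *; [exact: homogeneous_tX|exact: homogeneous_tX|exact: homogeneous_tL].
Qed.

Lemma negative_homogeneous gamma n z : negative_vector gamma n z ->
  homogeneous gamma n z.
Proof.
by case=> *; [exact: homogeneous_tX|exact: homogeneous_tX|exact: homogeneous_tL].
Qed.

Lemma positive_gen gamma n z : positive_vector gamma n z -> tau_plus_gen T z.
Proof.
case=> {gamma n z} [gamma n x _ _ n0|gamma x rg hc hx|n n0].
- exact: tau_plus_X.
- apply: tau_plus_n; apply/nplusP => S sS; apply.
  by exists gamma.
- exact: tau_plus_L.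
Qed.

Lemma positive_root_vector gamma n z : positive_vector gamma n z ->
  gamma <> 0 -> is_root gamma /\ exists2 x, root_space gamma x & z = tX B n x.
Proof.
case=> {gamma n z} [gamma n x [] // rg hx _ _|gamma x rg _ hx _|//].
- by split=> //; exists x.
- by split=> //; exists x.
Qed.

Lemma positive_coordinates gamma n z : positive_vector gamma n z ->
  exists c, coord_weight beta c = affine_weight gamma n /\ forall i, 0 <= c i.
Proof.
case=> {gamma n z} [gamma n x hg _ n0|gamma x rg [s es] _|n n0].
- by have [c [e /(_ n0) c0 _]] := affine_coordinates B beta_highest n hg; exists c.
- have [c [e _ c0]] := affine_coordinates B beta_highest 0 (or_intror rg).
  exists c; split=> //; apply: (c0 erefl (fun j => (s j)%:Z)) => //.
  by rewrite es; apply: eq_bigr => j _; rewrite -pmulrn scaler_nat.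
- have [c [e /(_ n0) c0 _]] := affine_coordinates B beta_highest n (or_introl erefl).
  by exists c.
Qed.

Lemma negative_coordinates gamma n z : negative_vector gamma n z ->
  exists c, coord_weight beta c = affine_weight (- gamma) (- n) /\
    forall i, 0 <= c i.
Proof.
case=> {gamma n z} [gamma n x hg _ n0|gamma x rg [s es] _|n n0].
- have hg' : - gamma = 0 \/ is_root (- gamma).
    by case: hg => [->|rg]; [left; rewrite oppr0|right; exact: (root_opp B rg)].
  have n0' : 0 < - n by lia.
  by have [c [e /(_ n0') c0 _]] := affine_coordinates B beta_highest (- n) hg'; exists c.
- have [c [e _ c0]] := affine_coordinates B beta_highest 0 (or_intror (root_opp B rg)).
  exists c; split; first by rewrite oppr0.
  apply: (c0 erefl (fun j => (s j)%:Z)) => //.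
  by rewrite es opprK; apply: eq_bigr => j _; rewrite -pmulrn scaler_nat.
- have n0' : 0 < - n by lia.
  have [c [e /(_ n0') c0 _]] := affine_coordinates B beta_highest (- n) (or_introl erefl).
  by exists c; rewrite oppr0.
Qed.

Lemma positive_weight_neq0 gamma n z : positive_vector gamma n z ->
  gamma <> 0 \/ n <> 0.
Proof.
case=> {gamma n z} [gamma n x _ _ n0|gamma x [g0 _] _ _|n n0].
- by right=> e; rewrite e in n0.
- by left.
- by right=> e; rewrite e in n0.
Qed.

Lemma tau_decomposition (S : set (tau B)) : subspace S ->
  (forall u, S (hbar_tau B u)) ->
  (forall gamma n z, positive_vector gamma n z -> S z) ->
  (forall gamma n z, negative_vector gamma n z -> S z) -> forall z, S z.
Proof.
move=> sS Sh Sp Sn; apply: tau_ind => [c s t Ss St|n x||n].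
- by case: sS => _; apply.
- have sSX : subspace [set y | S (tX B n y)].
    exact: subspace_preimage (tX_linear n) sS.
  apply: (root_decomposition (T := T) sSX) => [y hy|gamma y rg hy] /=.
    have [->|n0] := eqVneq n 0.
      have := Sh (Subvs hy, 0, 0).
      by rewrite /hbar_tau /= !scale0r !addr0.
    have hy0 := root_space0 hy.
    have [n1|n1] := ltP 0 n; first by apply: Sp (PositiveX (or_introl erefl) hy0 n1).
    by apply: Sn (NegativeX (or_introl erefl) hy0 _); lia.
  have [n1|] := ltP 0 n; first by apply: Sp (PositiveX (or_intror rg) hy n1).
  rewrite le_eqVlt => /predU1P[->|n1]; last by apply: Sn (NegativeX (or_intror rg) hy n1).
  have [c [e|e]] := root_sign rg.
    by apply: Sp (PositiveRoot rg _ hy); exists c.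
  by apply: Sn (NegativeRoot rg _ hy); exists c.
- by have := Sh (0, 1, 0); rewrite /hbar_tau /= linear0 scale0r scale1r addr0 add0r.
- have [->|n0] := eqVneq n 0.
    by have := Sh (0, 0, 1); rewrite /hbar_tau /= linear0 scale0r scale1r !add0r.
  have [n1|n1] := ltP 0 n; first by apply: Sp (PositiveL n1).
  by apply: Sn (NegativeL (n := n) _); lia.
Qed.

(** For i = None these are root vectors of - beta at t and of beta at t^-1. The cocycle contributes
    B x y = 2 / (beta, beta) times K, which is the central part of alpha_0^v. *)
Lemma chevalley_vectors i : exists x y, [/\ root_space (affine_root beta i) x,
  x <> 0, root_space (- affine_root beta i) y &
  lie (tX B (affine_degree i) x) (tX B (- affine_degree i) y) =
  hbar_tau B (affine_coroot B beta i)].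
Proof.
have rr := affine_root_is_root B beta_highest i.
have [_ [x hx x0]] := rr; have [y [hy Bxy xy]] := root_sl2 B rr hx x0.
exists x, y; split=> //; rewrite lie_tXX subrr eqxx mul1r Bxy xy.
rewrite /hbar_tau (affine_corootE B beta_highest).
case: i {rr hx x0 hy Bxy xy} => [j|] /=; first by rewrite mul0r !scale0r !addr0.
by rewrite mul1r dual_normN ?scale0r ?addr0 //; case: beta_highest.
Qed.

(** Iterated brackets follow those in g up to a central term, which one further step kills; a
    bracket with L_m falls back on this case. *)
Lemma lie_tX_nilpotent gamma k y : gamma <> 0 -> root_space gamma y ->
  forall z, exists q, iter q (lie (tX B k y)) z = 0.
Proof.
move=> g0 hy.
have nilX m x : exists q, iter q (lie (tX B k y)) (tX B m x) = 0.
  have it (n : nat) : exists m' (c : K), iter n (lie (tX B k y)) (tX B m x) =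
      tX B m' (iter n (lie y) x) + c *: tK B.
    elim: n => [|n [m' [c e]]]; first by exists m, 0; rewrite scale0r addr0.
    exists (k + m'), ((k + m' == 0)%:R * (k%:~R * B y (iter n (lie y) x))).
    by rewrite /= e lieDr lieZr lie_tKr scaler0 addr0 lie_tXX.
  have [n hn] := root_vector_nilpotent g0 hy x.
  have [m' [c e]] := it n; exists n.+1.
  by rewrite /= e hn linear0 add0r lieZr lie_tKr scaler0.
apply: tau_ind => [c s t||| m]; last 1 first.
- have [n hn] := nilX (k + m) y; exists n.+1.
  rewrite iterSr lieC lie_tLX -scaleNr.
  by rewrite -[X in iter n _ X]addr0 iter_linear hn scaler0 add0r iter_linear0.
- by have [_] := nilpotent_subspace (lie (tX B k y)); apply.
- by [].
- by exists 1%N; rewrite /= lie_tKr.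
Qed.

End TauRootVectors.

(** * Highest weight modules *)

Section LieModuleLemmas.
Variables (K : pzRingType) (L : lieType K) (V : lieModType L).
Implicit Types (x y : L) (w : V).

Lemma actDl x y w : act (x + y) w = act x w + act y w.
Proof. by have := act_linearl w 1 x y; rewrite !scale1r. Qed.
Lemma act0l w : act (0 : L) w = 0.
Proof. exact: linear_map0 (act_linearl w). Qed.
Lemma actZl c x w : act (c *: x) w = c *: act x w.
Proof. exact: linear_mapZ (act_linearl w). Qed.
Lemma act_swap x y w : act x (act y w) = act y (act x w) + act (lie x y) w.
Proof. by rewrite act_lie addrC subrK. Qed.

(** Leibniz rule: x^k y w is a combination of ((ad x)^p y) x^(k - p) w, and for k = n + m one of the
    two factors vanishes. Coefficients are avoided by induction on n + m. *)
Lemma act_nilpotent x y w : (exists n, iter n (lie x) y = 0) ->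
  (exists n, iter n (act x) w = 0) -> exists n, iter n (act x) (act y w) = 0.
Proof.
move=> [n hn] [m hm]; exists (n + m)%N.
move: {-2}(n + m)%N (erefl (n + m)%N) => k.
elim: k n m y w hn hm => [|k IH] n m y w hn hm e.
  by move: e hn; case: n => // _ /= ->; rewrite act0l.
case: n hn e => [/= -> _|n hn e]; first by rewrite act0l; exact: (iter_linear0 (act x) k.+1).
case: m hm e => [/= -> _|m hm e]; first by rewrite linear0; exact: (iter_linear0 (act x) k.+1).
rewrite iterSr act_swap -[X in iter k _ (X + _)]scale1r iter_linear.
rewrite (IH n.+1 m) //; last by lia.
  by rewrite (IH n m.+1) ?scaler0 ?addr0 //; [rewrite -iterSr|lia].
by rewrite -iterSr.
Qed.

End LieModuleLemmas.

Section WeightModule.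
Variables (K : numFieldType) (g : finLieType K) (B : inv_form g).
Variables (T : triangular g) (beta : dual (cartan T)).
Hypothesis beta_highest : highest_root beta.
Variables (A : comAlgType K) (V : lieModType (current (tau B) A)).
Hypothesis V_irr : irreducible V.
Local Notation h := (cartan T).
Local Notation I := (option 'I_(rank T)).
Local Notation cw := (coord_weight beta).
Local Notation W := (weight_space (V := V)).
Implicit Types (gamma : dual h) (u : hbar T) (z : tau B) (a b : A) (w : V).
Implicit Types (c : I -> int) (mu nu : hbar T -> K).

Lemma cur_scale (k : K) z a : cur (k *: z) a = k *: cur z a.
Proof.
exact: linear_mapZ (cur_linearl a).
Qed.

Lemma cur_zero a : cur (0 : tau B) a = 0.
Proof. exact: linear_map0 (cur_linearl a). Qed.

Lemma act_homogeneous gamma n z a mu w : homogeneous gamma n z -> W mu w ->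
  W (fun u => mu u + affine_weight gamma n u) (act (cur z a) w).
Proof.
move=> hz hw u; rewrite act_swap hw linearZ lie_cur mul1r hz cur_scale actZl.
by rewrite -scalerDl.
Qed.

Lemma current_decomposition (S : set (current (tau B) A)) : subspace S ->
  (forall u a, S (cur (hbar_tau B u) a)) ->
  (forall gamma n z a, positive_vector gamma n z -> S (cur z a)) ->
  (forall gamma n z a, negative_vector gamma n z -> S (cur z a)) ->
  forall x, S x.
Proof.
move=> sS Sh Sp Sn; apply: current_ind => [|c s t|z a].
- by case: sS.
- by case: sS => _; apply.
have sSa : subspace [set z | S (cur z a)].
  exact: subspace_preimage (cur_linearl a) sS.
by apply: (tau_decomposition (T := T) sSa) => /= *; eauto.
Qed.

Definition singular w : Prop := forall gamma n z a,
  positive_vector (T := T) gamma n z -> act (cur z a) w = 0.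

(** The starting vectors are all singular vectors of weight mu and not a single one: h (x) a need
    not act on a singular vector by a scalar, but it maps it to another one of the same weight. *)
Inductive descendant mu : V -> Prop :=
| DescSelf w : W mu w -> singular w -> descendant mu w
| DescAct gamma n z a w : negative_vector (T := T) gamma n z ->
    descendant mu w -> descendant mu (act (cur z a) w).

Lemma descendant_weight mu w : descendant mu w ->
  exists c, (forall i, 0 <= c i) /\ W (fun u => mu u - cw c u) w.
Proof.
elim=> {w} [w hw _|gamma n z a w nz _ [c [c0 hw]]].
  by exists (fun=> 0); split=> // u; rewrite coord_weight0 subr0 hw.
have [c' [e c'0]] := negative_coordinates beta_highest nz.
exists (fun i => c i + c' i); split=> [i|u]; first by rewrite addr_ge0.
rewrite (act_homogeneous a (negative_homogeneous nz) hw); congr (_ *: _).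
rewrite coord_weightD e; move: (cw c u) => x.
by rewrite /affine_weight opp_lfunE rmorphN mulNr !opprD !opprK !addrA.
Qed.

(* The usual commutation argument behind V = U(tau^-) U(tau^0) w. *)
Lemma act_descendant mu w : descendant mu w -> forall x,
  lspan (descendant mu) (act x w).
Proof.
have span_neg gamma n z a v : negative_vector (T := T) gamma n z ->
    lspan (descendant mu) v -> lspan (descendant mu) (act (cur z a) v).
  move=> nz /(_ [set v' | lspan (descendant mu) (act (cur z a) v')]); apply.
    exact: subspace_preimage (act_linearr _) (lspan_subspace _).
  by move=> v' dv'; apply: lspan_sub; exact: DescAct nz dv'.
have sub v : subspace [set x | lspan (descendant mu) (act x v)].
  exact: subspace_preimage (act_linearl _) (lspan_subspace _).
elim=> {w} [w hw sw|gamma n z a w nz dw IH];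
    apply: (current_decomposition (sub _)) => /=.
- move=> u a; apply: lspan_sub; apply: DescSelf => [u'|gamma n z b pz].
    rewrite act_swap hw linearZ lie_cur hbar_tau_commute.
    by rewrite cur_zero act0l addr0.
  rewrite act_swap (sw _ _ _ _ pz) linear0 add0r lieC lie_cur.
  rewrite (positive_homogeneous pz) cur_scale -scaleN1r scalerA actZl.
  by rewrite (sw _ _ _ _ pz) scaler0.
- move=> gamma n z a pz; rewrite (sw _ _ _ _ pz).
  by case: (lspan_subspace (descendant mu)).
- by move=> gamma n z a nz; apply: lspan_sub; apply: DescAct nz _; exact: DescSelf.
- move=> u b; rewrite act_swap; apply: subspaceD (lspan_subspace _) _ (IH _).
  exact: span_neg nz (IH _).
- move=> gamma' n' z' b pz; rewrite act_swap.
  apply: subspaceD (lspan_subspace _) _ (IH _).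
  exact: span_neg nz (IH _).
- by move=> gamma' n' z' b nz'; apply: lspan_sub; apply: DescAct nz' _; exact: DescAct nz dw.
Qed.

Lemma irreducible_generated (S : set V) w : submodule S -> S w -> w <> 0 ->
  forall v, S v.
Proof.
move=> sS Sw w0 v; have [_ /(_ _ sS)[S0|->//]] := V_irr.
by case: w0; move: Sw; rewrite S0.
Qed.

Lemma singular_generates mu w : w <> 0 -> W mu w -> singular w -> forall v,
  lspan (\bigcup_(nu in [set nu | exists c, (forall i, 0 <= c i) /\
    nu = fun u => mu u - cw c u]) W nu) v.
Proof.
move=> w0 hw sw v.
have : lspan (descendant mu) v.
  apply: irreducible_generated w0 v; last by apply: lspan_sub; exact: DescSelf.
  split=> [|x]; first exact: lspan_subspace.
  move=> v' /(_ [set v | lspan (descendant mu) (act x v)]); apply.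
    exact: subspace_preimage (act_linearr _) (lspan_subspace _).
  by move=> v'' d; exact: act_descendant.
apply; first exact: lspan_subspace.
move=> v' /descendant_weight[c [c0 hv']]; apply: lspan_sub.
by exists (fun u => mu u - cw c u) => //; exists c.
Qed.

Lemma weight_below mu w nu v : w <> 0 -> W mu w -> singular w ->
  v <> 0 -> W nu v ->
  exists c, (forall i, 0 <= c i) /\ nu = fun u => mu u - cw c u.
Proof.
move=> w0 hw sw v0 hv.
exact: (span_eigenvectors (T := fun u => act (cur (hbar_tau B u) 1))
  (singular_generates w0 hw sw v) hv v0).
Qed.

End WeightModule.

(** * The highest weight vector of the irreducible quotient *)

Section HighestWeightVector.
Variables (K : numFieldType) (g : finLieType K) (B : inv_form g).
Variables (T : triangular g) (A : comAlgType K) (psi : tau0A T A -> K).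
Hypothesis psi_linear : scalar psi.
Implicit Types (u : hbar T) (a b : A).

Lemma hbar_tau_linear : linear (hbar_tau B (T := T)).
Proof.
move=> c [[y k] l] [[y' k'] l']; rewrite /hbar_tau /=.
have -> : tX B 0 (vsval (c *: y + y')) = c *: tX B 0 (vsval y) + tX B 0 (vsval y').
  by rewrite -tX_linear; congr tX; exact: linearP.
rewrite !scalerDr !scalerDl !scalerA.
by rewrite (addrACA (c *: tX B 0 (vsval y))) (addrACA (_ + _)).
Qed.

Let inclE := @tlift_linear K (hbar T) A (fun _ _ _ _ => False)
  (current (tau B) A) (fun u a => tmul (hbar_tau B u) a).

Lemma tau0A_incl_linear : linear (tau0A_incl B (T := T) (A := A)).
Proof.
apply: inclE => [a c u u'|u c a a'|//].
  by rewrite hbar_tau_linear; exact: cur_linearl.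
exact: cur_linearr.
Qed.

Lemma tau0A_incl_tmul u a : tau0A_incl B (tmul u a) = cur (hbar_tau B u) a.
Proof.
apply: (tlift_pure (F := fun u a => tmul (hbar_tau B u) a)) => [b c v v'|v c b b'|//].
  by rewrite hbar_tau_linear; exact: cur_linearl.
exact: cur_linearr.
Qed.

(** v is the image of 1 (x) 1. If it vanished, so would the image of everything that the enveloping
    algebra generates from it, whereas f maps onto a nonzero module. *)
Lemma highest_weight_vector (V : lieModType (current (tau B) A)) :
  is_irr_hw psi V -> exists v : V, [/\ v <> 0,
    forall u a, act (cur (hbar_tau B u) a) v = psi (tmul u a) *: v &
    forall y, tau_plusA T y -> act y v = 0].
Proof.
move=> [[[w w0] _] [f [[fl fact] fs]]].
pose ip : env _ -> K^o -> verma B psi := @ind_pure _ _ (borel_char psi).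
pose v := f (ip 1 1); exists v.
have psi0 : psi 0 = 0.
  by apply: (addrI (psi 0)); have := psi_linear 1 0 0; rewrite scale1r mul1r !addr0 => <-.
have borel y c : borel_char psi y c -> act y v = c *: v.
  move=> hy; rewrite /v -fact.
  have -> : act y (ip 1 1) = ip 1 (c *: 1).
    rewrite [LHS]ind_act_pure mulr1; apply: pure_bal; exists y, c.
    by rewrite mul1r.
  rewrite -(linear_mapZ _ _ fl); congr f.
  exact: (linear_mapZ _ _ (pure_linearr (ind_bal (borel_char psi)) 1)).
have [plus0 _] : subspace (@tau_plusA _ _ B T A) := lspan_subspace _.
split=> [v0|u a|y hy]; last 2 first.
- apply: borel; exists (tmul u a), 0; split=> //.
  by rewrite addr0 tau0A_incl_tmul.
- rewrite (borel y 0) ?scale0r //; exists 0, y; split=> //.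
  by rewrite (linear_map0 tau0A_incl_linear) add0r.
apply: w0; have [m <-] := fs w.
have gen t : forall q z, f (ip q z) = 0 -> f (ip (t * q) z) = 0.
  elim/env_ind: t => [q z|c s t IHs IHt q z h|s t IHs IHt q z h|x q z h].
  - by rewrite mul1r.
  - rewrite mulrDl -scalerAl.
    have -> : ip (c *: (s * q) + t * q) z = c *: ip (s * q) z + ip (t * q) z.
      exact: (pure_linearl (ind_bal (borel_char psi)) z c).
    by rewrite fl IHs // IHt // scaler0 addr0.
  - by rewrite -mulrA; apply: IHs; exact: IHt.
  - have -> : ip (inj_env x * q) z = act x (ip q z) by exact/esym/ind_act_pure.
    by rewrite fact h linear0.
elim/tens_ind: m => [|c s t IHs IHt|t z].
- exact: linear_map0 fl.
- by rewrite fl IHs IHt scaler0 addr0.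
have := gen t 1 z; rewrite mulr1; apply.
have -> : ip 1 z = (z : K) *: ip 1 1.
  rewrite -(linear_mapZ _ _ (pure_linearr (ind_bal (borel_char psi)) 1)).
  by congr (ip 1 _); rewrite /GRing.scale /= mulr1.
by rewrite (linear_mapZ _ _ fl) [f _]v0 scaler0.
Qed.

End HighestWeightVector.

(** * Weights of the module and singular vectors *)

Section Integrability.
Variables (K : numFieldType) (g : finLieType K) (B : inv_form g).
Variables (T : triangular g) (beta : dual (cartan T)).
Hypothesis beta_highest : highest_root beta.
Variables (A : comAlgType K) (V : lieModType (current (tau B) A)).
Hypothesis V_irr : irreducible V.
Variables (psi : tau0A T A -> K) (v : V).
Hypotheses (psi_linear : scalar psi) (v_neq0 : v <> 0).
Hypothesis v_weight : forall u a, act (cur (hbar_tau B u) a) v = psi (tmul u a) *: v.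
Hypothesis v_plus : forall y, tau_plusA T y -> act y v = 0.

Local Notation h := (cartan T).
Local Notation I := (option 'I_(rank T)).
Local Notation cw := (coord_weight beta).
Local Notation W := (weight_space (V := V)).
Local Notation root_ := (affine_root beta).
Local Notation deg := affine_degree.
Local Notation coroot_ := (affine_coroot B beta).
Implicit Types (gamma : dual h) (u : hbar T) (z : tau B) (a b : A) (w : V).
Implicit Types (c : I -> int) (i j : I).

Definition highest_weight u : K := psi (tmul u 1).

Definition lower_weight_space c : set V := W (fun u => highest_weight u - cw c u).

Definition is_weight c : Prop := exists w, w <> 0 /\ lower_weight_space c w.

Lemma lower_weight_space_eq c c' w :
  lower_weight_space c w -> c =1 c' -> lower_weight_space c' w.
Proof. by move=> hw /funext <-. Qed.

Lemma highest_weight_space : lower_weight_space (fun=> 0) v.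
Proof. by move=> u; rewrite coord_weight0 subr0 v_weight. Qed.

Lemma highest_weight_singular : singular T v.
Proof.
move=> gamma n z a pz; apply: v_plus; apply: lspan_sub.
by exists z, a; split=> //; exact: positive_gen pz.
Qed.

Lemma is_weight_ge0 c : is_weight c -> forall i, 0 <= c i.
Proof.
move=> [w [w0 hw]]; have hv : W highest_weight v by move=> u; exact: v_weight.
have [c' [c'0 e]] := weight_below beta_highest V_irr v_neq0 hv highest_weight_singular w0 hw.
suff -> : c = c' by [].
apply: (coord_weight_inj (beta := beta)); apply/funext => u.
by have /addrI/oppr_inj := congr1 (fun f => f u) e.
Qed.

(** A nonzero singular w generates V, so all weights lie below that of w. For the weight of v this
    reads c + c' = 0 with c and c' nonnegative. *)
Lemma singular_eq0 c w i : lower_weight_space c w -> singular T w -> c i <> 0 -> w = 0.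
Proof.
move=> hw sw ci; apply: contrapT => w0.
have c0 := is_weight_ge0 (ex_intro _ w (conj w0 hw)).
have hv : W highest_weight v by move=> u; exact: v_weight.
have [c' [c'0 e]] := weight_below beta_highest V_irr w0 hw sw v_neq0 hv.
have /(congr1 (fun f => f i)) : (fun i => c i + c' i) = (fun=> 0).
  apply: (coord_weight_inj (beta := beta)); apply/funext => u.
  rewrite coord_weightD coord_weight0; have /eqP := congr1 (fun f => f u) e.
  by rewrite -addrA -subr_eq0 opprD addrA subrr add0r -opprD opprK => /eqP.
by have := c0 i; have := c'0 i; lia.
Qed.

Lemma act_lower gamma n z a c c' w : homogeneous gamma n z ->
  (forall u, affine_weight gamma n u = cw c' u) -> lower_weight_space c w ->
  lower_weight_space (fun i => c i - c' i) (act (cur z a) w).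
Proof.
move=> hz e hw u; rewrite (act_homogeneous a hz hw) e; congr (_ *: _).
rewrite (_ : (fun i => c i - c' i) = (fun i => c i + (-1) * c' i)); last first.
  by apply/funext => i; rewrite mulN1r.
rewrite coord_weightD coord_weightM rmorphN1 mulN1r.
by move: (cw c u) (cw c' u) => p q; rewrite opprD opprK addrA.
Qed.

Lemma psi_tmulP u (k : K) a b :
  psi (tmul u (k *: a + b)) = k * psi (tmul u a) + psi (tmul u b).
Proof. by rewrite -psi_linear; congr psi; exact: pure_linearr. Qed.

(** * The sl2-triple of an affine simple root *)

Section SimpleRoot.
Variables (i : I) (x y : g).
Hypotheses (hx : root_space (root_ i) x) (x_neq0 : x <> 0).
Hypothesis (hy : root_space (- root_ i) y).
Local Notation e_ := (tX B (deg i) x).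
Local Notation f_ := (tX B (- deg i) y).
Hypothesis lie_ef : lie e_ f_ = hbar_tau B (coroot_ i).
Local Notation delta_ := (fun j => (j == i)%:Z).

Lemma raise_weight a c w : lower_weight_space c w ->
  lower_weight_space (fun j => c j - delta_ j) (act (cur e_ a) w).
Proof.
apply: act_lower (homogeneous_tX B _ hx) _ => u.
by rewrite coord_weight_delta.
Qed.

Lemma lower_weight a c w : lower_weight_space c w ->
  lower_weight_space (fun j => c j + delta_ j) (act (cur f_ a) w).
Proof.
move=> hw; have := act_lower a (homogeneous_tX B (- deg i) hy)
  (c' := fun j => (-1) * delta_ j) _ hw.
move=> /(_ _)/lower_weight_space_eq; apply=> [u|j]; last by lia.
by rewrite affine_weightN coord_weightM coord_weight_delta rmorphN1 mulN1r.
Qed.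

Lemma raise_weight_iter n a c w : lower_weight_space c w ->
  lower_weight_space (fun j => c j - n%:Z * delta_ j) (iter n (act (cur e_ a)) w).
Proof.
move=> hw; elim: n => [|n IH].
  by apply: lower_weight_space_eq hw _ => j; rewrite mul0r subr0.
by apply: lower_weight_space_eq (raise_weight a IH) _ => j; lia.
Qed.

Lemma lower_weight_iter n a c w : lower_weight_space c w ->
  lower_weight_space (fun j => c j + n%:Z * delta_ j) (iter n (act (cur f_ a)) w).
Proof.
move=> hw; elim: n => [|n IH].
  by apply: lower_weight_space_eq hw _ => j; rewrite mul0r addr0.
by apply: lower_weight_space_eq (lower_weight a IH) _ => j; lia.
Qed.

(* The only weights above lambda - N alpha_i are lambda - k alpha_i with k <= N,
   and k alpha_i is a root only for k = 1. *)
Lemma string_positive_vector gamma n z b (N : nat) w :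
  positive_vector gamma n z -> lower_weight_space (fun j => N%:Z * delta_ j) w ->
  act (cur z b) w <> 0 -> exists s : K, z = s *: e_.
Proof.
move=> pz hw nz; have [c1 [ec c10]] := positive_coordinates beta_highest pz.
have hc : lower_weight_space (fun j => N%:Z * delta_ j - c1 j) (act (cur z b) w).
  by apply: act_lower (positive_homogeneous pz) _ hw => u; rewrite ec.
have ge0 := is_weight_ge0 (ex_intro _ _ (conj nz hc)).
have [k ek] : exists k : nat, c1 i = k%:Z.
  by exists `|c1 i|%N; rewrite gez0_abs.
have ec1 : c1 = fun j => k%:Z * delta_ j.
  apply/funext => j; have := ge0 j; have := c10 j.
  by have [->|_] := eqVneq j i; rewrite ?mulr1 ?mulr0; lia.
have [eg en] : gamma = root_ i *+ k /\ n = k%:Z * deg i.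
  apply: affine_weight_inj; rewrite -ec ec1; apply/funext => u.
  rewrite coord_weightM coord_weight_delta /affine_weight natmul_lfunE.
  by rewrite mulrDr rmorphM /= mulrA -pmulrn mulr_natl.
have ri := affine_root_is_root B beta_highest i.
have k0 : k <> 0%N.
  move=> k0; have := positive_weight_neq0 pz.
  by rewrite eg en k0 mulr0n mul0r; case.
have g0 : gamma <> 0.
  move/eqP; rewrite eg -scaler_nat scaler_eq0 pnatr_eq0 => /orP[/eqP//|/eqP].
  by case: ri.
have [rg [x' hx' ez]] := positive_root_vector pz g0.
have k1 : k = 1%N by apply: (multiple_root B ri); rewrite -eg.
have {}eg : gamma = root_ i by rewrite eg k1.
rewrite eg in hx'; have [s es] := root_space_dim1 B ri hx x_neq0 hx'.
by exists s; rewrite ez en k1 mul1r es; exact: linear_mapZ (tX_linear _ _).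
Qed.

(** The successor keeps the weight away from lambda, where v itself is singular. *)
Lemma string_singular_eq0 (N : nat) w : lower_weight_space (fun j => N.+1%:Z * delta_ j) w ->
  (forall b, act (cur e_ b) w = 0) -> w = 0.
Proof.
move=> hw ew; apply: (singular_eq0 (i := i) hw); last by rewrite /= eqxx.
move=> gamma n z b pz; apply: contrapT => nz.
have [s es] := string_positive_vector pz hw nz.
by apply: nz; rewrite es cur_scale actZl ew scaler0.
Qed.

Lemma e_highest b : act (cur e_ b) v = 0.
Proof.
apply: contrapT => nz.
have := is_weight_ge0 (ex_intro _ _ (conj nz (raise_weight b highest_weight_space))) i.
by rewrite eqxx.
Qed.

Lemma act_ef a b w : act (cur e_ b) (act (cur f_ a) w) =
  act (cur f_ a) (act (cur e_ b) w) + act (cur (hbar_tau B (coroot_ i)) (b * a)) w.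
Proof. by rewrite act_swap lie_cur lie_ef. Qed.

Lemma f_commute a b w :
  act (cur f_ a) (act (cur f_ b) w) = act (cur f_ b) (act (cur f_ a) w).
Proof. by rewrite act_swap lie_cur lie_xx cur_zero act0l addr0. Qed.

Lemma act_hf a b w : act (cur (hbar_tau B (coroot_ i)) b) (act (cur f_ a) w) =
  act (cur f_ a) (act (cur (hbar_tau B (coroot_ i)) b) w)
  - 2 *: act (cur f_ (b * a)) w.
Proof.
rewrite act_swap lie_cur (homogeneous_tX B _ hy) affine_weightN.
rewrite affine_weight_coroot // root_coroot; last exact: (affine_root_is_root B).
by rewrite cur_scale actZl scaleNr.
Qed.

(** Since ad f is locally nilpotent on tau(A), the vectors on which f is nilpotent form a submodule,
    and irreducibility makes it all of V. *)
Lemma f_locally_nilpotent : (exists n, iter n (act (cur f_ 1)) v = 0) ->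
  forall w, exists n, iter n (act (cur f_ 1)) w = 0.
Proof.
move=> hv; apply: (irreducible_generated V_irr) hv v_neq0.
split=> [|t w /=]; first exact: nilpotent_subspace.
apply: act_nilpotent; move: t; apply: current_ind => [|c s t hs ht|z a].
- by exists 0%N.
- by have [_] := nilpotent_subspace (lie (cur f_ (1 : A))); apply.
have ry : - root_ i <> 0.
  by have [] := root_opp B (affine_root_is_root B beta_highest i).
have [n hn] := lie_tX_nilpotent (- deg i) ry hy z; exists n.
suff -> : iter n (lie (cur f_ 1)) (cur z a) = cur (iter n (lie f_) z) a.
  by rewrite hn cur_zero.
by elim: n {hn} => //= n ->; rewrite lie_cur mul1r.
Qed.

Lemma coord_weight_coroot (a : I -> int) c :
  (forall j, (root_ j (coroot B (root_ i)) : K) = (a j)%:~R) ->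
  cw c (coroot_ i) = (\sum_j a j * c j)%:~R.
Proof.
move=> ha; rewrite /coord_weight affine_weight_coroot // sum_lfunE rmorph_sum.
by apply: eq_bigr => j _; rewrite scale_lfunE rmorphM /= -ha mulrC.
Qed.

(* The sl2-string through a lowest weight vector f^r w reaches the reflected
   weight. *)
Lemma weight_reflection (m : nat) (a : I -> int) c :
  (forall w, exists n, iter n (act (cur f_ 1)) w = 0) ->
  highest_weight (coroot_ i) = m%:R ->
  (forall j, (root_ j (coroot B (root_ i)) : K) = (a j)%:~R) ->
  is_weight c -> m%:Z - \sum_j a j * c j < 0 ->
  is_weight (fun j => c j + (m%:Z - \sum_j a j * c j) * delta_ j).
Proof.
move=> nil hm ha [w [w0 hw]]; set p := _ - _ => p0.
have [r [rw r0]] := last_nonzero_iter w0 (nil w).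
set u := iter r _ w in rw r0.
have hu : lower_weight_space (fun j => c j + r%:Z * delta_ j) u.
  exact: lower_weight_iter.
pose H : {linear V -> V} := act (cur (hbar_tau B (coroot_ i)) (1 : A)).
have EF w' : act (cur f_ 1) (act (cur e_ 1) w') =
    act (cur e_ 1) (act (cur f_ 1) w') + (\- H) w'.
  by rewrite act_ef mulr1 /= addrK.
(* The lowest weight vector u = f^r w has h-weight p - 2 r, so its string under e survives M = 2 r -
   p steps. The reflected weight lies s = r - p steps above u, and s <= M. Both are nonnegative
   because p < 0. *)
have [M eM] : exists M : nat, M%:Z = (2 * r)%:Z - p by exists `|(2 * r)%:Z - p|%N; lia.
have a2 : a i = 2.
  apply/eqP; rewrite -(eqr_int K) -ha root_coroot //.
  exact: (affine_root_is_root B).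
have Hq q : (\- H) (iter q (act (cur e_ 1)) u) =
    (M%:R - 2 * q%:R) *: iter q (act (cur e_ 1)) u.
  rewrite /= (raise_weight_iter q 1 hu) -scaleNr; congr (_ *: _).
  rewrite hm (coord_weight_coroot _ ha) 2!pmulrn -(natrM _ 2 q) pmulrn.
  rewrite -rmorphB -rmorphN -rmorphB; congr (_%:~R).
  have -> : \sum_j a j * (c j + r%:Z * delta_ j - q%:Z * delta_ j) =
      \sum_j a j * c j + (r%:Z - q%:Z) * a i.
    rewrite [X in _ + X](_ : _ = \sum_j a j * ((r%:Z - q%:Z) * delta_ j)); last first.
      rewrite (bigD1 i) //= eqxx mulr1 mulrC big1 ?addr0 // => j /negbTE ->.
      by rewrite !mulr0.
    by rewrite -big_split; apply: eq_bigr => j _ /=; ring.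
  by rewrite a2 eM /p; lia.
have [s es] : exists s : nat, s%:Z = r%:Z - p by exists `|r%:Z - p|%N; lia.
exists (iter s (act (cur e_ 1)) u); split.
  apply: (string_nonzero (E := act (cur f_ 1)) (F := act (cur e_ 1)) (H := \- H)
    EF r0 rw Hq).
  by lia.
by apply: lower_weight_space_eq (raise_weight_iter s 1 hu) _ => j /=; rewrite es; ring.
Qed.

Variable rad : set A.
Hypothesis radMl : forall a b, rad b -> rad (a * b).
Hypothesis psi_rad : forall a, rad a -> psi (tmul (coroot_ i) a) = 0.

Lemma f_radical a : rad a -> act (cur f_ a) v = 0.
Proof.
move=> ra; apply: (string_singular_eq0 (N := 0)) => [|b].
  apply: lower_weight_space_eq (lower_weight a highest_weight_space) _ => j.
  by rewrite mul1r add0r.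
by rewrite act_ef e_highest linear0 add0r v_weight psi_rad ?scale0r //; exact: radMl.
Qed.

Lemma f_congruent a b (k : K) : rad (a - k *: b) ->
  act (cur f_ a) v = k *: act (cur f_ b) v.
Proof.
move=> r; rewrite -[a](subrK (k *: b)) -[_ - _]scale1r cur_linearr scale1r.
rewrite actDl f_radical // add0r (linear_mapZ _ _ (cur_linearr _)) actZl //.
Qed.

Section Idempotent.
Variables (eps : A) (m : nat).
Hypothesis eps_residue : forall b, exists k : K, rad (b * eps - k *: eps).
Hypothesis eps_square : rad (eps * eps - eps).
Hypothesis psi_eps : psi (tmul (coroot_ i) eps) = m%:R.

Lemma f_idempotent_nilpotent : iter m.+1 (act (cur f_ eps)) v = 0.
Proof.
apply: (string_singular_eq0 (N := m)) => [|b].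
  apply: lower_weight_space_eq (lower_weight_iter m.+1 eps highest_weight_space) _ => j.
  by rewrite add0r.
have [k hk] := eps_residue b.
pose F := act (cur f_ eps) : V -> V.
pose H := act (cur (hbar_tau B (coroot_ i)) (b * eps)) : V -> V.
have FZ (t : K) w : F (t *: w) = t *: F w by exact: linearZ.
(* Modulo the radical b eps^2 is k eps^2, hence k eps. Congruent elements are known to agree only on
   v; commuting the f's carries this to F^q v. *)
have fbe q : act (cur f_ (b * eps * eps)) (iter q F v) = k *: iter q.+1 F v.
  elim: q => [|q IH]; last by rewrite iterS f_commute IH [RHS]/= linearZ.
  rewrite /= [LHS](_ : _ = act (cur f_ (k *: (eps * eps))) v).
    rewrite (linear_mapZ _ _ (cur_linearr _)) actZl; congr (_ *: _).
    by rewrite (@f_congruent _ eps 1) ?scale1r.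
  rewrite -[RHS]scale1r; apply: f_congruent; rewrite scale1r scalerAl -mulrBl mulrC.
  exact: radMl.
(* This is k times the sl2-formula, so the coefficient in [string_commutator] is proportional to k
   (m - q) and vanishes at q = m for every b. *)
have Hq q : H (iter q F v) = (k * m%:R - 2 * k * q%:R) *: iter q F v.
  elim: q => [|q IH].
    rewrite /H v_weight mulr0 subr0; congr (_ *: _).
    by rewrite -[b * eps](subrK (k *: eps)) addrC psi_tmulP (psi_rad hk) addr0 psi_eps.
  rewrite iterS [LHS]act_hf -/F -/H IH fbe FZ scalerA -scalerBl.
  by congr (_ *: _); rewrite -natr1; ring.
have EF w : act (cur e_ b) (F w) = F (act (cur e_ b) w) + H w by exact: act_ef.
have := string_commutator (E := act (cur e_ b)) (F := act (cur f_ eps)) EF Hq m.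
rewrite subrr mulr0 scale0r addr0 => e.
transitivity (iter m.+1 F (act (cur e_ b) v)); first exact: e.
by rewrite e_highest; exact: (iter_linear0 (act (cur f_ eps))).
Qed.

End Idempotent.

Lemma f_one_nilpotent (k : nat) (eps : 'I_k -> A) :
  (forall (j : 'I_k) b, exists t : K, rad (b * eps j - t *: eps j)) ->
  (forall j : 'I_k, rad (eps j * eps j - eps j)) -> rad (1 - \sum_j eps j) ->
  (forall j : 'I_k, exists m : nat, psi (tmul (coroot_ i) (eps j)) = m%:R) ->
  exists n, iter n (act (cur f_ 1)) v = 0.
Proof.
move=> res sq sum int.
have [n hn] : exists n, iter n (act (cur f_ (\sum_j eps j))) v = 0.
  elim/big_ind: _ => [|a b [n hn] [n' hn']|j _].
  - by exists 1%N; rewrite /= (linear_map0 (cur_linearr _)) act0l.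
  - exists (n + n')%N.
    have -> : act (cur f_ (a + b)) = act (cur f_ a) \+ act (cur f_ b) :> (V -> V).
      apply/funext => w /=; rewrite -actDl; congr act.
      by have := cur_linearr f_ 1 a b; rewrite !scale1r.
    by apply: nilpotent_sum_commuting => // w; exact: f_commute.
  - have [m hm] := int j; exists m.+1.
    exact: f_idempotent_nilpotent (res j) (sq j) hm.
(* The remainder 1 - sum_j eps_j is in the radical, so its f kills v in one step; it commutes with
   the f of the sum. *)
exists (1 + n)%N.
have -> : act (cur f_ 1) =
    act (cur f_ (1 - \sum_j eps j)) \+ act (cur f_ (\sum_j eps j)) :> (V -> V).
  apply/funext => w /=; rewrite -actDl; congr act.
  by have := cur_linearr f_ 1 (1 - \sum_j eps j) (\sum_j eps j); rewrite !scale1r subrK.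
apply: nilpotent_sum_commuting => //= [w|]; first exact: f_commute.
exact: f_radical.
Qed.

End SimpleRoot.
End Integrability.

(** * Dominant integral highest weights and integrability *)

Section DominantIntegral.
Variables (K : numClosedFieldType) (g : finLieType K) (B : inv_form g).
Variables (T : triangular g) (beta : dual (cartan T)).
Hypothesis beta_highest : highest_root beta.
Variables (A : comAlgType K) (V : lieModType (current (tau B) A)).
Hypothesis V_irr : irreducible V.
Variables (psi : tau0A T A -> K) (v : V).
Hypotheses (psi_linear : scalar psi) (v_neq0 : v <> 0).
Hypothesis v_weight : forall u a, act (cur (hbar_tau B u) a) v = psi (tmul u a) *: v.
Hypothesis v_plus : forall y, tau_plusA T y -> act y v = 0.
Variable I : set A.
Hypothesis I_cofinite : cofinite_ideal I.
Hypothesis psi_dominant : dominant_integral B beta psi I.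

Local Notation index := (option 'I_(rank T)).
Local Notation cw := (coord_weight beta).
Local Notation root_ := (affine_root beta).
Local Notation coroot_ := (affine_coroot B beta).
Local Notation W := (weight_space (V := V)).
Local Notation Wl := (lower_weight_space (V := V) beta psi).
Local Notation is_wt := (is_weight beta V psi).

Let htilde_coroot i : htilde (coroot_ i).
Proof. by case: i. Qed.

Let psi_rad i a : radical I a -> psi (tmul (coroot_ i) a) = 0.
Proof. by move=> ra; apply: psi_dominant.1. Qed.

Lemma dominant_idempotents : exists (k : nat) (e : 'I_k -> A), [/\
  forall a b, radical I b -> radical I (a * b),
  forall (j : 'I_k) b, exists t : K, radical I (b * e j - t *: e j),
  forall j, radical I (e j * e j - e j), radical I (1 - \sum_j e j) &
  forall i j, exists m : nat, psi (tmul (coroot_ i) (e j)) = m%:R].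
Proof.
have [_ [k [M [e [[maxM _] radE emod int]]]]] := psi_dominant.
exists k, e; split.
- exact: radicalMl maxM radE.
- by move=> j b; exact: (idempotent_residue I_cofinite maxM radE emod).
- by move=> j; exact: (idempotent_square maxM radE emod).
- exact: (idempotents_sum maxM radE emod).
- by move=> [i|] j; have [h0 hS] := int j; [exact: hS|].
Qed.

(** The idempotents add up to 1 modulo the radical, on which psi vanishes, so the value at h (x) 1
    is the sum of the integers at the h (x) e_j. *)
Lemma dominant_highest_weight i : exists m : nat,
  highest_weight psi (coroot_ i) = m%:R.
Proof.
have [k [e [_ _ _ sum int]]] := dominant_idempotents.
have [m hm] := choice (int i); exists (\sum_j m j)%N.
rewrite /highest_weight -[1](subrK (\sum_j e j)) -[1 - _]scale1r.
rewrite (psi_tmulP psi_linear) psi_rad // mulr0 add0r natr_sum.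
elim/big_rec2: _ => [|j a b _ <-].
  by have := psi_tmulP psi_linear (coroot_ i) (-1) 0 0; rewrite scaler0 addr0 mulN1r addNr.
by rewrite -hm -[in LHS](scale1r (e j)) (psi_tmulP psi_linear) mul1r.
Qed.

Lemma lower_weights_reflection (m : index -> nat) (a : index -> index -> int) c i :
  (forall i, highest_weight psi (coroot_ i) = (m i)%:R) ->
  (forall i j, (root_ j (coroot B (root_ i)) : K) = (a i j)%:~R) ->
  is_wt c -> weight_pairing m a c i < 0 ->
  is_wt (fun j => c j + weight_pairing m a c i * (j == i)%:Z).
Proof.
move=> hm ha wc neg.
have [k [e [radM res sq sum int]]] := dominant_idempotents.
have [x [y [hx x0 hy exy]]] := chevalley_vectors B beta_highest i.
have nil := f_one_nilpotent beta_highest V_irr psi_linear v_neq0 v_weight v_plus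
  hx x0 hy exy radM (@psi_rad i) res sq sum (int i).
have nilV := f_locally_nilpotent beta_highest V_irr v_neq0 hy nil.
exact: (weight_reflection beta_highest hx hy exy nilV (hm i) (ha i) wc neg).
Qed.

(* A real root has positive norm, so the weights mu + N alpha leave the set of
   weights, on which the norm is bounded by that of the highest weight. *)
Lemma real_root_leaves alpha n c : is_root alpha -> exists N : nat,
  forall w, W (fun u => highest_weight psi u - cw c u
    + N%:R * affine_weight alpha n u) w -> w = 0.
Proof.
move=> ra; have [m hm] := choice dominant_highest_weight.
have [a [d [ha a2 d0 dsym q0]]] := affine_cartan_matrix B beta_highest.
have [ca [eca _ _]] := affine_coordinates B beta_highest n (or_intror ra).
(* Raising a weight by alpha + n delta subtracts [ca] from c; the ray therefore has direction - ca,
   whose finite part is the root - alpha. *)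
have shift N u : highest_weight psi u - cw c u + N%:R * affine_weight alpha n u =
    highest_weight psi u - cw (fun i => c i + N%:Z * (-1 * ca i)) u.
  rewrite coord_weightD coord_weightM coord_weightM eca.
  by rewrite rmorphN1 mulN1r mulrN -pmulrn; move: (cw c u) => z; rewrite opprD opprK addrA.
have [wc|nwc] := pselect (is_wt c); last first.
  exists 0%N => w hw; apply: contrapT => w0; apply: nwc; exists w; split=> // u.
  by rewrite hw mul0r addr0.
have e : \sum_i (-1 * ca i)%:~R *: root_ i = - alpha.
  have [<- _] := affine_weight_inj eca; rewrite -sumrN; apply: eq_bigr => i _.
  by rewrite mulN1r rmorphN scaleNr.
have [N hN] := lattice_ray_leaves d0 a2 dsym
  (is_weight_ge0 beta_highest V_irr v_neq0 v_weight v_plus)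
  (fun c' i => @lower_weights_reflection m a c' i hm ha) wc
  (q0 _ _ (root_opp B ra) e).
exists N => w hw; apply: contrapT => w0; apply: hN; exists w; split=> // u.
by rewrite hw shift.
Qed.

Lemma lower_weights_span w : lspan (\bigcup_c Wl c) w.
Proof.
have hv : W (highest_weight psi) v by move=> u; exact: v_weight.
have sv := highest_weight_singular v_plus.
have := singular_generates beta_highest V_irr v_neq0 hv sv w.
apply; first exact: lspan_subspace.
move=> w' [_ [c [_ ->]] hw']; apply: lspan_sub; exists c => //.
Qed.

Lemma lower_weight_scalar c : scalar (fun u => highest_weight psi u - cw c u).
Proof.
move=> t u u'; rewrite /highest_weight /coord_weight /affine_weight.
have -> : psi (tmul (t *: u + u') 1) = t * psi (tmul u 1) + psi (tmul u' 1).
  by rewrite -psi_linear; congr psi; exact: pure_linearl.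
set gamma := \sum_i _.
have -> : (gamma (t *: u + u').1.1 : K) = t * (gamma u.1.1 : K) + (gamma u'.1.1 : K).
  exact: (linearP gamma t u.1.1 u'.1.1).
have -> : ((t *: u + u').2 : K) = t * (u.2 : K) + (u'.2 : K) by [].
ring.
Qed.

Lemma dominant_integrable : fin_dim_weight_spaces T V -> integrable T V.
Proof.
move=> fin; split=> //.
  split=> [w|n lam w _ inj hw].
    have := lower_weights_span w; apply; first exact: lspan_subspace.
    move=> w' [c _ hw']; apply: lspan_sub; eexists; last exact: hw'.
    exact: lower_weight_scalar.
  exact: (distinct_eigenvectors (T := fun u => act (cur (hbar_tau B u) 1)) inj hw).
move=> w alpha n a ra.
have := lower_weights_span w.
(* N must be chosen before x. This is possible because [real_root_leaves] bounds weights, not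
   vectors. The condition defines a subspace, so weight vectors suffice. *)
move=> /(_ [set w | exists N, forall x, root_space alpha x ->
  iter N (act (cur (tX B n x) a)) w = 0]); apply.
  split=> [|t u u' [N hN] [N' hN']]; first by exists 0%N.
  exists (N + N')%N => x hx; rewrite iter_linear.
  rewrite (iter_le0 (leq_addr N' N) (hN x hx)).
  by rewrite (iter_le0 (leq_addl N N') (hN' x hx)) scaler0 addr0.
move=> w' [c _ hw']; have [N hN] := real_root_leaves n c ra.
exists N => x hx; apply: hN; elim: N => [|N IH] u.
  by rewrite mul0r addr0 hw'.
rewrite iterS (act_homogeneous a (homogeneous_tX B n hx) IH); congr (_ *: _).
move: (affine_weight alpha n u) (cw c u) => p q.
by rewrite -natr1 mulrDl mul1r addrA.
Qed.

End DominantIntegral.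

Theorem theorem2p3 (R : realType) (g : finLieType R[i]) (simple_g : simple_lie g)
    (B : inv_form g) (T : triangular g) (beta : dual (cartan T))
    (beta_highest : highest_root beta)
    (A : comAlgType R[i]) (A_fg : finitely_generated A)
    (psi : tau0A T A -> R[i]) (psi_linear : scalar psi)
    (V : lieModType (current (tau B) A)) (V_psi : is_irr_hw psi V)
    (V_fin : fin_dim_weight_spaces T V)
    (I : set A) (I_cofinite : cofinite_ideal I)
    (psi_L0 : forall a, I a -> psi (tmul (hbarL0 T) a) = 0)
    (psi_htilde : forall u a, htilde u -> radical I a -> psi (tmul u a) = 0)
    (psi_dominant : dominant_integral B beta psi I) :
  integrable T V.
Proof.
have [v [v_neq0 v_weight v_plus]] := highest_weight_vector psi_linear V_psi.
exact: (dominant_integrable beta_highest V_psi.1 psi_linear v_neq0 v_weight v_plus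
  I_cofinite psi_dominant V_fin).
Qed.
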